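(* Let $\mathcal Z$ be a pointed matched circle with $4k$ points $\mathbf a$, let $\mathcal H(\mathcal Z)=H_*(\mathcal A(\mathcal Z))$, and let $\mathbf s,\mathbf t\subset[2k]$. The degree $(\ell,h)$ part of $I(\mathbf s)\cdot\mathcal H(\mathcal Z)\cdot I(\mathbf t)$ is trivial unless all of the following conditions hold: \begin{enumerate} \item The homology class $h\in H_1(Z\setminus z,\mathbf a)$ is compatible with $I(\mathbf s)$ and $I(\mathbf t)$, i.e. $M_*(\partial h)=\mathbf t-\mathbf s$. \item The local multiplicities of $h$ are all $0$ or $1$. \item If $p_1,p_2\in\mathbf a$ are matched points (so $M(p_1)=M(p_2)$), $p_1\in\mathrm{Int}(\mathrm{supp}(h))$ and $p_2\notin\mathrm{Int}(\mathrm{supp}(h))$, then $M(p_1)\notin\mathbf s\cap\mathbf t$. \item The Maslov degree $\ell$ is minimal among all (non-zero, homogeneous) elements of $I(\mathbf s)\cdot\mathcal A(\mathcal Z)\cdot I(\mathbf t)$ with associated one-chain $h$. \end{enumerate} Furthermore, for every $(\ell,h)$, $I(\mathbf s)$ and $I(\mathbf t)$ satisfying these conditions, the degree $(\ell,h)$ part of $I(\mathbf s)\cdot\mathcal H(\mathcal Z)\cdot I(\mathbf t)$ is 1-dimensional over $\mathbb F_2$, and is represented by any crossingless diagram of the correct grading (i.e. any basic element $E(S,T,\phi)$ in $I(\mathbf s)\mathcal A(\mathcal Z)I(\mathbf t)$ of degree $(\ell,h)$ with no inversions).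
   Context: Everything is over $\mathbb F_2$. A pointed matched circle $\mathcal Z$ is an oriented circle $Z$ with a basepoint $z$, a set $\mathbf a\subset Z\setminus\{z\}$ of $4k$ points, and a partition $M$ of $\mathbf a$ into $2k$ pairs such that surgery on $Z$ along all the pairs gives a connected 1-manifold. Cutting $Z$ at $z$ identifies $\mathbf a$ with $[4k]=\{1,\dots,4k\}$; $[2k]=[4k]/M$ and $M(p)\in[2k]$ denotes the class of $p$; $x\mapsto x'$ exchanges matched points, $S'=\{x':x\in S\}$. $\mathcal A(n,m)$ has basis the triples $(S,T,\phi)$, $S,T\subset[n]$, $|S|=|T|=m$, $\phi\colon S\to T$ a bijection with $\phi(x)\ge x$. With $\mathrm{inv}(\phi)=\#\{i<j:\phi(i)>\phi(j)\}$ (number of inversions, or crossings), $(S_1,T_1,\phi_1)(S_2,T_2,\phi_2)=(S_1,T_2,\phi_2\phi_1)$ if $T_1=S_2$ and $\mathrm{inv}(\phi_2\phi_1)=\mathrm{inv}(\phi_1)+\mathrm{inv}(\phi_2)$, else $0$; $\partial(S,T,\phi)=\sum(S,T,\phi_\sigma)$ over inversions $\sigma=(i,j)$ with $\mathrm{inv}(\phi_\sigma)=\mathrm{inv}(\phi)-1$, $\phi_\sigma$ being $\phi$ with values at $i,j$ exchanged. $E(S,T,\phi)=\sum_{\mathbf i}((S\setminus\mathbf i)\cup\mathbf i',(T\setminus\mathbf i)\cup\mathbf i',\phi_{\mathbf i})$ over sets $\mathbf i$ of fixed points of $\phi$, $\phi_{\mathbf i}$ the identity on $\mathbf i'$ and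 $\phi$ elsewhere. $\mathcal A(\mathcal Z,i)\subset\mathcal A(4k,k+i)$ is the dg subalgebra spanned by the basic elements $E(S,T,\phi)$ with $S\cap S'=T\cap T'=\emptyset$; $\mathcal A(\mathcal Z)=\bigoplus_{i=-k}^k\mathcal A(\mathcal Z,i)$. For $\mathbf s\subset[2k]$, $I(\mathbf s)=E(S,S,\mathrm{id})$ with $S$ any set of representatives of $\mathbf s$. Gradings: for $\alpha\in H_1(Z\setminus z,\mathbf a)$ and $p\in\mathbf a$, $m(\alpha,p)$ is the average of the multiplicities of $\alpha$ just above and just below $p$, extended bilinearly to $H_0(\mathbf a)$. A basic element $a=E(S,T,\phi)$ has associated one-chain $[a]=\sum_{x\in S}[x,\phi(x)]\in H_1(Z\setminus z,\mathbf a)$ and degree $(\iota(a),[a])$ with Maslov component $\iota(a)=\mathrm{inv}(\phi)-m([a],S)\in\frac12\mathbb Z$ (the same for each term of $E(S,T,\phi)$). The differential preserves $[a]$ and lowers the Maslov component by $1$, so the homology inherits a decomposition into degrees $(\ell,h)$. $M_*\colon\mathbb Z\langle\mathbf a\rangle\to\mathbb Z\langle[2k]\rangle$ is induced by $M$, and subsets of $[2k]$ are viewed as elements of $\mathbb Z\langle[2k]\rangle$. $\mathrm{supp}(h)$ is the closed union of the intervals where $h$ is non-zero. *)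

(* Defs.v *)
From HB Require Import structures.
From mathcomp Require Import all_boot all_order all_algebra.

Set Implicit Arguments.
Unset Strict Implicit.
Unset Printing Implicit Defensive.

Import Order.TTheory GRing.Theory Num.Theory.
Local Open Scope ring_scope.

(** * Pointed matched circles *)

(* Cutting the circle at the basepoint orders the marked points: 'I_n stands
   for {1, ..., n}, shifted down by one.  A matching is the quotient map
   M from points to pairs. *)

Definition partner n m (M : 'I_n -> 'I_m) (p : 'I_n) : 'I_n :=
  odflt p [pick q | (q != p) && (M q == M p)].

(* The arcs of the circle minus the marked points are labelled by their initial
   points; the arc of the last point contains the basepoint.  Oriented surgery
   along all pairs glues the end of the arc p, which is the point ordS p, to
   the beginning of the arc that starts at the partner of ordS p. *)
Definition surgery_next n m (M : 'I_n -> 'I_m) (p : 'I_n) : 'I_n :=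
  partner M (ordS p).

Record pointed_matched_circle (k : nat) := PointedMatchedCircle {
  pairing :> 'I_(4 * k) -> 'I_(2 * k);
  pairing_card2 : forall c, #|[set p | pairing p == c]| = 2%N;
  surgery_connected : forall p q, fconnect (surgery_next pairing) p q
}.

Notation pmc := pointed_matched_circle.

(** * The strands algebra *)

Section StrandsAlgebra.

Variable n : nat.

Local Notation strand := ('I_n * 'I_n)%type.

(* A triple (S, T, phi) is encoded by the graph g of phi. *)
Definition is_diagram (g : {set strand}) : bool :=
  [forall p in g, (p.1 <= p.2)%N] &&
  [forall p in g, forall q in g, (p.1 == q.1) == (p.2 == q.2)].

Definition diagram := {g : {set strand} | is_diagram g}.

Implicit Types (g : {set strand}) (a b c : diagram).

Definition src a : {set 'I_n} := [set p.1 | p in val a].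
Definition tgt a : {set 'I_n} := [set p.2 | p in val a].

Definition inversions g : {set strand * strand} :=
  [set s | [&& s.1 \in g, s.2 \in g, (s.1.1 < s.2.1)%N & (s.2.2 < s.1.2)%N]].
Definition num_inv g : nat := #|inversions g|.

(* The graph of phi_2 \o phi_1, if g1 and g2 are the graphs of phi_1 and phi_2. *)
Definition comp_graph (g1 g2 : {set strand}) : {set strand} :=
  [set p | [exists y, ((p.1, y) \in g1) && ((y, p.2) \in g2)]].

Definition swap_graph g (s : strand * strand) :
    {set strand} :=
  (s.1.1, s.2.2) |: ((s.2.1, s.1.2) |: (g :\ s.1 :\ s.2)).

(* The direct sum over m of the A(n, m): the F_2-vector space on all diagrams. *)
Definition strands := {ffun diagram -> ('F_2)^o}.
HB.instance Definition _ := Vector.on strands.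

(* The basis element with graph g; it is 0 if g is not a diagram, but g always
   is one where this is used for products and differentials, and for E(a) as
   soon as S and S', and T and T', are disjoint. *)
Definition gen g : strands := [ffun c : diagram => (val c == g)%:R].

Definition smul (x y : strands) : strands :=
  \sum_a \sum_(b | (tgt a == src b) &&
                   (num_inv (comp_graph (val a) (val b)) ==
                      num_inv (val a) + num_inv (val b))%N)
     ((x a : 'F_2) * (y b : 'F_2)) *: gen (comp_graph (val a) (val b)).

Definition sdiff (x : strands) : strands :=
  \sum_a (x a : 'F_2) *:
    \sum_(s in inversions (val a) |
             (num_inv (swap_graph (val a) s)).+1 == num_inv (val a))
       gen (swap_graph (val a) s).

Lemma smul_linearr x : linear (smul x).
Proof.
move=> l y z; rewrite /smul scaler_sumr -big_split; apply: eq_bigr => a _ /=.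
rewrite scaler_sumr -big_split; apply: eq_bigr => b _ /=.
by rewrite !ffunE mulrDr scalerDl scalerA mulrCA.
Qed.

Lemma smul_linearl y : linear (smul^~ y).
Proof.
move=> l x z; rewrite /smul scaler_sumr -big_split; apply: eq_bigr => a _ /=.
rewrite scaler_sumr -big_split; apply: eq_bigr => b _ /=.
by rewrite !ffunE mulrDl scalerDl scalerA mulrA.
Qed.

Lemma sdiff_linear : linear sdiff.
Proof.
move=> l x y; rewrite /sdiff scaler_sumr -big_split; apply: eq_bigr => a _ /=.
by rewrite !ffunE scalerDl scalerA.
Qed.

(** * Gradings *)

(* H_1(Z \ z, a): the index j is the interval from point j to point j + 1. *)
Definition chain := {ffun 'I_n.-1 -> int}.

Definition interval_chain (x y : 'I_n) : chain :=
  [ffun j : 'I_n.-1 => ((x <= j) && (j < y))%N%:R].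

Definition chain_of a : chain := \sum_(p in val a) interval_chain p.1 p.2.

(* Multiplicities next to p; both sums have at most one term and are empty
   when the region in question is adjacent to the basepoint. *)
Definition mult_above (h : chain) (p : 'I_n) : int :=
  \sum_(j < n.-1 | val j == val p) h j.
Definition mult_below (h : chain) (p : 'I_n) : int :=
  \sum_(j < n.-1 | (val j).+1 == val p) h j.

(* m(h, p) *)
Definition avg_mult (h : chain) (p : 'I_n) : rat :=
  (mult_above h p + mult_below h p)%:~R / 2%:R.

(* iota(a) *)
Definition maslov a : rat :=
  (num_inv (val a))%:R - \sum_(p in src a) avg_mult (chain_of a) p.

(* The coefficient of p in the 0-chain \partial h. *)
Definition chain_bnd (h : chain) (p : 'I_n) : int :=
  mult_below h p - mult_above h p.

Definition in_int_supp (h : chain) (p : 'I_n) : bool :=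
  (mult_above h p != 0) && (mult_below h p != 0).

End StrandsAlgebra.

(** * The algebra of a pointed matched circle *)

Section PMCAlgebra.

Variables (k : nat) (Z : pmc k).

Local Notation point := 'I_(4 * k).
Local Notation diagram := (diagram (4 * k)).
Local Notation strands := (strands (4 * k)).
Local Notation chain := (chain (4 * k)).

Implicit Types (a : diagram) (s t : {set 'I_(2 * k)}) (l : rat) (h : chain).

(* S' *)
Definition primed (S : {set point}) : {set point} := [set partner Z x | x in S].

Definition fixed_points a : {set point} := [set x | (x, x) \in val a].

Definition move_graph a (i : {set point}) : {set point * point} :=
  (val a :\: [set (x, x) | x in i]) :|: [set (x, x) | x in primed i].

Definition E a : strands :=
  \sum_(i : {set point} | i \subset fixed_points a) gen (move_graph a i).

(* Indexes a basic element E(a) of the algebra of Z. *)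
Definition is_basic a : bool :=
  (src a :&: primed (src a) == set0) && (tgt a :&: primed (tgt a) == set0).

(* A(Z, i), where m = k + i is the number of strands. *)
Definition pmc_alg_strands (m : nat) : {vspace strands} :=
  <<[seq E a | a <- enum [pred a | is_basic a && (#|val a| == m)]]>>%VS.

Definition pmc_alg : {vspace strands} :=
  (\sum_(m < (2 * k).+1) pmc_alg_strands m)%VS.

(* I(s), computed from the representatives of s that come first in each pair. *)
Definition first_reps s : {set point} :=
  [set p | (Z p \in s) && (p < partner Z p)%N].

Lemma idem_diagramP s : is_diagram [set (p, p) | p in first_reps s].
Proof.
apply/andP; split; first by apply/forall_inP => _ /imsetP[p _ ->].
apply/forall_inP => _ /imsetP[p _ ->].
by apply/forall_inP => _ /imsetP[q _ ->] /=.
Qed.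

Definition idem s : strands := E (Sub [set (p, p) | p in first_reps s] (idem_diagramP s)).

Definition idem_alg s t : {vspace strands} :=
  (linfun (fun x => smul (smul (idem s) x) (idem t)) @: pmc_alg)%VS.

(* The homogeneous part of A(Z) of degree (l, h). *)
Definition deg_part l h : {vspace strands} :=
  <<[seq E a | a <- enum [pred a | [&& is_basic a, maslov a == l
                                      & chain_of a == h]]]>>%VS.

(** * Homology *)

Definition cycles : {vspace strands} :=
  (pmc_alg :&: lker (linfun (@sdiff (4 * k))))%VS.
Definition boundaries : {vspace strands} :=
  (linfun (@sdiff (4 * k)) @: pmc_alg)%VS.

(* The quotient by the boundaries is realized as the image of a linear map cls
   whose kernel is the space of boundaries (see lker_cls); cls x is the homology
   class of the cycle x. *)
Definition cls : 'End(strands) := daddv_pi (boundaries^C)%VS boundaries.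

Lemma lker_cls : lker cls = boundaries.
Proof.
have d0 : (boundaries :&: boundaries^C = 0)%VS by apply: capv_compl.
have d0' : (boundaries^C :&: boundaries = 0)%VS by rewrite capvC.
have dec x : cls x + daddv_pi boundaries (boundaries^C) x = x.
  by apply: daddv_pi_add => //; rewrite addvC addv_complf memvf.
apply/vspaceP => x; rewrite memv_ker; apply/idP/idP => [/eqP x0|xB].
  by rewrite -[x]dec x0 add0r memv_pi.
have := dec x; rewrite (daddv_pi_id d0 xB) => /(canRL (addrK _)) ->.
by rewrite subrr.
Qed.

Definition homology : {vspace strands} := (cls @: cycles)%VS.

Definition hmul (u v : strands) : strands := cls (smul u v).

Definition homology_deg l h : {vspace strands} :=
  (cls @: (cycles :&: deg_part l h))%VS.

(* I(s) H(Z) I(t) *)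
Definition idem_homology s t : {vspace strands} :=
  (linfun (fun u => hmul (hmul (cls (idem s)) u) (cls (idem t))) @: homology)%VS.

Definition idem_homology_deg s t l h : {vspace strands} :=
  (idem_homology s t :&: homology_deg l h)%VS.

(** * The conditions on (l, h) *)

(* M_* (\partial h) = t - s *)
Definition compatible s t h : Prop :=
  forall c, \sum_(p | Z p == c) chain_bnd h p = (c \in t)%:R - (c \in s)%:R.

Definition multiplicities01 h : Prop := forall j, h j = 0 \/ h j = 1.

Definition matched_interior_cond s t h : Prop :=
  forall p1 p2 : point, Z p1 = Z p2 ->
    in_int_supp h p1 -> ~~ in_int_supp h p2 -> Z p1 \notin s :&: t.

(* In particular l is attained. *)
Definition maslov_minimal s t l h : Prop :=
  (exists2 x, x \in (idem_alg s t :&: deg_part l h)%VS & x != 0) /\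
  (forall l' x, x \in (idem_alg s t :&: deg_part l' h)%VS -> x != 0 -> l <= l').

Definition homology_conditions s t l h : Prop :=
  [/\ compatible s t h, multiplicities01 h, matched_interior_cond s t h
    & maslov_minimal s t l h].

End PMCAlgebra.

(* Main.v *)
Require Import Defs.
From HB Require Import structures.
From mathcomp Require Import all_boot all_order all_fingroup all_algebra.
From mathcomp Require Import zify lra.

Set Implicit Arguments.
Unset Strict Implicit.
Unset Printing Implicit Defensive.

Import Order.TTheory GRing.Theory Num.Theory.
Local Open Scope ring_scope.

(** Why the theorem holds.  The algebra is a differential algebra ([leibniz],
    [sdiff_sdiff]), so the summand of the homology between two idempotents is the
    homology of the complex spanned by the basic elements from s to t with chain h
    ([idem_homology_degP]).  In such an element the pairs of s :&: t at which the
    boundary of h vanishes are in one of three states: the pair carries a constant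
    strand, or a strand ends and another one starts at one of its two points (a
    break).  The differential resolves crossings of two moving strands, and
    crossings of a moving strand with a constant one, which creates a break.

    If h has a multiplicity at least two, the two lowest strands over an arc of that
    multiplicity can be crossed or uncrossed, which is a perfect matching of the
    basic elements and makes the complex acyclic ([acyclic_multiplicity]).

    If all multiplicities are zero or one, moving strands do not cross each other,
    and the complex is a tensor product over the pairs.  A pair without points in
    the interior of the support contributes its constant state only.  A pair with
    one interior point contributes two states and the differential takes the
    constant one to the break, so the complex is acyclic.  A pair with two interior
    points contributes three states and the differential takes the constant one to
    the sum of the two breaks; the homology is spanned by either break.  Hence the
    homology is nonzero iff no pair has exactly one interior point, and then it is
    spanned by the crossingless elements, which are all homologous and have the
    least Maslov degree, because Maslov degree and number of crossings differ by a
    constant ([maslov_num_inv]).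

    The tensor product is not constructed.  Instead a discrete Morse argument
    ([morse]) matches, in the first pair that is not yet broken at a prescribed
    point, the other break with the constant state ([critical_representative]).
    Choosing the prescribed points to be the break points of a given crossingless
    element, that element is the only critical one.

    Throughout, an element is handled through its coefficients, as a function on
    strand diagrams; it belongs to the algebra iff the function is supported on
    basic diagrams and is invariant under moving a constant strand to the matched
    point ([pmc_algP]). *)

(** * Inversions of injections between ordered sets *)

Section InversionCount.

Variable n : nat.
Implicit Types (S T : {set 'I_n}) (f g : 'I_n -> 'I_n) (i j x y : 'I_n).

Definition inv_pairs S f : {set 'I_n * 'I_n} :=
  [set p | [&& p.1 \in S, p.2 \in S, (p.1 < p.2)%N & (f p.2 < f p.1)%N]].
Definition inv_count S f : nat := #|inv_pairs S f|.

Lemma eq_inv S f g : {in S, f =1 g} -> inv_count S f = inv_count S g.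
Proof.
move=> fg; apply: eq_card => -[x y]; rewrite !inE /=.
by case xS: (x \in S); case yS: (y \in S) => //=; rewrite !fg.
Qed.

Lemma tperm_stable S i j x : i \in S -> j \in S -> (tperm i j x \in S) = (x \in S).
Proof. by move=> iS jS; case: tpermP => [->|->|]; rewrite ?iS ?jS. Qed.

(* The transport of an inversion of f \o tperm i j to an inversion of f: the
   transposition is applied to the pair unless that would reverse it. *)
Let push i j (p : 'I_n * 'I_n) : 'I_n * 'I_n :=
  let q := (tperm i j p.1, tperm i j p.2) in
  if (q.1 < q.2)%N then q else p.

Lemma push_inj i j : {in [pred p : 'I_n * 'I_n | (p.1 < p.2)%N] &, injective (push i j)}.
Proof.
move=> [x y] [x' y']; rewrite !inE /push /= => lxy lxy'.
case: ifP => h1; case: ifP => h2 // [].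
- by move=> /perm_inj -> /perm_inj ->.
- by move=> e1 e2; move: h2; rewrite -e1 -e2 !tpermK lxy.
- by move=> e1 e2; move: h1; rewrite e1 e2 !tpermK lxy'.
Qed.

(** The transported inversions all differ from (i, j), which is lost. *)
Lemma inv_swap_lt S f i j : i \in S -> j \in S -> (i < j)%N -> (f j < f i)%N ->
  (inv_count S (f \o tperm i j) < inv_count S f)%N.
Proof.
move=> iS jS lij fji.
have ijI : (i, j) \in inv_pairs S f by rewrite inE /= iS jS lij.
rewrite /inv_count (cardsD1 (i, j) (inv_pairs S f)) ijI add1n ltnS.
rewrite -[X in (X <= _)%N](card_in_imset (f := push i j)); last first.
  move=> p q; rewrite !inE => pI qI e.
  by apply: push_inj e; rewrite ?inE; [case/and4P: pI | case/and4P: qI].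
apply: subset_leq_card; apply/subsetP => _ /imsetP[[x y] + ->].
rewrite !inE /= => /and4P[xS yS lxy fxy]; rewrite /push /=.
case: ifP => h1 /=.
  rewrite !tperm_stable // xS yS h1 fxy /= andbT.
  apply/negP => /eqP[e1 e2]; have : x = j by rewrite -(tpermK i j x) e1 tpermL.
  have : y = i by rewrite -(tpermK i j y) e2 tpermR.
  by move=> ? ?; subst; lia.
rewrite xS yS lxy /= xpair_eqE.
move: h1 fxy.
case: (tpermP i j x) => [?|?|/eqP xi /eqP xj]; case: (tpermP i j y) => [?|?|/eqP yi /eqP yj]; subst;
  rewrite ?eqxx /= => *; try lia.
Qed.

(** The transport of inversions is onto all inversions other than (i, j) when no
    strand that starts between i and j also ends between their values. *)
Lemma inv_swap_eq S f i j : i \in S -> j \in S -> (i < j)%N -> (f j < f i)%N ->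
  (forall x, x \in S -> (i < x < j)%N -> ~~ (f j <= f x <= f i)%N) ->
  inv_count S f = (inv_count S (f \o tperm i j)).+1.
Proof.
move=> iS jS lij fji nobtw; apply/eqP; rewrite eqn_leq inv_swap_lt // andbT.
have ijI : (i, j) \in inv_pairs S f by rewrite inE /= iS jS lij.
rewrite /inv_count (cardsD1 (i, j) (inv_pairs S f)) ijI add1n ltnS.
rewrite -[X in (X <= _)%N](card_in_imset (f := push i j)); last first.
  move=> p q; rewrite !inE => pI qI e.
  by apply: push_inj e; rewrite ?inE; [case/and5P: pI | case/and5P: qI].
apply: subset_leq_card; apply/subsetP => _ /imsetP[[x y] + ->].
rewrite !inE /= => /and5P[nxy xS yS lxy fxy]; rewrite /push /=.
case: ifP => h1 /=; first by rewrite !tperm_stable // xS yS h1 !tpermK.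
rewrite xS yS lxy /=; move: h1 fxy nxy (nobtw x xS) (nobtw y yS); rewrite xpair_eqE.
case: (tpermP i j x) => [?|?|/eqP+ /eqP+]; case: (tpermP i j y) => [?|?|/eqP+ /eqP+]; subst;
  rewrite ?eqxx -?val_eqE //= => *; lia.
Qed.

(** Exchanging the values at i and j is the composite of three exchanges that
    involve x, and each of them removes an inversion. *)
Lemma inv_swap_between S f i j x : i \in S -> j \in S -> x \in S ->
  (i < x < j)%N -> (f j < f x < f i)%N -> ((inv_count S (f \o tperm i j)).+1 < inv_count S f)%N.
Proof.
move=> iS jS xS /andP[lix lxj] /andP[fjx fxi].
have nix : i != x by apply: contraTneq lix => ->; rewrite ltnn.
have nxj : x != j by apply: contraTneq lxj => ->; rewrite ltnn.
have nij : i != j by apply: contraTneq lxj => <-; rewrite -leqNgt ltnW.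
have t1 : tperm i x j = j by rewrite tpermD.
have t2 : tperm x j i = i by rewrite tpermD // eq_sym.
have h1 := inv_swap_lt iS xS lix fxi.
have h2 : (inv_count S (f \o tperm i x \o tperm x j) < inv_count S (f \o tperm i x))%N.
  by apply: inv_swap_lt => //=; rewrite tpermR t1; apply: ltn_trans fxi.
have h3 : (inv_count S (f \o tperm i x \o tperm x j \o tperm i x) < inv_count S (f \o tperm i x \o tperm x j))%N.
  by apply: inv_swap_lt => //=; rewrite t2 !tpermL t1.
rewrite (@eq_inv _ (f \o tperm i j) (f \o tperm i x \o tperm x j \o tperm i x)); first lia.
move=> z _ /=; congr f.
case: (tpermP i x z) => [->|->|/eqP zi /eqP zx].
- by rewrite !tpermL t1.
- by rewrite t2 tpermL tpermD // eq_sym.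
case: (tpermP x j z) => [zz|->|_ /eqP zj].
- by rewrite zz eqxx in zx.
- by rewrite !tpermR.
by rewrite !tpermD // eq_sym.
Qed.

(** A pair inverted by the composite is inverted by exactly one of the factors. *)
Lemma inv_comp S f g : {in S &, injective f} ->
  (inv_count S (g \o f) <= inv_count S f + inv_count (f @: S) g)%N.
Proof.
move=> f_inj.
pose I1 := inv_pairs S (g \o f) :&: inv_pairs S f.
rewrite /inv_count -(cardsID (inv_pairs S f)) leq_add //.
  by rewrite subset_leq_card // subsetIr.
rewrite -(card_in_imset (f := fun p : 'I_n * 'I_n => (f p.1, f p.2))).
  apply: subset_leq_card; apply/subsetP => _ /imsetP[[x y] + ->].
  rewrite !inE /= => /andP[+ /and4P[xS yS lxy gfxy]].
  rewrite xS yS lxy /= -leqNgt leq_eqVlt => nf.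
  rewrite !imset_f //= gfxy andbT.
  by case/orP: nf => // /eqP/val_inj/f_inj-/(_ xS yS) exy; rewrite exy ltnn in lxy.
move=> [x y] [x' y']; rewrite !inE /=.
move=> /andP[_ /and4P[xS yS _ _]] /andP[_ /and4P[xS' yS' _ _]].
by move=> [/f_inj-> // /f_inj->].
Qed.

End InversionCount.

(** * Strand diagrams as injections, and the differential *)

Section Coefficients.
Variable n : nat.
Implicit Types (u v : strands n) (c : diagram n).

Lemma strandsP u v : (forall c, u c = v c) -> u = v.
Proof. by move=> uv; apply/ffunP. Qed.

Lemma strandsD u v c : (u + v) c = u c + v c.
Proof. by rewrite ffunE. Qed.

Lemma strands0 c : (0 : strands n) c = 0.
Proof. by rewrite ffunE. Qed.

Lemma strandsZ (l : 'F_2) u c : (l *: u) c = l * (u c : 'F_2).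
Proof. by rewrite ffunE. Qed.

Lemma strands_sum I (r : seq I) (P : pred I) (F : I -> strands n) c :
  (\sum_(i <- r | P i) F i) c = \sum_(i <- r | P i) F i c.
Proof. by rewrite sum_ffunE. Qed.

End Coefficients.

Section DiagramsAsFunctions.

Variable n : nat.
Implicit Types (S T : {set 'I_n}) (f g : 'I_n -> 'I_n) (i j x y : 'I_n).
Implicit Types (a b c : diagram n).

(** Outside the source this is an arbitrary default value, the identity; all uses
    are restricted to the source. *)
Definition fn a x : 'I_n := odflt x [pick y | (x, y) \in val a].

Lemma diag_inj a p q : p \in val a -> q \in val a -> (p.1 == q.1) = (p.2 == q.2).
Proof.
case/andP: (valP a) => _ /forall_inP h pa qa.
by have /forall_inP/(_ _ qa)/eqP := h _ pa.
Qed.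

Lemma mem_diag a x y : ((x, y) \in val a) = (x \in src a) && (fn a x == y).
Proof.
apply/idP/andP => [xya|[]].
  split; first by apply/imsetP; exists (x, y).
  rewrite /fn; case: pickP => [z xza|/(_ y)]; last by rewrite xya.
  by rewrite /= -(diag_inj xza xya) eqxx.
case/imsetP => -[x' z] xza /= -> /eqP <-.
by rewrite /fn; case: pickP => [//|/(_ z)]; rewrite xza.
Qed.

Lemma fn_in a x : x \in src a -> (x, fn a x) \in val a.
Proof. by move=> xa; rewrite mem_diag xa eqxx. Qed.

Lemma fn_ge a x : x \in src a -> (x <= fn a x)%N.
Proof.
by move=> /fn_in xa; case/andP: (valP a) => /forall_inP/(_ _ xa).
Qed.

Lemma fn_inj a : {in src a &, injective (fn a)}.
Proof.
move=> x y /fn_in xa /fn_in ya e; apply/eqP.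
by have /= -> := diag_inj xa ya; rewrite e.
Qed.

Lemma mem_tgt a y : (y \in tgt a) = [exists x in src a, fn a x == y].
Proof.
apply/imsetP/exists_inP => [[[x z] xza /= ->]|[x xa /eqP <-]].
  by move: xza; rewrite mem_diag => /andP[xa e]; exists x.
by exists (x, fn a x) => //; apply: fn_in.
Qed.

Lemma tgtE a : tgt a = fn a @: src a.
Proof.
apply/setP => y; rewrite mem_tgt; apply/exists_inP/imsetP => -[x xa].
  by move=> /eqP <-; exists x.
by move=> ->; exists x.
Qed.

Lemma fn_tgt a x : x \in src a -> fn a x \in tgt a.
Proof. by move=> xa; rewrite tgtE imset_f. Qed.

Lemma diag_ext a b : src a = src b -> {in src a, fn a =1 fn b} -> a = b.
Proof.
move=> ss ff; apply/val_inj/setP => -[x y]; rewrite !mem_diag -ss.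
by case xa: (x \in src a) => //=; rewrite ff.
Qed.

Definition graph S f : {set 'I_n * 'I_n} := [set (x, f x) | x in S].

Lemma mem_graph S f x y : ((x, y) \in graph S f) = (x \in S) && (f x == y).
Proof.
apply/imsetP/andP => [[z zS [-> ->]]|[xS /eqP <-]]; first by rewrite zS eqxx.
by exists x.
Qed.

Lemma graphP S f : {in S, forall x, (x <= f x)%N} -> {in S &, injective f} ->
  is_diagram (graph S f).
Proof.
move=> f_ge f_inj; apply/andP; split.
  by apply/forall_inP => -[x y]; rewrite mem_graph => /andP[xS /eqP <-]; apply: f_ge.
apply/forall_inP => -[x y]; rewrite mem_graph => /andP[xS /eqP <-].
apply/forall_inP => -[x' y']; rewrite mem_graph => /andP[xS' /eqP <-] /=.
by apply/eqP; apply/eqP/eqP => [->|/f_inj->].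
Qed.

Lemma diag0P : is_diagram (set0 : {set 'I_n * 'I_n}).
Proof. by apply/andP; split; apply/forall_inP => p; rewrite inE. Qed.

Definition mkdiag S f : diagram n := insubd (Sub set0 diag0P) (graph S f).

Section MkDiag.
Variables (S : {set 'I_n}) (f : 'I_n -> 'I_n).
Hypotheses (f_ge : {in S, forall x, (x <= f x)%N}) (f_inj : {in S &, injective f}).

Lemma val_mkdiag : val (mkdiag S f) = graph S f.
Proof. by rewrite /mkdiag insubdK // -topredE /= graphP. Qed.

Lemma src_mkdiag : src (mkdiag S f) = S.
Proof.
rewrite /src val_mkdiag; apply/setP => x; apply/imsetP/idP => [[p]|xS].
  by case: p => y z; rewrite mem_graph => /andP[yS _] /= ->.
by exists (x, f x) => //; rewrite mem_graph xS eqxx.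
Qed.

Lemma fn_mkdiag : {in S, fn (mkdiag S f) =1 f}.
Proof.
move=> x xS; have := @fn_in (mkdiag S f) x; rewrite src_mkdiag => /(_ xS).
by rewrite val_mkdiag mem_graph xS => /eqP ->.
Qed.

End MkDiag.

Lemma num_invE a : num_inv (val a) = inv_count (src a) (fn a).
Proof.
rewrite /num_inv /inv_count.
pose F (p : 'I_n * 'I_n) := ((p.1, fn a p.1), (p.2, fn a p.2)).
rewrite -(card_imset (f := F) (inv_pairs (src a) (fn a))); last first.
  by move=> [x y] [x' y'] [-> _ ->].
apply: eq_card => -[[x y] [x' y']]; apply/idP/imsetP.
  rewrite inE /= !mem_diag => /and4P[/andP[xa /eqP<-] /andP[ya /eqP<-] h1 h2].
  by exists (x, x') => //; rewrite inE /= xa ya h1 h2.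
case=> -[z z']; rewrite inE /= => /and4P[h1 h2 h3 h4] [-> -> -> ->].
by rewrite inE /= !fn_in // h3 h4.
Qed.

(** Locked, so that comparing two exchanges does not unfold finite functions. *)
Fact swap_key : unit. Proof. by []. Qed.
Definition swap := locked_with swap_key
  (fun a i j => mkdiag (src a) (fn a \o tperm i j)).
Canonical swap_unlockable := [unlockable fun swap].

Definition swappable a i j :=
  [&& i \in src a, j \in src a, (i <= fn a j)%N & (j <= fn a i)%N].

Lemma swap_good a i j : swappable a i j ->
  {in src a, forall x, (x <= (fn a \o tperm i j) x)%N} /\
  {in src a &, injective (fn a \o tperm i j)}.
Proof.
case/and4P => ia ja h1 h2; split.
  by move=> x xa /=; case: tpermP => [->|->|] // _ _; apply: fn_ge.
move=> x y xa ya /= /fn_inj e; apply/(@perm_inj _ (tperm i j))/e;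
  by rewrite tperm_stable.
Qed.

Lemma src_swap a i j : swappable a i j -> src (swap a i j) = src a.
Proof. by rewrite unlock; case/swap_good => ? ?; rewrite src_mkdiag. Qed.

Lemma fn_swap a i j x : swappable a i j -> x \in src a ->
  fn (swap a i j) x = fn a (tperm i j x).
Proof. by rewrite [swap]unlock => /swap_good[? ?] ?; rewrite /= fn_mkdiag. Qed.

Lemma tgt_swap a i j : swappable a i j -> tgt (swap a i j) = tgt a.
Proof.
move=> sw; have /and4P[ia ja _ _] := sw; rewrite !tgtE src_swap //.
apply/setP => y; apply/imsetP/imsetP => -[x xa ->].
  by rewrite fn_swap //; exists (tperm i j x); rewrite ?tperm_stable.
exists (tperm i j x); first by rewrite tperm_stable.
by rewrite fn_swap ?tperm_stable // tpermK.
Qed.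

Lemma swappable_swap a i j : swappable a i j -> swappable (swap a i j) i j.
Proof.
move=> sw; have /and4P[ia ja h1 h2] := sw.
by rewrite /swappable !fn_swap // src_swap // ia ja tpermL tpermR !fn_ge.
Qed.

Lemma swapK a i j : swappable a i j -> swap (swap a i j) i j = a.
Proof.
move=> sw; have sw' := swappable_swap sw; have /and4P[ia ja _ _] := sw.
apply: diag_ext; first by rewrite !src_swap.
move=> x; rewrite !src_swap // => xa.
by rewrite !fn_swap ?src_swap ?tperm_stable // tpermK.
Qed.

Lemma inversion_swappable a i j : i \in src a -> j \in src a ->
  (i < j)%N -> (fn a j < fn a i)%N -> swappable a i j.
Proof.
move=> ia ja lij fji; rewrite /swappable ia ja /=.
by have := fn_ge ja; lia.
Qed.

Lemma num_inv_swap a i j : swappable a i j ->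
  num_inv (val (swap a i j)) = inv_count (src a) (fn a \o tperm i j).
Proof.
move=> sw; rewrite num_invE src_swap //; apply: eq_inv => x xa.
by rewrite fn_swap.
Qed.

Lemma swap_graphE a i j : i != j -> swappable a i j ->
  swap_graph (val a) ((i, fn a i), (j, fn a j)) = val (swap a i j).
Proof.
move=> nij sw; have /and4P[ia ja _ _] := sw; apply/setP => -[x y].
rewrite mem_diag src_swap // /swap_graph !inE /= !xpair_eqE mem_diag.
case xa: (x \in src a); last first.
  rewrite /= !andbF orbF; apply/negbTE; apply: contraFN xa.
  by case/orP => /andP[/eqP-> _].
rewrite fn_swap // ![fn a _ == y]eq_sym; case: tpermP => [->|->|/eqP xi /eqP xj].
- rewrite eqxx (negPf nij) /=; case: (y == fn a j) => //=.
  by case: eqP.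
- rewrite eqxx eq_sym (negPf nij) /=.
  by case: (y == fn a i) => //=; case: eqP.
by rewrite (negPf xi) (negPf xj) /=.
Qed.

(** Values are injective on the source, so a diagram determines the transposition
    that leads to it.  Hence no two terms of the differential coincide. *)
Lemma swap_pair_inj a i j i' j' : i \in src a -> j \in src a ->
  swappable a i j -> swappable a i' j' -> (i < j)%N -> (i' < j')%N ->
  swap a i j = swap a i' j' -> i = i' /\ j = j'.
Proof.
move=> ia ja sw sw' lij lij' e.
have /and4P[ia' ja' _ _] := sw'.
have ft x : x \in src a -> tperm i j x = tperm i' j' x.
  by move=> xa; apply: (@fn_inj a); rewrite ?tperm_stable // -!fn_swap // e.
have := ft _ ia; have := ft _ ja; rewrite tpermL tpermR.
case: tpermP => [e1|e1|_ _]; case: tpermP => [e2|e2|_ _] e3 e4;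
  subst; split=> //; lia.
Qed.

(** The covering relation of the Bruhat order: b is a term of the differential of
    a.  Both algebra operations are studied through their coefficients, which
    are sums over relations such as this one. *)
Definition cov a b :=
  ((num_inv (val b)).+1 == num_inv (val a)) &&
  [exists p in inv_pairs (src a) (fn a), b == swap a p.1 p.2].

Lemma covP a b : reflect (exists i j, [/\ i \in src a, j \in src a, (i < j)%N,
    (fn a j < fn a i)%N & b = swap a i j /\ num_inv (val a) = (num_inv (val b)).+1])
  (cov a b).
Proof.
apply: (iffP andP) => [[/eqP e /exists_inP[[i j]]]|[i [j [ia ja lij fji [-> e]]]]].
  by rewrite inE /= => /and4P[? ? ? ?] /eqP ?; exists i, j; split.
split; first by rewrite e.
by apply/exists_inP; exists (i, j); rewrite ?inE /= ?ia ?ja ?lij.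
Qed.

Lemma gen_coef (g : {set _}) b : gen g b = (val b == g)%:R.
Proof. by rewrite ffunE. Qed.

Lemma sdiffE (x : strands n) b : sdiff x b = \sum_(a | cov a b) (x a : 'F_2).
Proof.
rewrite /sdiff sum_ffunE [RHS]big_mkcond /=; apply: eq_bigr => a _.
rewrite ffunE sum_ffunE.
rewrite (_ : \sum_(s in _ | _) _ = (cov a b)%:R :> 'F_2); last first.
  have inP s : s \in inversions (val a) ->
      exists i j, [/\ i \in src a, j \in src a, (i < j)%N, (fn a j < fn a i)%N
        & s = ((i, fn a i), (j, fn a j)) /\ swap_graph (val a) s = val (swap a i j)].
    case: s => [[i u] [j v]]; rewrite inE /= !mem_diag.
    case/and4P => /andP[ia /eqP<-] /andP[ja /eqP<-] lij fji.
    exists i, j; split=> //; split=> //; apply: swap_graphE.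
      by apply: contraTneq lij => ->; rewrite ltnn.
    exact: inversion_swappable.
  case: covP => [[i [j [ia ja lij fji [-> e]]]]|ncov]; last first.
    rewrite big1 // => s /andP[/inP[i [j [ia ja lij fji [-> ->]]]] /eqP e].
    rewrite gen_coef; case: eqP => // /val_inj eb.
    by case: ncov; exists i, j; split=> //; rewrite eb e.
  have nij : i != j by apply: contraTneq lij => ->; rewrite ltnn.
  have sw := inversion_swappable ia ja lij fji.
  rewrite (bigD1 ((i, fn a i), (j, fn a j))) /=; last first.
    by rewrite inE /= !fn_in // lij fji /= swap_graphE // e.
  rewrite swap_graphE // gen_coef eqxx big1 ?addr0 //.
  move=> s /andP[/andP[/inP[i' [j' [ia' ja' lij' fji' [-> ->]]]] _] ns].
  rewrite gen_coef; case: eqP => // /val_inj.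
  have sw' := inversion_swappable ia' ja' lij' fji'.
  by move/swap_pair_inj => [] // ei ej; subst; rewrite eqxx in ns.
by case: (cov a b); rewrite ?scaler1 ?scaler0 //; apply: mulr1.
Qed.

End DiagramsAsFunctions.

(** * The Leibniz rule *)

Section F2.

Lemma F2_addxx (x : 'F_2) : x + x = 0.
Proof. by rewrite -mulr2n -mulr_natr pchar_Zp // mulr0. Qed.

Lemma F2_addb (b c : bool) : (b (+) c)%:R = b%:R + c%:R :> 'F_2.
Proof. by case: b; case: c; rewrite ?addr0 ?add0r //= F2_addxx. Qed.

Lemma sum_bool_unique (R : nzSemiRingType) (I : finType) (P : pred I) :
  (forall i j, P i -> P j -> i = j) ->
  \sum_i (P i)%:R = ([exists i, P i])%:R :> R.
Proof.
move=> uP; case: existsP => [[i Pi]|nP].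
  rewrite (bigD1 i) //= Pi big1 ?addr0 // => j nji.
  by case Pj: (P j) => //; rewrite (uP j i) ?eqxx // in nji.
by rewrite big1 // => i _; case Pi: (P i) => //; case: nP; exists i.
Qed.

(** The terms of i and phi i cancel in characteristic 2. *)
Lemma sum_F2_involution (I : finType) (P : pred I) (phi : I -> I) (F : I -> 'F_2) :
  (forall i, P i -> [/\ P (phi i), phi i != i, phi (phi i) = i & F (phi i) = F i]) ->
  \sum_(i | P i) F i = 0.
Proof.
move=> h.
rewrite (bigID (fun i => (enum_rank i < enum_rank (phi i))%N)) /=.
rewrite [X in _ + X](reindex_onto phi phi) /=; last by move=> i /andP[/h[]].
rewrite [X in _ + X](eq_big (fun i => P i && (enum_rank i < enum_rank (phi i))%N) F).
- exact: F2_addxx.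
- move=> i; apply/idP/idP => [/andP[/andP[Pi nlt] /eqP e]|/andP[Pi lt]].
    have [] := h _ Pi; rewrite e => Pi' ne _ _; rewrite Pi' /=.
    rewrite e in nlt; case: (ltngtP (enum_rank i)) nlt ne => // /val_inj/enum_rank_inj <-.
    by rewrite eqxx.
  by have [-> _ -> _] := h _ Pi; rewrite eqxx -leqNgt ltnW.
- by move=> i /andP[/andP[Pi _] /eqP e]; have [_ _ _] := h _ Pi; rewrite e.
Qed.

End F2.

Lemma tperm_conj_in (I : finType) (S : {set I}) (f : I -> I) i j x :
  {in S &, injective f} -> i \in S -> j \in S -> x \in S ->
  tperm (f i) (f j) (f x) = f (tperm i j x).
Proof.
move=> fI iS jS xS; case: (tpermP i j x) => [->|->|/eqP xi /eqP xj]; rewrite ?tpermL ?tpermR //.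
by rewrite tpermD // eq_sym (inj_in_eq fI).
Qed.

Section Leibniz.

Variable n : nat.
Implicit Types (S T : {set 'I_n}) (f g : 'I_n -> 'I_n) (i j x y : 'I_n).
Implicit Types (a b c : diagram n) (u v w : strands n).

Fact comp_key : unit. Proof. by []. Qed.
Definition dcomp := locked_with comp_key
  (fun a b => mkdiag (src a) (fn b \o fn a)).
Canonical comp_unlockable := [unlockable fun dcomp].

Lemma dcomp_good a b : tgt a = src b ->
  {in src a, forall x, (x <= (fn b \o fn a) x)%N} /\
  {in src a &, injective (fn b \o fn a)}.
Proof.
move=> ab; have faS x : x \in src a -> fn a x \in src b by rewrite -ab; apply: fn_tgt.
split=> [x xa|x y xa ya /fn_inj e] /=.
  by rewrite (leq_trans (fn_ge xa)) // fn_ge // faS.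
by apply: (@fn_inj _ a) => //; apply: e; apply: faS.
Qed.

Lemma src_dcomp a b : tgt a = src b -> src (dcomp a b) = src a.
Proof. by rewrite unlock; case/dcomp_good => ? ?; rewrite src_mkdiag. Qed.

Lemma fn_dcomp a b x : tgt a = src b -> x \in src a -> fn (dcomp a b) x = fn b (fn a x).
Proof. by rewrite [dcomp]unlock => /dcomp_good[? ?] ?; rewrite /= fn_mkdiag. Qed.

Lemma comp_graphE a b : tgt a = src b -> comp_graph (val a) (val b) = val (dcomp a b).
Proof.
move=> ab; apply/setP => -[x z]; rewrite mem_diag src_dcomp // inE /=.
apply/existsP/andP => [[y]|[xa /eqP <-]].
  rewrite !mem_diag => /andP[/andP[xa /eqP <-] /andP[_ /eqP <-]].
  by rewrite xa fn_dcomp.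
by exists (fn a x); rewrite !mem_diag xa eqxx -ab fn_tgt //= fn_dcomp.
Qed.

(** Here c is the product of a and b; the last condition says that no two strands
    cross twice. *)
Definition mulc a b c :=
  [&& tgt a == src b, c == dcomp a b &
      num_inv (val c) == (num_inv (val a) + num_inv (val b))%N].

Lemma smulE u v c :
  smul u v c = \sum_a \sum_b (mulc a b c)%:R * ((u a : 'F_2) * (v b : 'F_2)).
Proof.
rewrite /smul sum_ffunE; apply: eq_bigr => a _; rewrite sum_ffunE.
rewrite big_mkcond; apply: eq_bigr => b _; rewrite /mulc.
case: eqP => //= [ab|_]; last by rewrite mul0r.
rewrite comp_graphE //; case: (altP (c =P _)) => [->|nc] /=.
  case: ifP => _; rewrite ?mul0r // ffunE gen_coef eqxx mul1r; exact: mulr1.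
rewrite mul0r; case: ifP => // _; rewrite ffunE gen_coef (inj_eq val_inj) (negPf nc).
exact: mulr0.
Qed.

Lemma sdiff_coef u b : sdiff u b = \sum_a (cov a b)%:R * (u a : 'F_2).
Proof.
rewrite sdiffE big_mkcond; apply: eq_bigr => a _.
by case: (cov a b); rewrite ?mul1r ?mul0r.
Qed.

Lemma num_inv_dcomp a b : tgt a = src b ->
  num_inv (val (dcomp a b)) = inv_count (src a) (fn b \o fn a).
Proof.
by move=> ab; rewrite num_invE src_dcomp //; apply: eq_inv => x xa; rewrite fn_dcomp.
Qed.

Lemma tgt_dcomp a b : tgt a = src b -> tgt (dcomp a b) = tgt b.
Proof.
move=> ab; apply/setP => y.
rewrite !tgtE src_dcomp // -ab tgtE -(imset_comp (fn b) (fn a)).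
by apply/imsetP/imsetP => -[x xa ->]; exists x; rewrite // fn_dcomp.
Qed.

Lemma num_inv_dcomp_le a b : tgt a = src b ->
  (num_inv (val (dcomp a b)) <= num_inv (val a) + num_inv (val b))%N.
Proof.
move=> ab; rewrite num_inv_dcomp // !num_invE -ab tgtE.
by apply: inv_comp; apply: fn_inj.
Qed.

Lemma num_inv_swap_lt a i j : i \in src a -> j \in src a -> (i < j)%N ->
  (fn a j < fn a i)%N -> (num_inv (val (swap a i j)) < num_inv (val a))%N.
Proof.
move=> ia ja lij fji; rewrite num_inv_swap ?num_invE; first exact: inv_swap_lt.
exact: inversion_swappable.
Qed.

Lemma cov_src a b : cov a b -> src b = src a.
Proof.
case/covP => i [j [ia ja lij fji [-> _]]].
by rewrite src_swap //; apply: inversion_swappable.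
Qed.

Lemma cov_tgt a b : cov a b -> tgt b = tgt a.
Proof.
case/covP => i [j [ia ja lij fji [-> _]]].
by rewrite tgt_swap //; apply: inversion_swappable.
Qed.

Lemma cov_inv a b : cov a b -> num_inv (val a) = (num_inv (val b)).+1.
Proof. by case/covP => i [j [_ _ _ _ [_ ->]]]. Qed.

Section CompSwap.
Variables a b c : diagram n.
Hypothesis ab : tgt a = src b.

(* Each of the three sums of the Leibniz rule has at most one nonzero term, and
   that term exchanges the same pair i < j in the composite.  The condition on
   the number of inversions is common to all three. *)
Let swapped i j := [&& i \in src a, j \in src a, (i < j)%N, src c == src a,
  [forall (x | x \in src a), fn c x == fn b (fn a (tperm i j x))] &
  (num_inv (val c)).+1 == (num_inv (val a) + num_inv (val b))%N].

Let gf i := fn b (fn a i).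

Lemma swapped_unique i j k l : swapped i j -> swapped k l -> (i, j) = (k, l).
Proof.
case/and5P => ia ja lij _ /andP[/forall_inP e1 _].
case/and5P => ka la lkl _ /andP[/forall_inP e2 _].
have tt x : x \in src a -> tperm i j x = tperm k l x.
  move=> xa; have : gf (tperm i j x) = gf (tperm k l x).
    by rewrite /gf -(eqP (e1 _ xa)) (eqP (e2 _ xa)).
  by case: (dcomp_good ab) => _ inj /inj; apply; rewrite tperm_stable.
have := tt _ ia; have := tt _ ja; rewrite tpermL tpermR.
case: tpermP => [e3|e3|_ _]; case: tpermP => [e4|e4|_ _] e5 e6;
  subst => //; lia.
Qed.

(** If the composite is inverted at i < j, the numbers of inversions are forced:
    exchanging loses at least one, and composing adds at most those of the
    factors.  So the product is automatically nonzero. *)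
Lemma ex_mul_cov :
  [exists c', mulc a b c' && cov c' c] = [exists p : 'I_n * 'I_n, swapped p.1 p.2 && (gf p.2 < gf p.1)%N].
Proof.
apply/existsP/existsP => [[c' /andP[/and3P[_ /eqP -> /eqP e]]]|[[i j] /= /andP[]]].
  case/covP => i [j [ia ja lij fji [cE]]]; rewrite e => eN.
  have sw := inversion_swappable ia ja lij fji.
  move: ia ja fji; rewrite !src_dcomp // => ia ja; rewrite !fn_dcomp // => fji.
  exists (i, j); rewrite /swapped ia ja lij /= fji eN eqxx !andbT cE src_swap // src_dcomp // eqxx /=.
  apply/forall_inP => x xa; rewrite fn_swap ?src_dcomp // fn_dcomp ?tperm_stable //.
case/and5P => ia ja lij /eqP sc /andP[/forall_inP fc /eqP eN] gji.
have ia' : i \in src (dcomp a b) by rewrite src_dcomp.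
have ja' : j \in src (dcomp a b) by rewrite src_dcomp.
have gji' : (fn (dcomp a b) j < fn (dcomp a b) i)%N by rewrite !fn_dcomp.
have sw := inversion_swappable ia' ja' lij gji'.
have cE : c = swap (dcomp a b) i j.
  apply: diag_ext; first by rewrite src_swap // src_dcomp.
  move=> x; rewrite sc => xa; rewrite fn_swap ?src_dcomp // fn_dcomp ?tperm_stable //.
  exact/eqP/fc.
have := num_inv_swap_lt ia' ja' lij gji'; have := num_inv_dcomp_le ab; rewrite -cE => h1 h2.
exists (dcomp a b); rewrite /mulc ab !eqxx !andTb.
apply/andP; split; first by lia.
apply/covP; exists i, j; split=> //; split=> //; lia.
Qed.

Lemma ex_cov_mull :
  [exists a', cov a a' && mulc a' b c] = [exists p : 'I_n * 'I_n, swapped p.1 p.2 && (fn a p.2 < fn a p.1)%N].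
Proof.
apply/existsP/existsP => [[a' /andP[/covP[i [j [ia ja lij fji [-> eA]]]]]]|[[i j] /= /andP[]]].
  have sw := inversion_swappable ia ja lij fji.
  case/and3P => _ /eqP cE /eqP e; have ab' : tgt (swap a i j) = src b by rewrite tgt_swap.
  exists (i, j); rewrite /swapped e eA addSn eqxx cE ia ja lij fji src_dcomp // src_swap // eqxx !andbT /=.
  by apply/forall_inP => x xa; rewrite fn_dcomp ?src_swap // fn_swap.
case/and5P => ia ja lij /eqP sc /andP[/forall_inP fc /eqP eN] fji.
have sw := inversion_swappable ia ja lij fji.
have ab' : tgt (swap a i j) = src b by rewrite tgt_swap.
have cE : c = dcomp (swap a i j) b.
  apply: diag_ext; first by rewrite src_dcomp // src_swap.
  move=> x; rewrite sc => xa; rewrite fn_dcomp ?src_swap // fn_swap //.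
  exact/eqP/fc.
have := num_inv_swap_lt ia ja lij fji; have := num_inv_dcomp_le ab'; rewrite -cE => h1 h2.
exists (swap a i j); rewrite /mulc ab' -cE !eqxx !andTb.
apply/andP; split; last by lia.
apply/covP; exists i, j; split=> //; split=> //; lia.
Qed.

(** An inversion of b at the images of i and j is an inversion of exactly one of
    a and the composite at i < j. *)
Lemma ex_cov_mulr :
  [exists b', cov b b' && mulc a b' c] =
  [exists p : 'I_n * 'I_n, swapped p.1 p.2 && ((fn a p.2 < fn a p.1) (+) (gf p.2 < gf p.1))%N].
Proof.
have fS x : x \in src a -> fn a x \in src b by rewrite -ab; apply: fn_tgt.
apply/existsP/existsP => [[b' /andP[/covP[y [z [yb zb lyz fzy [-> eB]]]]]]|[[i j] /= /andP[]]].
  have sw := inversion_swappable yb zb lyz fzy.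
  case/and3P => _ /eqP cE /eqP e; have ab' : tgt a = src (swap b y z) by rewrite src_swap.
  move: (yb) (zb); rewrite -ab !mem_tgt => /exists_inP[i ia /eqP ei] /exists_inP[j ja /eqP ej].
  have fc x : x \in src a -> fn (dcomp a (swap b y z)) x = fn b (fn a (tperm i j x)).
    move=> xa; rewrite fn_dcomp // fn_swap ?fS // -ei -ej (@tperm_conj_in _ (src a)) //.
    exact: fn_inj.
  rewrite /gf; case: (ltngtP i j) => [lij|lji|/val_inj eij].
  - exists (i, j) => /=; rewrite ei ej fzy ltnNge (ltnW lyz) andbT.
    rewrite /swapped e eB addnS eqxx cE ia ja lij src_dcomp // eqxx andbT /=.
    by apply/forall_inP => x xa; rewrite fc.
  - exists (j, i) => /=; rewrite ei ej lyz [X in _ (+) X]ltnNge (ltnW fzy) andbT.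
    rewrite /swapped e eB addnS eqxx cE ia ja lji src_dcomp // eqxx andbT /=.
    by apply/forall_inP => x xa; rewrite fc // tpermC.
  by move: lyz; rewrite -ei -ej eij ltnn.
case/and5P => ia ja lij /eqP sc /andP[/forall_inP fc /eqP eN] xor.
have nij : i != j by apply: contraTneq lij => ->; rewrite ltnn.
have nfij : fn a i != fn a j.
  by apply: contra nij => /eqP/fn_inj-/(_ ia ja) ->.
have [y [z [yb zb lyz fzy yz]]] : exists y z, [/\ y \in src b, z \in src b, (y < z)%N,
    (fn b z < fn b y)%N & tperm y z = tperm (fn a i) (fn a j)].
  have ngij : gf i != gf j.
    by apply: contra nfij => /eqP/fn_inj-/(_ (fS _ ia) (fS _ ja)) ->.
  case: (ltngtP (fn a j) (fn a i)) xor => [h|h|/val_inj h] /= xor.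
  - exists (fn a j), (fn a i); rewrite !fS // tpermC; split=> //.
    by rewrite -/(gf i) -/(gf j) ltn_neqAle ngij leqNgt.
  - by exists (fn a i), (fn a j); rewrite !fS.
  - by rewrite h eqxx in nfij.
have sw := inversion_swappable yb zb lyz fzy.
have ab' : tgt a = src (swap b y z) by rewrite src_swap.
have cE : c = dcomp a (swap b y z).
  apply: diag_ext; first by rewrite src_dcomp.
  move=> x; rewrite sc => xa; rewrite fn_dcomp // fn_swap ?fS // yz (@tperm_conj_in _ (src a)) //.
    exact/eqP/fc.
  exact: fn_inj.
have := num_inv_swap_lt yb zb lyz fzy; have := num_inv_dcomp_le ab'; rewrite -cE => h1 h2.
exists (swap b y z); rewrite /mulc ab' -cE !eqxx !andTb.
apply/andP; split; last by lia.
apply/covP; exists y, z; split=> //; split=> //; lia.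
Qed.

(** With the pair i < j and the common numerical condition fixed, the three terms
    are present iff the composite, a and b, respectively, invert the pair; and
    the composite inverts it iff exactly one of its factors does. *)
Lemma leibniz_comp :
  [exists c', mulc a b c' && cov c' c] =
  [exists a', cov a a' && mulc a' b c] (+) [exists b', cov b b' && mulc a b' c].
Proof.
rewrite ex_mul_cov ex_cov_mull ex_cov_mulr.
case: (pickP (fun p : 'I_n * 'I_n => swapped p.1 p.2)) => [[i j] /= sw|nsw].
  have exE (P : rel 'I_n) : [exists p : 'I_n * 'I_n, swapped p.1 p.2 && P p.1 p.2] = P i j.
    apply/existsP/idP => [[[k l] /= /andP[sw' Pkl]]|Pij]; last by exists (i, j); rewrite /= sw.
    by have [-> ->] := swapped_unique sw sw'.
  rewrite (exE (fun i j => gf j < gf i)%N) (exE (fun i j => fn a j < fn a i)%N).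
  rewrite (exE (fun i j => (fn a j < fn a i) (+) (gf j < gf i))%N).
  by rewrite addbA addbb.
by apply/esym; do 2! [rewrite (_ : [exists p, _] = false); last by apply/existsP => -[p]; rewrite nsw];
  apply/esym/existsP => -[p]; rewrite nsw.
Qed.

End CompSwap.

Lemma leibniz_coef a b c :
  \sum_c' (mulc a b c' && cov c' c)%:R =
  \sum_a' (cov a a' && mulc a' b c)%:R + \sum_b' (cov b b' && mulc a b' c)%:R :> 'F_2.
Proof.
have [ab|nab] := eqVneq (tgt a) (src b); last first.
  rewrite !big1 ?addr0 // => d _.
  - by case: (boolP (cov b d)) => // /cov_src e; rewrite /mulc e (negPf nab).
  - by case: (boolP (cov a d)) => // /cov_tgt e; rewrite /mulc e (negPf nab).
  - by rewrite /mulc (negPf nab).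
rewrite !sum_bool_unique ?leibniz_comp ?F2_addb //.
- move=> b1 b2 /andP[c1 /and3P[/eqP t1 /eqP e1 _]] /andP[c2 /and3P[/eqP t2 /eqP e2 _]].
  apply: diag_ext => [|y]; first by rewrite -t1 -t2.
  rewrite -t1 mem_tgt => /exists_inP[x xa /eqP <-].
  by rewrite -(fn_dcomp t1 xa) -(fn_dcomp t2 xa) -e1 -e2.
- move=> a1 a2 /andP[c1 /and3P[/eqP t1 /eqP e1 _]] /andP[c2 /and3P[/eqP t2 /eqP e2 _]].
  apply: diag_ext => [|x xa]; first by rewrite -(src_dcomp t1) -(src_dcomp t2) -e1 -e2.
  have s12 : src a1 = src a2 by rewrite (cov_src c1) (cov_src c2).
  apply: (@fn_inj _ b); rewrite -?t1 ?fn_tgt ?t1 -?t2 ?fn_tgt // -?s12 //.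
  by rewrite -!fn_dcomp // -?s12 // -e1 -e2.
- by move=> c1 c2 /andP[/and3P[_ /eqP -> _] _] /andP[/and3P[_ /eqP -> _] _].
Qed.

Lemma leibniz u v : sdiff (smul u v) = smul (sdiff u) v + smul u (sdiff v).
Proof.
apply: strandsP => c.
rewrite sdiff_coef.
rewrite [RHS]strandsD.
rewrite [in RHS](smulE (sdiff u) v c).
rewrite [in RHS](smulE u (sdiff v) c).
under eq_bigr => c' _.
  rewrite smulE mulr_sumr.
  under eq_bigr => a _ do rewrite mulr_sumr.
  over.
rewrite exchange_big /=.
transitivity (\sum_a \sum_b (\sum_c' (mulc a b c' && cov c' c)%:R) * ((u a : 'F_2) * (v b : 'F_2))).
  apply: eq_bigr => a _; rewrite exchange_big /=; apply: eq_bigr => b _.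
  rewrite mulr_suml; apply: eq_bigr => c' _; rewrite mulrA -natrM mulnb andbC //.
transitivity (\sum_a (\sum_b (\sum_a' (cov a a' && mulc a' b c)%:R) * ((u a : 'F_2) * (v b : 'F_2)) +
    \sum_b (\sum_b' (cov b b' && mulc a b' c)%:R) * ((u a : 'F_2) * (v b : 'F_2)))).
  apply: eq_bigr => a _; rewrite -big_split; apply: eq_bigr => b _ /=.
  by rewrite -mulrDl -leibniz_coef.
rewrite big_split /=; congr (_ + _).
  transitivity (\sum_a \sum_a' \sum_b (cov a a')%:R * ((mulc a' b c)%:R * ((u a : 'F_2) * (v b : 'F_2)))).
    apply: eq_bigr => a _; rewrite exchange_big; apply: eq_bigr => b _ /=.
    by rewrite mulr_suml; apply: eq_bigr => a' _; rewrite -mulnb natrM -mulrA.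
  rewrite exchange_big; apply: eq_bigr => a' _ /=.
  rewrite exchange_big; apply: eq_bigr => b _ /=.
  rewrite sdiff_coef mulr_suml mulr_sumr; apply: eq_bigr => a _.
  by rewrite mulrCA !mulrA.
apply: eq_bigr => a _.
transitivity (\sum_b \sum_b' (cov b b')%:R * ((mulc a b' c)%:R * ((u a : 'F_2) * (v b : 'F_2)))).
  by apply: eq_bigr => b _; rewrite mulr_suml; apply: eq_bigr => b' _; rewrite -mulnb natrM -mulrA.
rewrite exchange_big; apply: eq_bigr => b' _ /=.
rewrite sdiff_coef !mulr_sumr; apply: eq_bigr => b _.
by rewrite mulrCA; congr (_ * _); rewrite mulrCA.
Qed.

End Leibniz.

(** * The differential squares to zero *)

Section DSquare.

Variable n : nat.
Implicit Types (f : 'I_n -> 'I_n) (i j k l x y : 'I_n).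
Implicit Types (a b c : diagram n) (u v w : strands n).

Lemma tperm_if i j x : tperm i j x = if x == i then j else if x == j then i else x.
Proof. by case: tpermP => [->|->|/eqP/negPf-> /eqP/negPf->//]; rewrite eqxx //; case: eqP. Qed.

Definition swap_pair_ok f i j k l :=
  [&& (i < j)%N, (k < l)%N, (f j < f i)%N & (f (tperm i j l) < f (tperm i j k))%N].

(** A product of two transpositions that drops the number of inversions twice can be
    factored so in exactly one other way.  If the transpositions are disjoint they
    commute.  Otherwise their product is a 3-cycle of i < j < l, which has three
    factorizations, and comparing the three values shows that the present one and
    exactly one other remove an inversion at each step. *)
Definition other_factorization f (pq : ('I_n * 'I_n) * ('I_n * 'I_n)) :=
  let: ((i, j), (k, l)) := pq in
  if k == i then (if (l < j)%N then ((i, l), (l, j)) else ((j, l), (i, j)))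
  else if k == j then (if (f l < f j)%N then ((j, l), (i, l)) else ((i, l), (i, j)))
  else if l == i then (if (f i < f k)%N then ((k, i), (k, j)) else ((k, j), (i, j)))
  else if l == j then (if (k < i)%N then ((k, i), (i, j)) else ((k, j), (i, k)))
  else ((k, l), (i, j)).

Lemma neq_lt (i j : 'I_n) : i != j -> ((i < j) || (j < i))%N.
Proof. by rewrite -val_eqE /=; case: ltngtP. Qed.

Lemma ltn_eqF x y : (x < y)%N -> (x == y) = false.
Proof. by rewrite -val_eqE; case: ltngtP. Qed.

Lemma gtn_eqF x y : (x < y)%N -> (y == x) = false.
Proof. by rewrite -val_eqE; case: ltngtP. Qed.

Ltac decide_eqs := repeat match goal with
  | H : is_true (nat_of_ord ?x < nat_of_ord ?y)%N |- context [?x == ?y] => rewrite (ltn_eqF H)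
  | H : is_true (nat_of_ord ?x < nat_of_ord ?y)%N |- context [?y == ?x] => rewrite (gtn_eqF H)
  | H : is_true (?x != ?y) |- context [?x == ?y] => rewrite (negPf H)
  | H : is_true (?x != ?y) |- context [?y == ?x] => rewrite (eq_sym y x) (negPf H)
  | |- context [?x == ?x] => rewrite eqxx
  | _ => progress cbn beta iota zeta delta [fst snd andb negb]
  end.

Ltac finish_pair := split;
  [ rewrite /swap_pair_ok ?tperm_if; decide_eqs; lia
  | by apply/and4P
  | rewrite -!pair_eqE /pair_eq /= -?pair_eqE /pair_eq /=; decide_eqs; rewrite ?andbF //
  | rewrite /other_factorization; decide_eqs;
    repeat match goal with |- context [if ?b then _ else _] =>
      first [rewrite (_ : b = true); [|lia] | rewrite (_ : b = false); [|lia]] end; done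
  | let z := fresh "z" in intro z; rewrite !(tperm_if _ _ z);
    repeat (case: eqP => [?|/eqP ?]; [subst|]); rewrite ?tperm_if; decide_eqs; first [done | exfalso; lia |
      match goal with H : is_true (?y != ?y) |- _ => by rewrite eqxx in H end] ].

Lemma other_factorizationP (S : {set 'I_n}) f i j k l : {in S &, injective f} ->
  i \in S -> j \in S -> k \in S -> l \in S -> (i, j) != (k, l) ->
  swap_pair_ok f i j k l ->
  let: ((i', j'), (k', l')) := other_factorization f ((i, j), (k, l)) in
  [/\ swap_pair_ok f i' j' k' l', [&& i' \in S, j' \in S, k' \in S & l' \in S],
      ((i', j'), (k', l')) != ((i, j), (k, l)),
      other_factorization f ((i', j'), (k', l')) = ((i, j), (k, l)) &
      forall x, tperm i' j' (tperm k' l' x) = tperm i j (tperm k l x)].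
Proof.
move=> fI iS jS kS lS nijkl /and4P[lij lkl fji].
have fne x y : x \in S -> y \in S -> (x < y)%N -> ((f x < f y) || (f y < f x))%N.
  by move=> xS yS /ltn_eqF nxy; apply: neq_lt; rewrite (inj_in_eq fI) // nxy.
rewrite !tperm_if /other_factorization; case: (eqVneq k i) nijkl => [ki|nki] nijkl.
  subst k; have njl : j != l by apply: contraNneq nijkl => ->.
  decide_eqs => flj.
  case: ltnP => hlj; first by finish_pair.
  have {}hlj : (j < l)%N by rewrite ltn_neqAle hlj andbT.
  by finish_pair.
case: (eqVneq k j) nijkl => [kj|nkj] nijkl.
  subst k; have lil : (i < l)%N by apply: ltn_trans lkl.
  decide_eqs => flj; have dis := fne _ _ jS lS lkl.
  by case: (ltnP (f l) (f j)) => h1; [|have {}h1 : (f j < f l)%N by lia]; finish_pair.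
case: (eqVneq l i) nijkl => [li|nli] nijkl.
  subst l; have lkj : (k < j)%N by apply: ltn_trans lij.
  decide_eqs => flj; have dis := fne _ _ kS iS lkl.
  by case: (ltnP (f i) (f k)) => h1; [|have {}h1 : (f k < f i)%N by lia]; finish_pair.
case: (eqVneq l j) nijkl => [lj|nlj] nijkl.
  subst l; decide_eqs => flj; case: ltnP => hki; first by finish_pair.
  have {}hki : (i < k)%N by rewrite ltn_neqAle hki andbT eq_sym.
  by finish_pair.
by decide_eqs => flk; finish_pair.
Qed.

Definition good_swap a (p : 'I_n * 'I_n) :=
  (p \in inv_pairs (src a) (fn a)) &&
  ((num_inv (val (swap a p.1 p.2))).+1 == num_inv (val a)).

Lemma good_swapP a i j : reflect
  [/\ i \in src a, j \in src a, (i < j)%N, (fn a j < fn a i)%N &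
     num_inv (val a) = (num_inv (val (swap a i j))).+1] (good_swap a (i, j)).
Proof.
rewrite /good_swap inE /= eq_sym.
by apply: (iffP andP) => [[/and4P[? ? ? ?] /eqP]|[-> -> -> -> /eqP]].
Qed.

Lemma covE a b : (cov a b)%:R = \sum_p (good_swap a p && (b == swap a p.1 p.2))%:R :> 'F_2.
Proof.
rewrite sum_bool_unique => [|[i j] [k l]].
  congr (nat_of_bool _)%:R; apply/covP/existsP => [[i [j [ia ja lij fji [bE e]]]]|[[i j]]].
    by exists (i, j); rewrite /= bE eqxx andbT; apply/good_swapP; rewrite -bE.
  by case/andP => /good_swapP[ia ja lij fji e] /eqP bE; exists i, j; rewrite bE.
case/andP => /good_swapP[ia ja lij fji _] /eqP e1 /andP[/good_swapP[ka la lkl flk _] /eqP e2].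
rewrite e2 in e1.
by have [-> ->] := swap_pair_inj ka la (inversion_swappable ka la lkl flk)
  (inversion_swappable ia ja lij fji) lkl lij e1.
Qed.

(** Paths from a to c of length two are paired by the two factorizations of the
    permutation between them.  The number of inversions drops by one at each step
    of the other path since it drops at each step and by two in total. *)
Lemma cov_cov_even a c : \sum_b (cov a b)%:R * (cov b c)%:R = 0 :> 'F_2.
Proof.
pose P (pq : ('I_n * 'I_n) * ('I_n * 'I_n)) := let: ((i, j), (k, l)) := pq in
  [&& good_swap a (i, j), good_swap (swap a i j) (k, l) & c == swap (swap a i j) k l].
transitivity (\sum_(pq | P pq) (1 : 'F_2)).
  transitivity (\sum_p \sum_q (if P (p, q) then 1 else 0 : 'F_2)); last first.
    by rewrite pair_bigA [RHS]big_mkcond; apply: eq_bigr => -[].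
  under eq_bigr => b _ do rewrite covE mulr_suml.
  rewrite exchange_big; apply: eq_bigr => -[i j] _ /=.
  rewrite (bigD1 (swap a i j)) //= eqxx andbT big1 ?addr0; last first.
    by move=> b /negPf->; rewrite andbF mul0r.
  rewrite covE mulr_sumr; apply: eq_bigr => -[k l] _; rewrite -natrM mulnb.
  by case: (_ && _).
apply: (@sum_F2_involution _ _ (other_factorization (fn a))) => -[[i j] [k l]].
move E : (other_factorization (fn a) ((i, j), (k, l))) => pq'.
case/and3P => /good_swapP[ia ja lij fji e1] /good_swapP.
have sw := inversion_swappable ia ja lij fji.
rewrite (src_swap sw) => -[ka la lkl]; rewrite (fn_swap sw ka) (fn_swap sw la) => flk e2 /eqP cE.
have nijkl : (i, j) != (k, l).
  by apply/eqP => -[ek el]; move: fji flk; rewrite -ek -el tpermL tpermR; lia.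
have ok : swap_pair_ok (fn a) i j k l by rewrite /swap_pair_ok lij lkl fji.
have := other_factorizationP (@fn_inj _ a) ia ja ka la nijkl ok.
rewrite {}E; case: pq' => [[i' j'] [k' l']].
case=> /and4P[lij' lkl' fji' flk'] /and4P[ia' ja' ka' la'] neq inv tt.
split; [rewrite /P /= | exact: neq | exact: inv | by []].
have sw' := inversion_swappable ia' ja' lij' fji'.
have ka2 : k' \in src (swap a i' j') by rewrite src_swap.
have la2 : l' \in src (swap a i' j') by rewrite src_swap.
have flk2 : (fn (swap a i' j') l' < fn (swap a i' j') k')%N.
  by rewrite (fn_swap sw' la') (fn_swap sw' ka').
have sw2 := inversion_swappable ka2 la2 lkl' flk2.
have sw3 : swappable (swap a i j) k l.
  apply: inversion_swappable lkl _; try by rewrite (src_swap sw).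
  by rewrite (fn_swap sw la) (fn_swap sw ka).
have cE' : c = swap (swap a i' j') k' l'.
  rewrite cE; apply: diag_ext.
    by rewrite (src_swap sw3) (src_swap sw) (src_swap sw2) (src_swap sw').
  move=> x; rewrite (src_swap sw3) (src_swap sw) => xa.
  have xa1 : x \in src (swap a i j) by rewrite (src_swap sw).
  have xa2 : x \in src (swap a i' j') by rewrite (src_swap sw').
  rewrite (fn_swap sw3 xa1) (fn_swap sw2 xa2) (fn_swap sw) ?tperm_stable //.
  by rewrite (fn_swap sw') ?tperm_stable // tt.
have h1 := num_inv_swap_lt ia' ja' lij' fji'.
have h2 := num_inv_swap_lt ka2 la2 lkl' flk2.
rewrite -cE' in h2; rewrite -cE in e2.
apply/and3P; split; last by rewrite -cE'.
  by apply/good_swapP; split=> //; move: h1 h2 e1 e2; clear; lia.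
by apply/good_swapP; rewrite -cE'; split=> //; move: h1 h2 e1 e2; clear; lia.
Qed.

Lemma sdiff_sdiff u : sdiff (sdiff u) = 0.
Proof.
apply: strandsP => c; rewrite strands0 sdiff_coef.
under eq_bigr => b _ do rewrite sdiff_coef mulr_sumr.
rewrite exchange_big /= big1 // => a _.
under eq_bigr => b _ do rewrite mulrA [_ * (cov a b)%:R]mulrC.
by rewrite -mulr_suml cov_cov_even mul0r.
Qed.

End DSquare.

(** * Multiplicities and the Maslov grading *)

Section Chains.

Variable n : nat.
Implicit Types (m : nat) (i j p x y : 'I_n) (a b c : diagram n).

(** The strands that pass the arc from the point m to its successor. *)
Definition strands_over a (m : nat) := [set x in src a | (x <= m < fn a x)%N].

(** Strands are nondecreasing, so those that end above m are those that start
    above m and those that pass over the arc. *)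
Lemma card_strands_over a (m : nat) :
  (#|strands_over a m| + #|[set x in src a | (m < x)%N]|)%N = #|[set y in tgt a | (m < y)%N]|.
Proof.
rewrite (_ : [set y in tgt a | (m < y)%N] = fn a @: [set x in src a | (m < fn a x)%N]); last first.
  apply/setP => y; rewrite inE mem_tgt; apply/andP/imsetP.
    by case=> /exists_inP[x xa /eqP <-] my; exists x; rewrite // inE xa.
  case=> x; rewrite inE => /andP[xa my] ->; split=> //.
  by apply/exists_inP; exists x.
rewrite card_in_imset; last first.
  by move=> x y; rewrite !inE => /andP[xa _] /andP[ya _]; apply: fn_inj.
rewrite -(cardsID [set x : 'I_n | (x <= m)%N] [set x in src a | (m < fn a x)%N]).
congr (_ + _)%N; apply: eq_card => x; rewrite !inE; case xa: (x \in src a);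
  rewrite ?andbF //=; by have := fn_ge xa; lia.
Qed.

Lemma over_src_tgt a b m : src a = src b -> tgt a = tgt b -> #|strands_over a m| = #|strands_over b m|.
Proof. by move=> sab tab; have := card_strands_over a m; have := card_strands_over b m; rewrite sab tab; lia. Qed.

Lemma over_dcomp a b m : tgt a = src b ->
  #|strands_over (dcomp a b) m| = (#|strands_over a m| + #|strands_over b m|)%N.
Proof.
move=> ab; have := card_strands_over a m; have := card_strands_over b m; have := card_strands_over (dcomp a b) m.
by rewrite tgt_dcomp // src_dcomp // ab; lia.
Qed.

Lemma chain_ofE a (j : 'I_n.-1) : chain_of a j = #|strands_over a j|%:Z.
Proof.
rewrite /chain_of sum_ffunE.
have -> : val a = [set (x, fn a x) | x in src a].
  by apply/setP => -[x y]; rewrite mem_diag -/(graph (src a) (fn a)) mem_graph.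
rewrite big_imset /=; last by move=> x y _ _ [].
rewrite -sum1_card -[RHS]natz natr_sum big_mkcond [RHS]big_mkcond /=.
apply: eq_bigr => x _; rewrite inE ffunE.
by case: (x \in src a) => //=; case: (_ && _).
Qed.

Lemma over_last a m : (n.-1 <= m)%N -> #|strands_over a m| = 0%N.
Proof.
move=> h; apply/eqP; rewrite cards_eq0; apply/eqP/setP => x; rewrite !inE.
by apply/negbTE; rewrite !negb_and; have := ltn_ord (fn a x); lia.
Qed.

Lemma mult_aboveE a p : mult_above (chain_of a) p = #|strands_over a p|%:Z.
Proof.
rewrite /mult_above; case: (ltnP p n.-1) => h.
  rewrite (big_pred1 (Ordinal h)) ?chain_ofE // => j; exact/eqP/eqP.
rewrite over_last // big_pred0 // => j; apply/negbTE.
by rewrite neq_ltn (leq_trans (ltn_ord j) h).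
Qed.

Lemma mult_belowE a p :
  mult_below (chain_of a) p = #|[set x in src a | (x < p <= fn a x)%N]|%:Z.
Proof.
rewrite /mult_below; case: (posnP p) => h.
  rewrite big_pred0; last by move=> j; rewrite -[val p]/(nat_of_ord p) h.
  by congr (_%:Z); apply/esym/eqP; rewrite cards_eq0; apply/eqP/setP => x; rewrite !inE h ltn0 andbF.
have h' : (p.-1 < n.-1)%N by have := ltn_ord p; lia.
rewrite (big_pred1 (Ordinal h')) /=; last first.
  move=> j; apply/eqP/eqP => [e|->]; last exact: prednK.
  by apply: val_inj; rewrite /= -[in RHS](e : j.+1 = p).
rewrite chain_ofE; congr (_%:Z); apply: eq_card => x; rewrite !inE /=; congr (_ && _); lia.
Qed.

(** Both sides count the strands x with x <= p <= fn a x. *)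
Lemma card_below_above a p :
  (#|[set x in src a | (x < p <= fn a x)%N]| + (p \in src a) = #|strands_over a p| + (p \in tgt a))%N.
Proof.
pose T := [set x in src a | (x <= p <= fn a x)%N].
transitivity #|T|.
  rewrite (cardsD1 p T) addnC; congr (_ + _)%N.
    by rewrite inE leqnn /=; case pa: (p \in src a) => //=; rewrite fn_ge.
  apply: eq_card => x; rewrite !inE; case: (x \in src a); rewrite ?andbF //=.
  by rewrite -val_eqE /=; lia.
rewrite -(cardsID [set x | (p < fn a x)%N] T); congr (_ + _)%N.
  by apply: eq_card => x; rewrite !inE; case: (x \in src a) => //=; lia.
case: (boolP (p \in tgt a)) => [|np].
  rewrite mem_tgt => /exists_inP[x xa /eqP fx]; apply/eqP/cards1P; exists x.
  apply/setP => y; rewrite !inE; apply/idP/eqP => [/and3P[h1 ya h2]|->].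
    by apply: (@fn_inj _ a) => //; apply: val_inj; rewrite fx /=; lia.
  by rewrite xa fx -fx fn_ge // ltnn leqnn.
apply/eqP; rewrite cards_eq0; apply/eqP/setP => x; rewrite !inE.
apply: contraNF np => /and3P[h1 xa h2]; rewrite mem_tgt; apply/exists_inP; exists x => //.
by rewrite -val_eqE /=; lia.
Qed.

Lemma chain_bndE a p :
  chain_bnd (chain_of a) p = (p \in tgt a)%:Z - (p \in src a)%:Z.
Proof. by rewrite /chain_bnd mult_aboveE mult_belowE; have := card_below_above a p; lia. Qed.

Lemma chain_of_src_tgt a b : src a = src b -> tgt a = tgt b -> chain_of a = chain_of b.
Proof.
by move=> sab tab; apply/ffunP => j; rewrite !chain_ofE (over_src_tgt _ sab tab).
Qed.

Lemma cov_chain a b : cov a b -> chain_of b = chain_of a.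
Proof. by move=> ab; apply: chain_of_src_tgt; rewrite ?(cov_src ab) ?(cov_tgt ab). Qed.

Lemma cov_maslov a b : cov a b -> maslov a = maslov b + 1.
Proof.
move=> ab; rewrite /maslov (cov_src ab) (cov_chain ab) (cov_inv ab).
by rewrite -addn1 natrD addrAC.
Qed.

Definition fixed a p := (p \in src a) && (fn a p == p).

Lemma avg_mult_fixed a p : fixed a p ->
  avg_mult (chain_of a) p = #|strands_over a p|%:R.
Proof.
case/andP => pa /eqP fp.
have pt : p \in tgt a by rewrite -fp fn_tgt.
rewrite /avg_mult mult_aboveE mult_belowE.
have := card_below_above a p; rewrite pa pt => /addIn ->.
by rewrite -PoszD -pmulrn addnn -muln2 natrM mulfK.
Qed.

End Chains.

(** * Moving constant strands to the matched point *)

Section Moves.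

Variables (k : nat) (Z : pmc k).
Local Notation point := 'I_(4 * k).
Implicit Types (p q x y : point) (a b c : diagram (4 * k)).
Local Notation pt := (partner Z).

Lemma partnerP p : [/\ pt p != p, Z (pt p) = Z p &
  forall q, Z q = Z p -> q = p \/ q = pt p].
Proof.
have /eqP/cards2P[x [y [nxy Sxy]]] := pairing_card2 Z (Z p).
have inS q : (Z q == Z p) = (q \in [set x; y]) by rewrite -Sxy inE.
have [z [nzp zS]] : exists z, z != p /\ forall q, (Z q == Z p) = ((q == p) || (q == z)).
  have := inS p; rewrite eqxx in_set2 => /esym/orP[] /eqP e; subst p.
    by exists y; split; [rewrite eq_sym | move=> q; rewrite inS in_set2].
  by exists x; split; [| move=> q; rewrite inS in_set2 orbC].
have -> : pt p = z.
  rewrite /partner; case: pickP => [q /andP[nq]|/(_ z)] /=.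
    by rewrite zS (negPf nq) => /eqP.
  by rewrite nzp zS eqxx orbT.
split=> //; first by apply/eqP; rewrite zS eqxx orbT.
by move=> q /eqP; rewrite zS => /orP[] /eqP; [left|right].
Qed.

Lemma partner_neq p : pt p != p. Proof. by case: (partnerP p). Qed.
Lemma pairing_partner p : Z (pt p) = Z p. Proof. by case: (partnerP p). Qed.
Lemma pairing_inj p q : Z q = Z p -> q = p \/ q = pt p.
Proof. by case: (partnerP p) => _ _; apply. Qed.

Lemma partnerK : involutive pt.
Proof.
move=> p; have [|//|e] := @pairing_inj (pt p) p; first by rewrite pairing_partner.
  by move=> e; have := partner_neq p; rewrite -e eqxx.
by rewrite -e.
Qed.

Lemma mem_primed (S : {set point}) p : (p \in primed Z S) = (pt p \in S).
Proof.
apply/imsetP/idP => [[q qS ->]|pS]; first by rewrite partnerK.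
by exists (pt p); rewrite ?partnerK.
Qed.

Lemma is_basicP a : reflect
  ((forall p, p \in src a -> pt p \notin src a) /\
   (forall p, p \in tgt a -> pt p \notin tgt a)) (is_basic Z a).
Proof.
have disj (S : {set point}) :
    reflect (forall p, p \in S -> pt p \notin S) (S :&: primed Z S == set0).
  apply: (iffP eqP) => [/setP S0 p pS|h].
    by have := S0 p; rewrite !inE mem_primed pS => /= ->.
  by apply/setP => p; rewrite !inE mem_primed; case pS: (p \in S) => //=; apply/negbTE/h.
by apply: (iffP andP) => -[/disj ? /disj].
Qed.

Lemma basic_src a p : is_basic Z a -> p \in src a -> pt p \notin src a.
Proof. by case/is_basicP => h _; apply: h. Qed.
Lemma basic_tgt a p : is_basic Z a -> p \in tgt a -> pt p \notin tgt a.
Proof. by case/is_basicP => _; apply. Qed.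

Lemma fixed_src a p : fixed a p -> p \in src a.
Proof. by case/andP. Qed.
Lemma fixed_fn a p : fixed a p -> fn a p = p.
Proof. by case/andP => _ /eqP. Qed.
Lemma fixed_tgt a p : fixed a p -> p \in tgt a.
Proof. by move=> fa; rewrite -(fixed_fn fa) fn_tgt ?fixed_src. Qed.
Lemma fixedE a p : fixed a p = ((p, p) \in val a).
Proof. by rewrite mem_diag. Qed.
Lemma mem_fixed a p : (p \in fixed_points a) = fixed a p.
Proof. by rewrite inE fixedE. Qed.

(** The elementary move: the constant strand at p is replaced by one at the
    matched point.  Elements of the algebra are the functions on basic diagrams
    that are invariant under these moves.  Locked for the same reason as the
    exchanges. *)
Fact move_key : unit. Proof. by []. Qed.
Definition mv := locked_with move_key (fun a p =>
  mkdiag (pt p |: src a :\ p) (fun x => if x == pt p then x else fn a x)).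
Canonical mv_unlockable := [unlockable fun mv].

Section Move.
Variables (a : diagram (4 * k)) (p : point).
Hypotheses (a_basic : is_basic Z a) (ap : fixed a p).

Let p'src : pt p \notin src a. Proof. exact/basic_src/fixed_src. Qed.
Let p'tgt : pt p \notin tgt a. Proof. exact/basic_tgt/fixed_tgt. Qed.
Let mem_move x : x \in pt p |: src a :\ p = (x == pt p) || (x != p) && (x \in src a).
Proof. by rewrite !inE. Qed.

Lemma fn_neq_fixed x : x \in src a -> x != p -> fn a x != p.
Proof.
move=> xa; apply: contra => /eqP fx.
by apply/eqP/(@fn_inj _ a); rewrite ?(fixed_src ap) // fx fixed_fn.
Qed.

Lemma mv_good :
  {in pt p |: src a :\ p, forall x, (x <= if x == pt p then x else fn a x)%N} /\
  {in pt p |: src a :\ p &, injective (fun x => if x == pt p then x else fn a x)}.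
Proof.
split=> [x|x y]; rewrite !mem_move.
  by case: (x =P pt p) => //= _ /andP[_]; apply: fn_ge.
case: (x =P pt p) => [->|_] /=; case: (y =P pt p) => [->|_] //=.
- by move=> _ /andP[_ ya] e; case/negP: p'tgt; rewrite e fn_tgt.
- by move=> /andP[_ xa] _ e; case/negP: p'tgt; rewrite -e fn_tgt.
by move=> /andP[_ xa] /andP[_ ya]; apply: fn_inj.
Qed.

Lemma src_mv : src (mv a p) = pt p |: src a :\ p.
Proof. by rewrite unlock; case: mv_good => ? ?; rewrite src_mkdiag. Qed.

Lemma mem_src_mv x : (x \in src (mv a p)) = (x == pt p) || (x != p) && (x \in src a).
Proof. by rewrite src_mv mem_move. Qed.

Lemma fn_mv x : x \in src a -> x != p -> fn (mv a p) x = fn a x.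
Proof.
move=> xa xp; rewrite unlock; case: mv_good => ? ?.
rewrite fn_mkdiag //; last by rewrite mem_move xa xp orbT.
by case: eqP => // e; case/negP: p'src; rewrite -e.
Qed.

Lemma fn_mv_partner : fn (mv a p) (pt p) = pt p.
Proof.
rewrite unlock; case: mv_good => ? ?; rewrite fn_mkdiag ?eqxx //.
by rewrite mem_move eqxx.
Qed.

Lemma mem_tgt_mv x : (x \in tgt (mv a p)) = (x == pt p) || (x != p) && (x \in tgt a).
Proof.
rewrite !mem_tgt; apply/exists_inP/orP => [[y]|].
  rewrite mem_src_mv => /orP[/eqP->|/andP[yp ya]].
    by rewrite fn_mv_partner => /eqP ->; left.
  rewrite fn_mv // => /eqP <-; right; rewrite fn_neq_fixed //.
  by apply/exists_inP; exists y.
case=> [/eqP ->|/andP[xp /exists_inP[y ya /eqP fy]]].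
  by exists (pt p); rewrite ?fn_mv_partner // mem_src_mv eqxx.
have yp : y != p by apply: contraNneq xp => yp; rewrite -fy yp fixed_fn.
by exists y; rewrite ?fn_mv ?fy // mem_src_mv yp ya orbT.
Qed.

Lemma tgt_mv : tgt (mv a p) = pt p |: tgt a :\ p.
Proof. by apply/setP => x; rewrite mem_tgt_mv !inE. Qed.

Lemma basic_mv : is_basic Z (mv a p).
Proof.
apply/is_basicP; split=> x; rewrite ?mem_src_mv ?mem_tgt_mv.
  case/orP => [/eqP ->|/andP[xp xa]].
    by rewrite partnerK eqxx /= orbF eq_sym partner_neq.
  by rewrite (inj_eq (can_inj partnerK)) (negPf xp) (negPf (basic_src a_basic xa)) andbF.
case/orP => [/eqP ->|/andP[xp xa]].
  by rewrite partnerK eqxx /= orbF eq_sym partner_neq.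
by rewrite (inj_eq (can_inj partnerK)) (negPf xp) (negPf (basic_tgt a_basic xa)) andbF.
Qed.

Lemma fixed_mv_partner : fixed (mv a p) (pt p).
Proof. by rewrite /fixed mem_src_mv eqxx fn_mv_partner eqxx. Qed.

Lemma fixed_mv x : fixed (mv a p) x = (x == pt p) || (x != p) && fixed a x.
Proof.
rewrite /fixed mem_src_mv; case: eqP => [->|_] /=; first by rewrite fn_mv_partner eqxx.
by case xp: (x == p) => //=; case xa: (x \in src a) => //=; rewrite fn_mv ?xp.
Qed.

Lemma strands_over_mv m : strands_over (mv a p) m = strands_over a m.
Proof.
apply/setP => x; rewrite !inE mem_src_mv; case: (altP (x =P pt p)) => [->|xp'] /=.
  by rewrite fn_mv_partner (negPf p'src) /=; lia.
case: (altP (x =P p)) => [->|xp] /=; last by case xa: (x \in src a); rewrite //= fn_mv.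
by rewrite fixed_fn //; case: (_ \in _) => //=; lia.
Qed.

Lemma chain_mv : chain_of (mv a p) = chain_of a.
Proof. by apply/ffunP => j; rewrite !chain_ofE strands_over_mv. Qed.

End Move.

Lemma mvK a p : is_basic Z a -> fixed a p -> mv (mv a p) (pt p) = a.
Proof.
move=> ba fa; have bm := basic_mv ba fa; have fm := fixed_mv_partner ba fa.
have np' : pt p \notin src a by exact/basic_src/fixed_src.
apply: diag_ext => [|x].
  apply/setP => x; rewrite mem_src_mv // mem_src_mv // partnerK.
  case: (altP (x =P p)) => [->|_] /=; first by rewrite fixed_src.
  by case: eqP => [->|_] //=; rewrite (negPf np').
rewrite mem_src_mv // partnerK; case: (altP (x =P p)) => [-> _|xp] /=.
  by rewrite -[X in fn _ X]partnerK fn_mv_partner // partnerK fixed_fn.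
rewrite mem_src_mv // => /andP[xp']; rewrite (negPf xp') xp /= => xa.
by rewrite !fn_mv // mem_src_mv // xp xa orbT.
Qed.

(** A constant strand is crossed exactly by the strands that pass over it. *)
Lemma num_inv_fixed a p : fixed a p ->
  num_inv (val a) = (inv_count (src a :\ p) (fn a) + #|strands_over a p|)%N.
Proof.
move=> fa; have fp := fixed_fn fa; have pa := fixed_src fa.
rewrite num_invE /inv_count.
rewrite -(cardsID [set q : point * point | q.2 == p]) addnC; congr (_ + _)%N.
  apply: eq_card => -[x y]; rewrite !inE /=.
  case: (altP (y =P p)) => [->|yp]; rewrite ?andbF //=.
  case: (altP (x =P p)) => [->|xp] //=.
  by rewrite fp; case ya: (y \in src a); rewrite ?andbF //=; have := fn_ge ya; lia.
rewrite -(card_imset (f := fun x : point => (x, p)) (strands_over a p)); last by move=> x y [].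
apply: eq_card => -[x y]; rewrite !inE /=; apply/idP/imsetP => [|[z]].
  case/andP => /and4P[xa ya lxy fxy] /eqP e; subst y; exists x => //.
  by rewrite !inE xa ltnW //=; rewrite -{1}fp.
rewrite inE => /and3P[za h1 h2] [-> ->]; rewrite za pa eqxx fp h2 !andbT /=.
by rewrite ltn_neqAle h1 andbT; apply: contraTneq h2 => /val_inj ->; rewrite fp ltnn.
Qed.

Lemma num_inv_mv a p : is_basic Z a -> fixed a p ->
  (num_inv (val (mv a p)) + #|strands_over a p| =
   num_inv (val a) + #|strands_over a (pt p)|)%N.
Proof.
move=> ba fa; rewrite (num_inv_fixed fa) (num_inv_fixed (fixed_mv_partner ba fa)).
have -> : src (mv a p) :\ pt p = src a :\ p.
  apply/setP => x; rewrite !inE mem_src_mv //.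
  by case: (altP (x =P pt p)) => [->|_] //=; rewrite (negPf (basic_src ba (fixed_src fa))) andbF.
rewrite strands_over_mv // addnAC; congr (_ + _ + _)%N.
by apply: eq_inv => x; rewrite !inE => /andP[xp xa]; rewrite fn_mv.
Qed.

(** The change of the number of crossings at the constant strand is compensated
    by the change of the multiplicity at its starting point. *)
Lemma maslov_mv a p : is_basic Z a -> fixed a p -> maslov (mv a p) = maslov a.
Proof.
move=> ba fa; rewrite /maslov chain_mv //.
rewrite src_mv // big_setU1 /=; last first.
  by rewrite !inE negb_and (basic_src ba (fixed_src fa)) orbT.
have -> : avg_mult (chain_of a) (pt p) = #|strands_over a (pt p)|%:R.
  by rewrite -(chain_mv ba fa) avg_mult_fixed ?fixed_mv_partner // strands_over_mv.
rewrite (big_setD1 p (fixed_src fa)) /= avg_mult_fixed //.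
have /(congr1 (fun m => m%:R : rat)) := num_inv_mv ba fa; rewrite !natrD.
lra.
Qed.

Lemma classes_mv a p : is_basic Z a -> fixed a p ->
  Z @: src (mv a p) = Z @: src a /\ Z @: tgt (mv a p) = Z @: tgt a.
Proof.
move=> ba fa; rewrite src_mv // tgt_mv // !imsetU1 pairing_partner.
by rewrite -!imsetU1 !setD1K // ?fixed_src ?fixed_tgt.
Qed.

(** A strand that takes part in a resolved crossing ends up strictly increasing,
    so constant strands of the result were there before. *)
Lemma cov_fixed a b p : cov a b -> fixed b p -> fixed a p.
Proof.
case/covP => i [j [ia ja lij fji [-> _]]]; have sw := inversion_swappable ia ja lij fji.
case/andP; rewrite src_swap // => pa; rewrite fn_swap // /fixed pa /=.
have gi := fn_ge ia; have gj := fn_ge ja.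
by case: tpermP => [pi|pj|_ _ //]; rewrite ?pi ?pj => /eqP/(congr1 val) /= h; exfalso; lia.
Qed.

Lemma cov_basic a b : cov a b -> is_basic Z b = is_basic Z a.
Proof. by move=> ab; rewrite /is_basic (cov_src ab) (cov_tgt ab). Qed.

Lemma cov_mv a b p : is_basic Z a -> cov a b -> fixed b p -> cov (mv a p) (mv b p).
Proof.
move=> ba ab fb; have fa := cov_fixed ab fb.
have bb : is_basic Z b by rewrite (cov_basic ab).
have sab := cov_src ab; have tab := cov_tgt ab.
have Ha := num_inv_mv ba fa; have Hb := num_inv_mv bb fb.
rewrite !(over_src_tgt _ sab tab) in Hb.
case/covP: ab => i [j [ia ja lij fji [bE eN]]]; have sw := inversion_swappable ia ja lij fji.
have [fbi fbj] : fn b i = fn a j /\ fn b j = fn a i.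
  by rewrite bE !fn_swap // tpermL tpermR.
have ip : i != p.
  apply: contraTneq lij => e; have := fixed_fn fb; have := fn_ge ja.
  by rewrite -e fbi -leqNgt => h1 <-.
have jp : j != p.
  apply: contraTneq lij => e; have := fixed_fn fb; have := fn_ge ia; rewrite -e fbj => h1 h2.
  by have := fixed_fn fa; rewrite -e => h3; rewrite h2 h3 ltnn in fji.
have ia' : i \in src (mv a p) by rewrite mem_src_mv // ip ia orbT.
have ja' : j \in src (mv a p) by rewrite mem_src_mv // jp ja orbT.
have fji' : (fn (mv a p) j < fn (mv a p) i)%N by rewrite !fn_mv.
have sw' := inversion_swappable ia' ja' lij fji'.
apply/covP; exists i, j; split=> //; split; last by move: Ha Hb eN; clear; lia.
apply: diag_ext; first by rewrite (src_swap sw') !src_mv // sab.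
move=> x xb; have xa' : x \in src (mv a p) by move: xb; rewrite !mem_src_mv // sab.
rewrite (fn_swap sw') //; move: xb; rewrite mem_src_mv // => /orP[/eqP->|/andP[xp xb]].
  have np' : pt p \notin src a by exact/basic_src/fixed_src.
  rewrite fn_mv_partner // tpermD ?fn_mv_partner //.
    by apply: contraNneq np' => <-.
  by apply: contraNneq np' => <-.
rewrite fn_mv // bE fn_swap -?sab // fn_mv //; first by rewrite tperm_stable // -sab.
by case: tpermP => [_|_|].
Qed.

Lemma mulc_fixed a b c p : mulc a b c -> fixed c p -> fixed a p /\ fixed b p.
Proof.
case/and3P => /eqP ab /eqP -> _ /andP[]; rewrite src_dcomp // => pa.
rewrite fn_dcomp // => /eqP fp.
have fpb : fn a p \in src b by rewrite -ab fn_tgt.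
have e : fn a p = p by apply: val_inj => /=; have := fn_ge pa; have := fn_ge fpb; rewrite fp; lia.
by rewrite /fixed pa e eqxx -{1}e fpb /= -{1}e fp.
Qed.

Lemma mulc_mv a b c p : is_basic Z a -> is_basic Z b ->
  mulc a b c -> fixed c p -> mulc (mv a p) (mv b p) (mv c p).
Proof.
move=> ba bb abc fc; have [fa fb] := mulc_fixed abc fc.
case/and3P: abc => /eqP ab /eqP cE /eqP eN.
have sc : src c = src a by rewrite cE src_dcomp.
have tc : tgt c = tgt b by rewrite cE tgt_dcomp.
have bc : is_basic Z c.
  by case/is_basicP: ba => ba _; case/is_basicP: bb => _ bb; apply/is_basicP; rewrite sc tc.
have ab' : tgt (mv a p) = src (mv b p) by rewrite tgt_mv // src_mv // ab.
have Ha := num_inv_mv ba fa; have Hb := num_inv_mv bb fb; have Hc := num_inv_mv bc fc.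
have O m : #|strands_over c m| = (#|strands_over a m| + #|strands_over b m|)%N.
  by rewrite cE over_dcomp.
rewrite !O in Hc.
apply/and3P; split; first exact/eqP.
  apply/eqP/diag_ext; first by rewrite src_dcomp // !src_mv // sc.
  move=> x xc; have xa : x \in src (mv a p) by move: xc; rewrite !mem_src_mv // sc.
  rewrite fn_dcomp //; move: xc; rewrite mem_src_mv // => /orP[/eqP->|/andP[xp xc]].
    by rewrite !fn_mv_partner.
  rewrite sc in xc.
  rewrite (fn_mv ba fa) // fn_mv ?sc // cE fn_dcomp // fn_mv -?ab ?fn_tgt //.
  exact: fn_neq_fixed.
by apply/eqP; move: Ha Hb Hc eN; clear; lia.
Qed.

End Moves.

(** * Basic elements and their keys *)

Section BasicElements.

Variables (k : nat) (Z : pmc k).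
Local Notation point := 'I_(4 * k).
Implicit Types (p q x y : point) (a b c : diagram (4 * k)) (u v w : strands (4 * k)).
Local Notation pt := (partner Z).
Local Notation mv := (mv Z).
Local Notation basic := (is_basic Z).

(** The moving strands together with the matched pairs that carry a constant
    strand.  Two basic diagrams have the same key iff they are related by moving
    constant strands, that is, iff they occur in the same basic element. *)
Definition key a := ([set s in val a | s.1 != s.2], Z @: fixed_points a).

Lemma mem_moving a x y : ((x, y) \in (key a).1) = ((x, y) \in val a) && (x != y).
Proof. by rewrite inE. Qed.

Lemma mem_class a p : (Z p \in (key a).2) = fixed a p || fixed a (pt p).
Proof.
apply/imsetP/orP => [[q]|[fp|fp]].
- by rewrite mem_fixed => fq /pairing_inj[->|e]; [left|right; rewrite e partnerK].
- by exists p; rewrite ?mem_fixed.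
- by exists (pt p); rewrite ?mem_fixed ?pairing_partner.
Qed.

Lemma fixed_partner a p : basic a -> fixed a p -> fixed a (pt p) = false.
Proof. by move=> ba fp; rewrite /fixed (negPf (basic_src ba (fixed_src fp))). Qed.

Lemma eq_key a b :
  (forall x y, x != y -> ((x, y) \in val a) = ((x, y) \in val b)) ->
  (forall p, fixed a p || fixed a (pt p) = fixed b p || fixed b (pt p)) -> key a = key b.
Proof.
move=> hm hf; congr pair.
  apply/setP => -[x y]; rewrite !inE /=; case: (altP (x =P y)) => [|/hm ->//].
  by rewrite !andbF.
apply/setP => c; apply/imsetP/imsetP => -[p]; rewrite mem_fixed => fp ->.
  have := hf p; rewrite fp /= => /esym/orP[] fp'; first by exists p; rewrite ?mem_fixed.
  by exists (pt p); rewrite ?mem_fixed ?pairing_partner.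
have := hf p; rewrite fp orTb => /orP[] fp'; first by exists p; rewrite ?mem_fixed.
by exists (pt p); rewrite ?mem_fixed ?pairing_partner.
Qed.

Lemma key_mv a p : basic a -> fixed a p -> key (mv a p) = key a.
Proof.
move=> ba fa; apply: eq_key => [x y nxy|q].
  rewrite !mem_diag mem_src_mv //; case: (altP (x =P pt p)) => [e|xp'] /=.
    rewrite e fn_mv_partner // -e (negPf nxy).
    by rewrite e (negPf (basic_src ba (fixed_src fa))).
  case: (altP (x =P p)) => [e|xp] /=; first by rewrite e fixed_fn // -e (negPf nxy) andbF.
  by case xa: (x \in src a) => //=; rewrite fn_mv.
rewrite !fixed_mv // (inj_eq (can_inj (partnerK Z))) -[pt q == p](inj_eq (can_inj (partnerK Z))) partnerK.
case: (altP (q =P p)) => [->|qp] /=; first by rewrite fa orbT.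
by case: (altP (q =P pt p)) => [->|_] //=; rewrite partnerK fa orbT.
Qed.

(** A constant strand of a that b does not have sits at the matched point in b;
    moving it brings a closer to b. *)
Lemma key_invariant (T : Type) (g : diagram (4 * k) -> T) :
  (forall a p, basic a -> fixed a p -> g (mv a p) = g a) ->
  forall a b, basic a -> basic b -> key a = key b -> g a = g b.
Proof.
move=> g_mv a b; have [m] := ubnP #|fixed_points a :\: fixed_points b|.
elim: m a => // m IH a le_m ba bb kab.
have cls p : fixed a p || fixed a (pt p) = fixed b p || fixed b (pt p).
  by rewrite -!mem_class kab.
case: (set_0Vmem (fixed_points a :\: fixed_points b)) => [d0|[p]].
  have sub p : fixed a p -> fixed b p.
    move=> fp; have : p \notin fixed_points a :\: fixed_points b by rewrite d0 inE.
    by rewrite !inE -!fixedE fp andbT negbK.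
  suff -> : a = b by [].
  apply/val_inj/setP => -[x y]; case: (altP (x =P y)) => [<-|nxy]; last first.
    have /setP/(_ (x, y)) : (key a).1 = (key b).1 by rewrite kab.
    by rewrite !mem_moving nxy !andbT.
  rewrite -!fixedE; apply/idP/idP => [/sub //|fb].
  have := cls x; rewrite fb /= => /orP[//|/sub fb'].
  by rewrite (fixed_partner bb fb) in fb'.
rewrite !inE -!fixedE => /andP[nfb fa].
have fb' : fixed b (pt p) by have := cls p; rewrite fa (negPf nfb).
rewrite -(g_mv _ _ ba fa); apply: IH; rewrite ?basic_mv ?key_mv //.
rewrite -ltnS; apply: leq_trans le_m; rewrite ltnS [X in (_ < X)%N](cardsD1 p) !inE -!fixedE fa nfb add1n ltnS.
apply: subset_leq_card; apply/subsetP => q; rewrite !inE -!fixedE fixed_mv //.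
by case: (altP (q =P pt p)) => [->|_] /=; [rewrite fb' | case: (q == p); rewrite ?andbF].
Qed.

(** The basic diagrams with the key of a are the moves of a, and the set of points
    that are moved can be read off. *)
Lemma move_graphP a b (i : {set point}) : basic a -> i \subset fixed_points a ->
  (val b == move_graph Z a i) =
  [&& basic b, key a == key b & i == fixed_points a :\: fixed_points b].
Proof.
move=> ba /subsetP sia; have fi p : p \in i -> fixed a p by move/sia; rewrite mem_fixed.
have nfi p : p \in i -> pt p \notin i.
  by move=> pi; apply: contraFN (fixed_partner ba (fi _ pi)) => /fi.
have memG x y : ((x, y) \in move_graph Z a i) =
    ((x, y) \in val a) && ~~ ((x == y) && (x \in i)) || (x == y) && (pt x \in i).
  rewrite inE in_setD andbC; congr (_ && ~~ _ || _).
    by apply/imsetP/andP => [[z zi [-> ->]]|[/eqP <- xi]]; [rewrite eqxx | exists x].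
  apply/imsetP/andP => [[z zi [-> ->]]|[/eqP <- xi]]; first by rewrite eqxx -mem_primed.
  by exists x; rewrite ?mem_primed.
apply/eqP/and3P => [bE|[bb /eqP kab /eqP iE]].
  have memb x y : ((x, y) \in val b) =
    ((x, y) \in val a) && ~~ ((x == y) && (x \in i)) || (x == y) && (pt x \in i).
    by rewrite bE memG.
  have fixb p : fixed b p = fixed a p && (p \notin i) || (pt p \in i).
    by rewrite !fixedE memb eqxx.
  have srcb p : p \in src b -> (p \in src a) && (p \notin i) || (pt p \in i).
    move/fn_in; rewrite memb => /orP[/andP[]|/andP[_ ->]]; last by rewrite orbT.
    rewrite mem_diag => /andP[pa /eqP fp] npi; rewrite pa /=; apply/orP; left.
    by apply: contra npi => pi; rewrite pi andbT -fp fixed_fn // fi.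
  have tgtb p : p \in tgt b -> (p \in tgt a) && (p \notin i) || (pt p \in i).
    rewrite mem_tgt => /exists_inP[x /fn_in + /eqP fx]; rewrite fx memb.
    case/orP => [/andP[]|/andP[/eqP -> ->]]; last by rewrite orbT.
    rewrite mem_diag => /andP[xa /eqP fp] npi; have -> : p \in tgt a by rewrite -fp fn_tgt.
    apply/orP; left; apply: contra npi => pi; have fap := fi _ pi.
    have -> : x = p by apply: (@fn_inj _ a); rewrite ?(fixed_src fap) // (fixed_fn fap).
    by rewrite eqxx.
  have disj (A : {set point}) : (forall p, p \in A -> pt p \notin A) ->
      forall p, (p \in A) && (p \notin i) || (pt p \in i) ->
        ~~ ((pt p \in A) && (pt p \notin i) || (p \in i)).
    move=> hA p; rewrite negb_or negb_and negbK => /orP[/andP[pA ->]|pi].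
      by rewrite (negPf (hA _ pA)).
    by rewrite pi orbT /= -(partnerK Z p) nfi.
  have bb : basic b.
    case/is_basicP: ba => sa ta; apply/is_basicP; split=> p.
      move/srcb => h; apply: contra (disj _ sa _ h) => /srcb.
      by rewrite partnerK.
    move/tgtb => h; apply: contra (disj _ ta _ h) => /tgtb.
    by rewrite partnerK.
  split=> //.
    apply/eqP/eq_key => [x y nxy|p]; first by rewrite memb (negPf nxy) /= orbF andbT.
    rewrite !fixb partnerK; case: (boolP (p \in i)) => [pi|npi]; first by rewrite (fi _ pi) !orbT.
    case: (boolP (pt p \in i)) => [pi|npi']; first by rewrite (fi _ pi) !orbT.
    by rewrite !andbT !orbF.
  apply/eqP/setP => p; rewrite !inE -!fixedE fixb.
  case: (boolP (p \in i)) => [pi|npi]; first by rewrite andbF (negPf (nfi _ pi)) /= fi.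
  by case: (fixed a p); rewrite ?andbF.
have cls p : fixed a p || fixed a (pt p) = fixed b p || fixed b (pt p).
  by rewrite -!mem_class kab.
have memi p : (p \in i) = fixed a p && ~~ fixed b p.
  by rewrite iE !inE -!fixedE andbC.
apply/setP => -[x y]; rewrite memG; case: (altP (x =P y)) => [<-|nxy]; last first.
  have /setP/(_ (x, y)) : (key a).1 = (key b).1 by rewrite kab.
  by rewrite !mem_moving nxy !andbT => <-; rewrite /= ?orbF ?andbT.
rewrite -!fixedE /= !memi; have := cls x.
case fa: (fixed a x); first by rewrite (fixed_partner ba fa); case: (fixed b x) => //= <-.
case fa': (fixed a (pt x)) => /=; last by case: (fixed b x).
by case fb: (fixed b x); [rewrite (fixed_partner bb fb) | move=> /= <-].
Qed.

Lemma E_coef a b : basic a -> E Z a b = (basic b && (key a == key b))%:R.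
Proof.
move=> ba; rewrite /E strands_sum.
transitivity (\sum_(i : {set point} | i \subset fixed_points a)
    (basic b && (key a == key b) && (i == fixed_points a :\: fixed_points b))%:R : 'F_2).
  by apply: eq_bigr => i si; rewrite gen_coef move_graphP // andbA.
rewrite (bigD1 (fixed_points a :\: fixed_points b)) ?subsetDl //= eqxx andbT.
by rewrite big1 ?addr0 // => i /andP[_ /negPf ->]; rewrite andbF.
Qed.

End BasicElements.

(** * The algebra of a pointed matched circle as a subspace *)

Section SpanPredicates.

Lemma linfunE_of (R : fieldType) (U V : vectType R) (f : U -> V) (f_lin : linear f) x :
  linfun f x = f x.
Proof.
pose m := GRing.isLinear.Build R U V *:%R f f_lin.
pose F : {linear U -> V} := HB.pack f m.
exact: (lfunE F).
Qed.

Lemma span_ind (R : fieldType) (V : vectType R) (P : V -> Prop) (X : seq V) :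
  P 0 -> (forall u v, P u -> P v -> P (u + v)) -> (forall l u, P u -> P (l *: u)) ->
  (forall u, u \in X -> P u) -> forall u, u \in <<X>>%VS -> P u.
Proof.
move=> P0 PD PZ; elim: X => [_ u|v X IH PX u].
  by rewrite span_nil memv0 => /eqP ->.
rewrite span_cons => /memv_addP[_ /vlineP[l ->] [w /IH Pw ->]].
apply: PD; first by apply/PZ/PX; rewrite mem_head.
by apply: Pw => x xX; apply: PX; rewrite in_cons xX orbT.
Qed.

End SpanPredicates.

Section Algebra.

Variables (k : nat) (Z : pmc k).
Local Notation point := 'I_(4 * k).
Implicit Types (p q : point) (a b c : diagram (4 * k)) (x y z : strands (4 * k)).
Implicit Types (s t : {set 'I_(2 * k)}).
Local Notation pt := (partner Z).
Local Notation mv := (mv Z).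
Local Notation basic := (is_basic Z).

(** Membership in the algebra in terms of coefficients. *)
Definition in_pmc x :=
  (forall a, x a != 0 -> basic a) /\
  (forall a p, basic a -> fixed a p -> x (mv a p) = x a).

Lemma in_pmc0 : in_pmc 0.
Proof. by split=> [a|a p _ _]; rewrite !strands0 ?eqxx. Qed.

Lemma in_pmcD x y : in_pmc x -> in_pmc y -> in_pmc (x + y).
Proof.
move=> [xb xm] [yb ym]; split=> [a|a p ba fa]; last by rewrite !strandsD xm ?ym.
rewrite strandsD; apply: contraNT => nb.
have /eqP -> : x a == 0 by apply: contraNT nb; apply: xb.
by rewrite add0r; apply: contraNT nb; apply: yb.
Qed.

Lemma in_pmcZ (l : 'F_2) x : in_pmc x -> in_pmc (l *: x).
Proof.
move=> [xb xm]; split=> [a|a p ba fa]; last by rewrite !strandsZ xm.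
by rewrite strandsZ; apply: contraNT => /(contraNN (xb a)); rewrite negbK => /eqP ->; rewrite mulr0.
Qed.

Lemma in_pmc_E a : basic a -> in_pmc (E Z a).
Proof.
move=> ba; split=> [b|b p bb fb]; first by rewrite E_coef //; case: (basic b); rewrite ?eqxx.
by rewrite !E_coef // basic_mv // key_mv // bb.
Qed.

Lemma in_pmc_key x a b : in_pmc x -> basic a -> basic b -> key Z a = key Z b -> x a = x b.
Proof. by move=> [_ xm]; apply: key_invariant. Qed.

(** A choice of one diagram for each key: it depends on the key only. *)
Definition rep a := odflt a [pick b | basic b && (key Z b == key Z a)].

Lemma rep_basic a : basic a -> basic (rep a) /\ key Z (rep a) = key Z a.
Proof.
rewrite /rep; case: pickP => [b /andP[bb /eqP kb] _|/(_ a)] /=; first by [].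
by rewrite eqxx andbT => ->.
Qed.

Lemma rep_key a b : basic a -> key Z a = key Z b -> rep a = rep b.
Proof.
move=> ba kab; rewrite /rep kab; case: pickP => [//|/(_ a)].
by rewrite ba kab eqxx.
Qed.

Lemma sum_reps x : in_pmc x ->
  x = \sum_(a | basic a && (rep a == a)) (x a : 'F_2) *: E Z a.
Proof.
move=> xP; apply: strandsP => b; rewrite strands_sum.
case: (boolP (basic b)) => [bb|nb]; last first.
  have /eqP -> : x b == 0 by apply: contraNT nb; case: xP => xb _; apply: xb.
  rewrite big1 // => a /andP[ba _].
  by rewrite strandsZ E_coef // (negPf nb) mulr0.
have [br kr] := rep_basic bb.
rewrite (bigD1 (rep b)) /=; last by rewrite br (rep_key br kr) eqxx.
rewrite [X in X + _]strandsZ [X in _ * X + _](E_coef b br) kr bb eqxx mulr1.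
have -> : x (rep b) = x b by apply: in_pmc_key xP br bb kr.
rewrite big1 ?addr0 // => a /andP[/andP[ba /eqP ra] nab].
rewrite strandsZ (E_coef b ba) bb.
by case: eqP => [kab|_]; [rewrite -(rep_key ba kab) ra eqxx in nab | rewrite mulr0].
Qed.

Lemma span_EP (Q : pred (diagram (4 * k))) :
  (forall a p, basic a -> fixed a p -> Q (mv a p) = Q a) -> forall x,
  x \in <<[seq E Z a | a <- enum [pred a | basic a && Q a]]>>%VS <->
  in_pmc x /\ (forall a, x a != 0 -> Q a).
Proof.
move=> Q_mv x; split.
  move: x; apply: span_ind.
  - by split=> [|a]; [exact: in_pmc0 | rewrite strands0 eqxx].
  - move=> x y [xP xQ] [yP yQ]; split=> [|a]; first exact: in_pmcD.
    rewrite strandsD; apply: contraNT => nb.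
    have /eqP -> : x a == 0 by apply: contraNT nb; apply: xQ.
    by rewrite add0r; apply: contraNT nb; apply: yQ.
  - move=> l x [xP xQ]; split=> [|a]; first exact: in_pmcZ.
    by rewrite strandsZ; apply: contraNT => /(contraNN (xQ a)); rewrite negbK => /eqP ->; rewrite mulr0.
  move=> _ /mapP[a + ->]; rewrite mem_enum inE => /andP[ba Qa].
  split=> [|b]; first exact: in_pmc_E.
  rewrite E_coef //; case: (boolP (basic b)) => bb; last by rewrite eqxx.
  by case: (key Z a =P key Z b) => [kab _|]; [rewrite -(key_invariant Q_mv ba bb kab) | rewrite eqxx].
move=> [xP xQ]; rewrite (sum_reps xP); apply: memv_suml => a /andP[ba _].
have [->|xa] := eqVneq (x a) 0; first by rewrite scale0r mem0v.
apply/memvZ/memv_span/mapP; exists a => //.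
by rewrite mem_enum inE ba xQ.
Qed.

Lemma card_diagram a : #|val a| = #|src a|.
Proof.
rewrite /src card_in_imset // => s u sa ua e.
have := diag_inj sa ua; rewrite e eqxx => /esym/eqP.
by case: s e {sa} => ? ? /= ->; case: u {ua} => ? ? /= ->.
Qed.

Lemma card_basic a : basic a -> (#|val a| <= 2 * k)%N.
Proof.
move=> ba; rewrite card_diagram.
rewrite -[(2 * k)%N]card_ord -(card_in_imset (f := Z)) ?max_card //.
by move=> p q pa qa /pairing_inj[//|e]; move: pa; rewrite e (negPf (basic_src ba qa)).
Qed.

Lemma card_mv a p : basic a -> fixed a p -> #|val (mv a p)| = #|val a|.
Proof.
move=> ba fa; rewrite !card_diagram src_mv // cardsU1 [in RHS](cardsD1 p) (fixed_src fa).
by rewrite !inE negb_and (basic_src ba (fixed_src fa)) orbT.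
Qed.

Lemma pmc_algP x : x \in pmc_alg Z <-> in_pmc x.
Proof.
split.
  case/memv_sumP => u hu ->; elim/big_ind: _ => [|y z|i _]; [exact: in_pmc0 | exact: in_pmcD |].
  have := hu i isT; rewrite /pmc_alg_strands.
  move=> h; by have [] := (@span_EP (fun a => #|val a| == i)
     (fun a p ba fa => congr1 (eq_op^~ (val i)) (card_mv ba fa)) (u i)).1 h.
move=> xP; rewrite (sum_reps xP); apply: memv_suml => a /andP[ba _].
have ca : (#|val a| < (2 * k).+1)%N by rewrite ltnS card_basic.
apply/memvZ/(subvP (sumv_sup (Ordinal ca) _ (subvv _))) => //.
by apply/memv_span/mapP; exists a; rewrite // mem_enum inE ba eqxx.
Qed.

Definition bideg (l : rat) h a := (maslov a == l) && (chain_of a == h).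

Lemma deg_partP l h x :
  x \in deg_part Z l h <-> in_pmc x /\ (forall a, x a != 0 -> bideg l h a).
Proof.
rewrite -(@span_EP (bideg l h)) //.
by move=> a p ba fa; rewrite /bideg maslov_mv ?chain_mv.
Qed.

Lemma sum_F2_neq0 (I : finType) (P : pred I) (F : I -> 'F_2) :
  \sum_(i | P i) F i != 0 -> exists2 i, P i & F i != 0.
Proof.
move=> s0; case: (pickP (fun i => P i && (F i != 0))) => [i /andP[Pi Fi]|h]; first by exists i.
by rewrite big1 ?eqxx // in s0 => i Pi; apply/eqP; have := h i; rewrite Pi /= => /negbFE.
Qed.

(** Moving a constant strand of b carries the diagrams that cover b to those that
    cover the moved diagram. *)
Lemma in_pmc_sdiff x : in_pmc x -> in_pmc (sdiff x).
Proof.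
move=> [xb xm]; split=> [b|b p bb fb].
  rewrite sdiffE => /sum_F2_neq0[a ab /xb ba].
  by rewrite (cov_basic _ ab).
rewrite !sdiffE; have bb' := basic_mv bb fb; have fb' := fixed_mv_partner bb fb.
have back a : cov a (mv b p) -> [/\ basic a, fixed a (pt p) & cov (mv a (pt p)) b].
  move=> ab; have ba : basic a by rewrite -(cov_basic _ ab).
  split=> //; first exact: cov_fixed fb'.
  by rewrite -(mvK bb fb); apply: cov_mv.
rewrite (reindex_onto (fun a => mv a p) (fun a => mv a (pt p))) /=; last first.
  by move=> a /back[ba fa _]; rewrite -[X in mv _ X](partnerK Z p) mvK.
apply: eq_big => [a|a /andP[/back[ba fa ab] /eqP e]].
  apply/andP/idP => [[/back[_ _ +] /eqP e]|ab]; first by rewrite e.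
  have ba : basic a by rewrite -(cov_basic _ ab).
  have fa := cov_fixed ab fb; split; last by rewrite mvK.
  exact: cov_mv.
by rewrite e in ab; apply: xm; [rewrite -(cov_basic _ ab) | apply: cov_fixed fb].
Qed.

Lemma smul_basicE x y c : in_pmc x -> in_pmc y ->
  smul x y c = \sum_(ab | [&& basic ab.1, basic ab.2 & mulc ab.1 ab.2 c])
                 (x ab.1 : 'F_2) * (y ab.2 : 'F_2).
Proof.
move=> [xb _] [yb _]; rewrite smulE pair_bigA [RHS]big_mkcond /=.
apply: eq_bigr => -[a b] _ /=.
case: (boolP (basic a)) => [ba|na]; last first.
  have /eqP -> : x a == 0 by apply: contraNT na; apply: xb.
  by rewrite mul0r mulr0.
case: (boolP (basic b)) => [bb|nb]; last first.
  have /eqP -> : y b == 0 by apply: contraNT nb; apply: yb.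
  by rewrite !mulr0.
by rewrite /=; case: (mulc _ _ _); rewrite ?mul1r ?mul0r.
Qed.

Lemma mulc_basic a b c : basic a -> basic b -> mulc a b c -> basic c.
Proof.
move=> ba bb /and3P[/eqP ab /eqP -> _].
case/is_basicP: ba => ba _; case/is_basicP: bb => _ bb; apply/is_basicP.
by rewrite tgt_dcomp // src_dcomp.
Qed.

(** A constant strand of a product is constant in both factors, and can be moved
    in both. *)
Lemma in_pmc_smul x y : in_pmc x -> in_pmc y -> in_pmc (smul x y).
Proof.
move=> xP yP; have [[xb xm] [yb ym]] := (xP, yP); split=> [c|c p bc fc].
  rewrite smul_basicE // => /sum_F2_neq0[[a b] /= /and3P[ba bb abc] _].
  exact: mulc_basic abc.
rewrite !smul_basicE //; have bc' := basic_mv bc fc; have fc' := fixed_mv_partner bc fc.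
have back a b : [&& basic a, basic b & mulc a b (mv c p)] ->
    [/\ basic a, basic b, fixed a (pt p), fixed b (pt p) &
        mulc (mv a (pt p)) (mv b (pt p)) c].
  case/and3P => ba bb abc; have [fa fb] := mulc_fixed abc fc'.
  by split=> //; rewrite -(mvK bc fc); apply: mulc_mv.
rewrite (reindex_onto (fun ab : _ * _ => (mv ab.1 p, mv ab.2 p))
                      (fun ab : _ * _ => (mv ab.1 (pt p), mv ab.2 (pt p)))) /=; last first.
  move=> [a b] /= /back[ba bb fa fb _].
  by rewrite -[X in (mv _ X, _)](partnerK Z p) -[X in (_, mv _ X)](partnerK Z p) !mvK.
apply: eq_big => [[a b] /=|[a b] /= /andP[/back[ba bb fa fb abc] /eqP [ea eb]]].
  apply/andP/idP => [[/back[ba bb fa fb abc] /eqP [ea eb]]|/and3P[ba bb abc]].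
    rewrite ea eb in abc; have [fa' fb'] := mulc_fixed abc fc.
    have ba' : basic a by rewrite -ea basic_mv.
    have bb' : basic b by rewrite -eb basic_mv.
    by rewrite ba' bb'.
  have [fa fb] := mulc_fixed abc fc.
  by rewrite !basic_mv // mulc_mv //= !mvK.
rewrite ea eb in abc; have [fa' fb'] := mulc_fixed abc fc.
have ba' : basic a by rewrite -ea basic_mv.
have bb' : basic b by rewrite -eb basic_mv.
by rewrite xm ?ym.
Qed.

End Algebra.

(** * Idempotents *)

Section Idempotents.

Variables (k : nat) (Z : pmc k).
Local Notation point := 'I_(4 * k).
Implicit Types (p q : point) (a b c : diagram (4 * k)) (x y z u v : strands (4 * k)).
Implicit Types (s t : {set 'I_(2 * k)}) (S : {set point}).
Local Notation pt := (partner Z).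
Local Notation basic := (is_basic Z).

Lemma in_pmc_non_basic x a : in_pmc Z x -> ~~ basic a -> x a = 0.
Proof. by move=> [xb _] na; apply/eqP; apply: contraNT na; apply: xb. Qed.

(** The diagram of which the idempotent of s is the basic element. *)
Definition idem_diagram s : diagram (4 * k) :=
  Sub [set (p, p) | p in first_reps Z s] (idem_diagramP Z s).

Lemma mem_idem_diagram s p q :
  ((p, q) \in val (idem_diagram s)) = (p == q) && (p \in first_reps Z s).
Proof.
apply/imsetP/andP => [[r rs [-> ->]]|[/eqP <- ps]]; first by rewrite eqxx.
by exists p.
Qed.

Lemma idem_diagram_fn s p : p \in src (idem_diagram s) ->
  fn (idem_diagram s) p = p /\ p \in first_reps Z s.
Proof. by move/fn_in; rewrite mem_idem_diagram => /andP[/eqP <- ->]. Qed.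

Lemma idem_diagram_basic s : basic (idem_diagram s).
Proof.
have fr p : p \in first_reps Z s -> pt p \notin first_reps Z s.
  by rewrite !inE partnerK => /andP[_ h]; rewrite negb_and -[X in _ || X]leqNgt ltnW // orbT.
apply/is_basicP; split=> p.
  case/idem_diagram_fn => _ ps; apply/negP => /idem_diagram_fn[_].
  by rewrite (negPf (fr _ ps)).
rewrite mem_tgt => /exists_inP[q /idem_diagram_fn[-> qs] /eqP <-].
rewrite mem_tgt; apply/exists_inP => -[r /idem_diagram_fn[-> rs] /eqP e].
by have := fr q qs; rewrite -e rs.
Qed.

Lemma idem_diagram_key s : key Z (idem_diagram s) = (set0, s).
Proof.
congr pair.
  apply/setP => -[p q]; rewrite !inE mem_idem_diagram /=.
  by case: (p == q); rewrite ?andbF.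
apply/setP => c; apply/imsetP/idP => [[p + ->]|cs].
  by rewrite inE mem_idem_diagram eqxx inE /= => /andP[].
have [p pc] : exists p, Z p = c.
  have : (0 < #|[set p | Z p == c]|)%N by rewrite pairing_card2.
  by case/card_gt0P => p; rewrite inE => /eqP <-; exists p.
case: (ltnP p (pt p)) => h.
  by exists p; rewrite // inE mem_idem_diagram eqxx inE pc cs h.
exists (pt p); rewrite ?pairing_partner //.
rewrite inE mem_idem_diagram eqxx inE pairing_partner pc cs partnerK /=.
by rewrite ltn_neqAle h andbT (inj_eq val_inj) partner_neq.
Qed.

Lemma in_pmc_idem s : in_pmc Z (idem Z s).
Proof. exact: in_pmc_E (idem_diagram_basic s). Qed.

Lemma idem_coef s a : idem Z s a = (basic a && (key Z a == (set0, s)))%:R.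
Proof. by rewrite (E_coef a (idem_diagram_basic s)) idem_diagram_key eq_sym. Qed.

Definition id_diagram (S : {set point}) : diagram (4 * k) := mkdiag S id.

Lemma src_id S : src (id_diagram S) = S.
Proof. by rewrite src_mkdiag. Qed.
Lemma fn_id S p : p \in S -> fn (id_diagram S) p = p.
Proof. by move=> pS; rewrite fn_mkdiag. Qed.
Lemma tgt_id S : tgt (id_diagram S) = S.
Proof.
rewrite tgtE src_id; apply/setP => p; apply/imsetP/idP => [[q qS ->]|pS].
  by rewrite fn_id.
by exists p; rewrite ?fn_id.
Qed.

Lemma num_inv_id S : num_inv (val (id_diagram S)) = 0%N.
Proof.
apply/eqP; rewrite num_invE src_id cards_eq0; apply/eqP/setP => -[p q]; rewrite !inE /=.
apply/negbTE; case pS: (p \in S) => //=; case qS: (q \in S) => //=.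
by rewrite !fn_id //; lia.
Qed.

Lemma key_id S s : (key Z (id_diagram S) == (set0, s)) = (Z @: S == s).
Proof.
rewrite /key xpair_eqE (_ : [set _ in _ | _] = set0) ?eqxx /=.
  congr (_ == _); apply/setP => d; apply/imsetP/imsetP => -[p].
    by rewrite mem_fixed => /fixed_src; rewrite src_id => pS ->; exists p.
  by move=> pS ->; exists p; rewrite // mem_fixed /fixed src_id pS fn_id ?eqxx.
apply/setP => -[p q]; rewrite !inE mem_diag src_id /=.
by case pS: (p \in S) => //=; rewrite fn_id //; case: eqP.
Qed.

Lemma key0_id s a : key Z a = (set0, s) -> a = id_diagram (src a).
Proof.
case=> /setP m0 _; apply: diag_ext; first by rewrite src_id.
move=> p pa; rewrite fn_id //; have := m0 (p, fn a p).
by rewrite !inE fn_in //= => /negbFE/eqP.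
Qed.

Lemma basic_id a (S : {set point}) : basic a -> (S = src a \/ S = tgt a) -> basic (id_diagram S).
Proof.
case/is_basicP => sa ta [->|->]; apply/is_basicP; rewrite src_id tgt_id; split=> p; do [exact: sa | exact: ta].
Qed.

Lemma mulc_idl c : mulc (id_diagram (src c)) c c.
Proof.
rewrite /mulc tgt_id eqxx num_inv_id add0n eqxx andbT /=.
apply/eqP/diag_ext => [|p pc]; rewrite ?src_dcomp ?tgt_id ?src_id //.
by rewrite fn_dcomp ?tgt_id ?src_id // fn_id.
Qed.

Lemma mulc_idr c : mulc c (id_diagram (tgt c)) c.
Proof.
rewrite /mulc src_id eqxx num_inv_id addn0 eqxx andbT /=.
apply/eqP/diag_ext => [|p pc]; rewrite ?src_dcomp ?src_id //.
by rewrite fn_dcomp ?src_id // fn_id ?fn_tgt.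
Qed.

Lemma mulc_idl_inv S b c : mulc (id_diagram S) b c -> S = src c /\ b = c.
Proof.
case/and3P => /eqP; rewrite tgt_id => Sb /eqP cE _.
have bc : b = c.
  rewrite cE; apply: diag_ext => [|p pb]; first by rewrite src_dcomp ?tgt_id // src_id.
  by rewrite fn_dcomp ?tgt_id ?src_id ?Sb // fn_id ?Sb.
by rewrite -bc.
Qed.

Lemma mulc_idr_inv S a c : mulc a (id_diagram S) c -> S = tgt c /\ a = c.
Proof.
case/and3P => /eqP; rewrite src_id => Sa /eqP cE _.
have ac : a = c.
  rewrite cE; apply: diag_ext => [|p pa]; first by rewrite src_dcomp ?src_id.
  by rewrite fn_dcomp ?src_id // fn_id // -Sa fn_tgt.
by rewrite -ac.
Qed.

Lemma smul_idem_l s x c : in_pmc Z x ->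
  smul (idem Z s) x c = if Z @: src c == s then x c else 0.
Proof.
move=> xP; rewrite smulE.
case: (boolP (basic c)) => [bc|nc]; last first.
  rewrite (in_pmc_non_basic xP nc) if_same -smulE.
  by apply: in_pmc_non_basic nc; apply: in_pmc_smul; first exact: in_pmc_idem.
rewrite (bigD1 (id_diagram (src c))) //= (bigD1 c) //= mulc_idl mul1r.
rewrite idem_coef (basic_id bc (or_introl erefl)) key_id /=.
rewrite [X in _ + X + _]big1 ?addr0 => [|b nb]; last first.
  case: (boolP (mulc (id_diagram (src c)) b c)) => [/mulc_idl_inv[_ e]|_]; last by rewrite mul0r.
  by rewrite e eqxx in nb.
rewrite big1 ?addr0 => [|a na]; first by case: (_ == s); rewrite ?mul1r ?mul0r.
apply: big1 => b _; rewrite idem_coef; case: (key Z a =P (set0, s)) => [ka|_]; last first.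
  by rewrite andbF mul0r mulr0.
case: (boolP (mulc a b c)) => [|_]; last by rewrite mul0r.
by rewrite (key0_id ka) => /mulc_idl_inv[e _]; rewrite (key0_id ka) e eqxx in na.
Qed.

Lemma smul_idem_r t x c : in_pmc Z x ->
  smul x (idem Z t) c = if Z @: tgt c == t then x c else 0.
Proof.
move=> xP; rewrite smulE.
case: (boolP (basic c)) => [bc|nc]; last first.
  rewrite (in_pmc_non_basic xP nc) if_same -smulE.
  by apply: in_pmc_non_basic nc; apply: in_pmc_smul; last exact: in_pmc_idem.
rewrite (bigD1 c) //= (bigD1 (id_diagram (tgt c))) //= mulc_idr mul1r.
rewrite idem_coef (basic_id bc (or_intror erefl)) key_id /=.
have tail a b : (a, b) != (c, id_diagram (tgt c)) ->
    (mulc a b c)%:R * ((x a : 'F_2) * (idem Z t b : 'F_2)) = 0.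
  move=> nab; rewrite idem_coef; case: (key Z b =P (set0, t)) => [kb|_]; last first.
    by rewrite andbF !mulr0.
  case: (boolP (mulc a b c)) => [|_]; last by rewrite mul0r.
  by rewrite (key0_id kb) => /mulc_idr_inv[e1 e2]; rewrite (key0_id kb) e1 e2 eqxx in nab.
rewrite [X in _ + X + _]big1 ?addr0 => [|b nb]; last first.
  by apply: tail; rewrite xpair_eqE eqxx.
rewrite big1 ?addr0 => [|a na]; first by case: (_ == t); rewrite ?mulr1 ?mulr0.
by apply: big1 => b _; apply: tail; rewrite xpair_eqE (negPf na).
Qed.

Definition between s t a := (Z @: src a == s) && (Z @: tgt a == t).

Lemma smul_idem_lr s t x c : in_pmc Z x ->
  smul (smul (idem Z s) x) (idem Z t) c = if between s t c then x c else 0.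
Proof.
move=> xP; rewrite smul_idem_r; last by apply: in_pmc_smul => //; apply: in_pmc_idem.
by rewrite smul_idem_l // /between; case: (_ == s); case: (_ == t).
Qed.

Lemma smul_idem_lr_id s t x : in_pmc Z x -> (forall a, x a != 0 -> between s t a) ->
  smul (smul (idem Z s) x) (idem Z t) = x.
Proof.
move=> xP xst; apply: strandsP => c; rewrite smul_idem_lr //.
by case: ifP => // nst; apply/esym/eqP; apply: contraFT nst; apply: xst.
Qed.

Lemma idem_algP s t x :
  x \in idem_alg Z s t <-> in_pmc Z x /\ (forall a, x a != 0 -> between s t a).
Proof.
have lin : linear (fun x => smul (smul (idem Z s) x) (idem Z t)).
  by move=> l u v /=; rewrite smul_linearr smul_linearl.
split=> [/memv_imgP[u /pmc_algP uP ->]|[xP xst]].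
  rewrite linfunE_of //; split=> [|a].
    by do ?apply: in_pmc_smul => //; apply: in_pmc_idem.
  by rewrite smul_idem_lr //; case: ifP => //; rewrite eqxx.
apply/memv_imgP; exists x; first exact/pmc_algP.
by rewrite linfunE_of // smul_idem_lr_id.
Qed.

End Idempotents.

(** * Homology between two idempotents *)

(** Stated for an abstract differential algebra of characteristic 2, where the
    Leibniz rule has no sign. *)
Lemma dg_mul_homologous (V : zmodType) (mul : V -> V -> V) (d : V -> V) :
  left_distributive mul +%R -> right_distributive mul +%R ->
  {morph d : x y / x + y} ->
  (forall x y, d (mul x y) = mul (d x) y + mul x (d y)) ->
  (forall x, d (d x) = 0) ->
  forall z z' y y', d z = 0 -> d z' = 0 ->
  mul (z + d y) (z' + d y') - mul z z' = d (mul z y' + (mul y z' + mul y (d y'))).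
Proof.
move=> mulDl mulDr dD dM dd z z' y y' z0 z'0.
have mul0l x : mul 0 x = 0 by apply: (addIr (mul 0 x)); rewrite -mulDl !add0r.
have mul0r x : mul x 0 = 0 by apply: (addIr (mul x 0)); rewrite -mulDr !add0r.
rewrite !dD !dM dd z0 z'0 !mul0l !mul0r !addr0 add0r mulDl !mulDr.
by rewrite -(addrA (mul z z')) [LHS]addrC addKr.
Qed.

Section Homology.

Variables (k : nat) (Z : pmc k).
Implicit Types (a b c : diagram (4 * k)) (x y z u v : strands (4 * k)).
Implicit Types (s t : {set 'I_(2 * k)}) (l : rat) (h : chain (4 * k)).
Local Notation basic := (is_basic Z).
Local Notation bd := (boundaries Z).

Lemma sdiffD : {morph @sdiff (4 * k) : x y / x + y}.
Proof. move=> x y; by have := sdiff_linear 1 x y; rewrite !scale1r. Qed.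

Lemma boundariesP x : x \in bd <-> exists2 y, in_pmc Z y & x = sdiff y.
Proof.
split=> [/memv_imgP[y /pmc_algP yP ->]|[y yP ->]].
  by exists y; rewrite // linfunE_of //; apply: sdiff_linear.
apply/memv_imgP; exists y; first exact/pmc_algP.
by rewrite linfunE_of //; apply: sdiff_linear.
Qed.

Lemma cyclesP x : x \in cycles Z <-> in_pmc Z x /\ sdiff x = 0.
Proof.
have e : linfun (@sdiff (4 * k)) x = sdiff x by apply/linfunE_of/sdiff_linear.
rewrite memv_cap memv_ker e; split=> [/andP[/pmc_algP xP /eqP x0]|[xP x0]]; first by [].
by rewrite x0 eqxx andbT; apply/pmc_algP.
Qed.

Lemma cls_eq x y : x - y \in bd <-> cls Z x = cls Z y.
Proof.
rewrite -lker_cls memv_ker linearB subr_eq0.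
by split=> /eqP.
Qed.

Lemma cls_mod x : cls Z x - x \in bd.
Proof.
set B := bd; have d0 : (B :&: B^C = 0)%VS by apply: capv_compl.
have d0' : (B^C :&: B = 0)%VS by rewrite capvC.
have dec : cls Z x + daddv_pi B (B^C)%VS x = x.
  by apply: daddv_pi_add => //; rewrite addvC addv_complf memvf.
by rewrite -[X in _ - X]dec opprD addrA subrr add0r rpredN memv_pi.
Qed.

Lemma smulDl : left_distributive (@smul (4 * k)) +%R.
Proof. move=> x y z; by have := smul_linearl z 1 x y; rewrite !scale1r. Qed.
Lemma smulDr : right_distributive (@smul (4 * k)) +%R.
Proof. move=> x y z; by have := smul_linearr x 1 y z; rewrite !scale1r. Qed.

Lemma smul0l x : smul 0 x = 0.
Proof. by apply: (addIr (smul 0 x)); rewrite -smulDl !add0r. Qed.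
Lemma smul0r x : smul x 0 = 0.
Proof. by apply: (addIr (smul x 0)); rewrite -smulDr !add0r. Qed.

Lemma cycles_smul x y : x \in cycles Z -> y \in cycles Z -> smul x y \in cycles Z.
Proof.
move=> /cyclesP[xP x0] /cyclesP[yP y0]; apply/cyclesP; split; first exact: in_pmc_smul.
by rewrite leibniz x0 y0 smul0l (smul0r x) addr0.
Qed.

(** The class map picks representatives that need not respect the gradings nor be
    idempotent; only their classes are known.  This makes them harmless. *)
Lemma smul_mod_boundaries z z' u v :
  z \in cycles Z -> z' \in cycles Z -> u - z \in bd -> v - z' \in bd ->
  smul u v - smul z z' \in bd.
Proof.
move=> /cyclesP[zP z0] /cyclesP[z'P z'0] /boundariesP[y yP uE] /boundariesP[y' y'P vE].
apply/boundariesP; exists (smul z y' + (smul y z' + smul y (sdiff y'))).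
  apply: in_pmcD; [|apply: in_pmcD]; apply: in_pmc_smul => //.
  exact: in_pmc_sdiff.
have -> : u = z + sdiff y by rewrite -uE addrC subrK.
have -> : v = z' + sdiff y' by rewrite -vE addrC subrK.
exact: (dg_mul_homologous smulDl smulDr sdiffD (@leibniz _) (@sdiff_sdiff _)).
Qed.

Lemma idem_cycle s : idem Z s \in cycles Z.
Proof.
apply/cyclesP; split; first exact: in_pmc_idem.
apply: strandsP => b; rewrite strands0 sdiffE big1 // => a ab.
rewrite idem_coef; case: (key Z a =P (set0, s)) => [ka|_]; last by rewrite andbF.
by have := cov_inv ab; rewrite (key0_id ka) num_inv_id.
Qed.

Lemma cycles_idem_smul s t x : x \in cycles Z ->
  smul (smul (idem Z s) x) (idem Z t) \in cycles Z.
Proof.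
move=> xc; apply: cycles_smul (idem_cycle t).
exact: cycles_smul (idem_cycle s) xc.
Qed.

Definition summand s t l h a := between Z s t a && bideg l h a.

Definition complex_elt s t l h x :=
  in_pmc Z x /\ (forall a, x a != 0 -> summand s t l h a).

(** Multiplying by the idempotents projects onto the diagrams between s and t, so
    the summand is the homology of the complex that they span. *)
Lemma idem_homology_degP s t l h v : v \in idem_homology_deg Z s t l h <->
  exists x, [/\ complex_elt s t l h x, sdiff x = 0 & v = cls Z x].
Proof.
have linh : linear (fun u => hmul Z (hmul Z (cls Z (idem Z s)) u) (cls Z (idem Z t))).
  by move=> r u w /=; rewrite /hmul smul_linearr linearP smul_linearl linearP.
have hmulE x : x \in cycles Z ->
    hmul Z (hmul Z (cls Z (idem Z s)) (cls Z x)) (cls Z (idem Z t)) =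
    cls Z (smul (smul (idem Z s) x) (idem Z t)).
  move=> xc; apply/cls_eq/smul_mod_boundaries.
  - exact: cycles_smul (idem_cycle s) xc.
  - exact: idem_cycle.
  - rewrite -[X in X - _](subrK (smul (cls Z (idem Z s)) (cls Z x))) -addrA.
    apply: rpredD; first exact: cls_mod.
    by apply: smul_mod_boundaries; rewrite ?cls_mod ?idem_cycle.
  - exact: cls_mod.
rewrite memv_cap; split.
  case/andP => /memv_imgP[u /memv_imgP[c cc ->]]; rewrite linfunE_of // (hmulE _ cc) => ve.
  case/memv_imgP => x; rewrite memv_cap => /andP[xc /deg_partP[xP xd]] vE.
  have wc : smul (smul (idem Z s) c) (idem Z t) \in cycles Z.
    exact: cycles_idem_smul.
  have xwc : smul (smul (idem Z s) x) (idem Z t) \in cycles Z.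
    exact: cycles_idem_smul.
  exists (smul (smul (idem Z s) x) (idem Z t)); split; last 1 first.
  - transitivity (hmul Z (hmul Z (cls Z (idem Z s)) v) (cls Z (idem Z t))).
      pose H w := hmul Z (hmul Z (cls Z (idem Z s)) w) (cls Z (idem Z t)).
      have Hv : H v = cls Z (smul (smul (idem Z s) (smul (smul (idem Z s) c) (idem Z t))) (idem Z t)).
        exact: (etrans (congr1 H ve) (hmulE _ wc)).
      apply: etrans _ (esym Hv); apply: (etrans ve); apply/(congr1 (cls Z))/esym.
      apply: smul_idem_lr_id; first by case/cyclesP: wc.
      case/cyclesP: cc => cP _ a.
      by rewrite (smul_idem_lr s t a cP); case: ifP => // _; rewrite eqxx.
    by rewrite vE; apply: hmulE.
  - split; first by case/cyclesP: xwc.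
    move=> a; rewrite smul_idem_lr //; case: ifP => [st xa|]; last by rewrite eqxx.
    by rewrite /summand st xd.
  - by case/cyclesP: xwc.
case=> x [[xP xQ] x0 ->]; have xc : x \in cycles Z by apply/cyclesP.
apply/andP; split.
  apply/memv_imgP; exists (cls Z x); first exact: memv_img.
  rewrite linfunE_of // (hmulE _ xc) smul_idem_lr_id // => a /xQ/andP[]//.
apply: memv_img; rewrite memv_cap xc; apply/deg_partP; split=> // a /xQ/andP[]//.
Qed.

End Homology.

(** * Acyclic matchings *)

Section Matching.

Variables (k : nat) (Z : pmc k).
Implicit Types (a b c v w : diagram (4 * k)) (x y : strands (4 * k)).
Implicit Types (l : rat).
Local Notation basic := (is_basic Z).

Lemma complex_eltD s t l h x y :
  complex_elt Z s t l h x -> complex_elt Z s t l h y -> complex_elt Z s t l h (x + y).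
Proof.
move=> [xP xQ] [yP yQ]; split; first exact: in_pmcD.
move=> a; rewrite strandsD; apply: contraNT => na.
have /eqP -> : x a == 0 by apply: contraNT na; apply: xQ.
by rewrite add0r; apply: contraNT na; apply: yQ.
Qed.

Lemma between_cov s t a b : cov a b -> between Z s t b = between Z s t a.
Proof. by move=> ab; rewrite /between (cov_src ab) (cov_tgt ab). Qed.

Lemma summand_cov s t l h a b : cov a b ->
  summand Z s t (l + 1) h a = summand Z s t l h b.
Proof.
move=> ab; rewrite /summand /bideg (between_cov _ _ ab) (cov_chain ab) (cov_maslov ab).
by rewrite (inj_eq (addIr _)).
Qed.

Lemma summand_mv s t l h a p : basic a -> fixed a p ->
  summand Z s t l h (mv Z a p) = summand Z s t l h a.
Proof.
move=> ba fa; have [e1 e2] := classes_mv ba fa.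
by rewrite /summand /between /bideg e1 e2 maslov_mv // chain_mv.
Qed.

Lemma complex_elt_sdiff s t l h y :
  complex_elt Z s t (l + 1) h y -> complex_elt Z s t l h (sdiff y).
Proof.
move=> [yP yQ]; split; first exact: in_pmc_sdiff.
move=> b; rewrite sdiffE => /sum_F2_neq0[a ab /yQ].
by rewrite (summand_cov _ _ _ _ ab).
Qed.

Definition restrict (P : pred (diagram (4 * k))) x : strands (4 * k) :=
  [ffun a => if P a then x a else 0].

Lemma restrictE P x a : restrict P x a = if P a then x a else 0.
Proof. by rewrite ffunE. Qed.

Lemma complex_elt_restrict s t l h x : in_pmc Z x ->
  complex_elt Z s t l h (restrict (summand Z s t l h) x).
Proof.
move=> [xb xm]; split; first split.
- by move=> a; rewrite restrictE; case: ifP => [_ /xb|_]; rewrite ?eqxx.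
- by move=> a p ba fa; rewrite !restrictE summand_mv // xm.
by move=> a; rewrite restrictE; case: ifP => //; rewrite eqxx.
Qed.

Lemma sdiff_restrict s t l h x :
  sdiff (restrict (summand Z s t (l + 1) h) x) = restrict (summand Z s t l h) (sdiff x).
Proof.
apply: strandsP => b; rewrite [RHS]restrictE [LHS]sdiffE.
case: ifP => sb; [rewrite sdiffE|]; [apply: eq_bigr | apply: big1] => a ab;
  by rewrite restrictE (summand_cov _ _ _ _ ab) sb.
Qed.

(** The basic diagrams of the complex in all Maslov degrees. *)
Definition in_complex s t h a := [&& basic a, between Z s t a & chain_of a == h].

Lemma in_complex_cov s t h a b : cov a b -> in_complex s t h b = in_complex s t h a.
Proof.
by move=> ab; rewrite /in_complex (cov_basic _ ab) (between_cov _ _ ab) (cov_chain ab).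
Qed.

Lemma in_complex_mv s t h a p : basic a -> fixed a p ->
  in_complex s t h (mv Z a p) = in_complex s t h a.
Proof.
move=> ba fa; have [e1 e2] := classes_mv ba fa.
by rewrite /in_complex /between e1 e2 chain_mv // basic_mv // ba.
Qed.

Lemma complex_elt_in s t l h x a : complex_elt Z s t l h x -> x a != 0 -> in_complex s t h a.
Proof.
move=> [[xb _] xQ] xa; have /andP[st /andP[_ ch]] := xQ a xa.
by rewrite /in_complex (xb a xa) st.
Qed.

(** Discrete Morse theory.  The diagrams in D are matched with diagrams in U of the
    next degree, through tau and beta, so that v is a term of the differential of
    beta v.  All other diagrams in U whose differential has the term v are matched
    to diagrams of smaller rank.  Because elements are functions on diagrams that
    are invariant under moving constant strands, several diagrams of U may be
    matched to one of D; they then carry the same coefficient. *)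
Section Morse.

Variables (s t : {set 'I_(2 * k)}) (h : chain (4 * k)).
Variables (U D : pred (diagram (4 * k))) (tau beta : diagram (4 * k) -> diagram (4 * k)).
Variable r : diagram (4 * k) -> nat.
Local Notation B := (in_complex s t h).

Hypothesis U_mv : forall a p, B a -> fixed a p -> U (mv Z a p) = U a.
Hypothesis tau_mv : forall x a p, in_pmc Z x -> B a -> U a -> fixed a p ->
  x (tau (mv Z a p)) = x (tau a).
Hypothesis tau_D : forall a, B a -> U a -> [/\ B (tau a), D (tau a) & maslov a = maslov (tau a) + 1].
Hypothesis betaP : forall v, B v -> D v ->
  [/\ B (beta v), U (beta v), cov (beta v) v & tau (beta v) = v].
Hypothesis beta_tau : forall x a, in_pmc Z x -> B a -> U a -> x a = x (beta (tau a)).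
Hypothesis cov_UD : forall a v, B a -> D v -> cov a v -> U a || D a.
Hypothesis rank_lt : forall a v, B a -> U a -> D v -> cov a v -> a != beta v ->
  (r (tau a) < r v)%N.

Let homotopy x : strands (4 * k) := [ffun a => if B a && U a then x (tau a) else 0].

Let homotopyE x a : homotopy x a = if B a && U a then x (tau a) else 0.
Proof. by rewrite ffunE. Qed.

Let homotopy_complex l x : complex_elt Z s t l h x -> complex_elt Z s t (l + 1) h (homotopy x).
Proof.
move=> xW; have [xP xQ] := xW; split; first split.
- by move=> a; rewrite homotopyE; case: ifP => [/andP[/and3P[]] //|]; rewrite eqxx.
- move=> a p ba fa; rewrite !homotopyE in_complex_mv //.
  by case: (boolP (B a)) => //= Ba; rewrite U_mv //; case: ifP => // Ua; rewrite tau_mv.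
move=> a; rewrite homotopyE; case: ifP => [/andP[Ba Ua] xa|]; last by rewrite eqxx.
have [_ _ e] := tau_D Ba Ua; have /andP[_ /andP[/eqP ml _]] := xQ _ xa.
case/and3P: Ba => _ st ch.
by rewrite /summand st /bideg ch e ml eqxx.
Qed.

Let complex_elt_notin l x a : complex_elt Z s t l h x -> ~~ B a -> x a = 0.
Proof. by move=> xW nB; apply/eqP; apply: contraNT nB; apply: complex_elt_in xW. Qed.

Let sdiff_homotopy l x v : complex_elt Z s t l h x -> B v -> D v ->
  (forall w, D w -> (r w < r v)%N -> x w = 0) -> sdiff (homotopy x) v = x v.
Proof.
move=> xW Bv Dv x0; have [Bb Ub cb tb] := betaP Bv Dv.
rewrite sdiffE (bigD1 (beta v)) //= homotopyE Bb Ub /= tb big1 ?addr0 //.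
move=> a /andP[av nab]; rewrite homotopyE; case: ifP => // /andP[Ba Ua].
by have [_ Dt _] := tau_D Ba Ua; apply: x0 => //; apply: rank_lt.
Qed.

(** Adding the boundary of the homotopy removes the coefficients in D of the lowest
    rank that is left. *)
Let clear_D l x m : complex_elt Z s t l h x -> exists2 y, complex_elt Z s t (l + 1) h y &
  forall v, D v -> (r v < m)%N -> (x + sdiff y) v = 0.
Proof.
move=> xW; elim: m => [|m [y yW IH]].
  exists 0; last by [].
  by split=> [|a]; [exact: in_pmc0 | rewrite strands0 eqxx].
pose x' := x + sdiff y.
have x'W : complex_elt Z s t l h x' by apply: complex_eltD xW (complex_elt_sdiff yW).
exists (y + homotopy x') => [|v Dv rv].
  by apply: complex_eltD yW _; apply: homotopy_complex.
have -> : x + sdiff (y + homotopy x') = x' + sdiff (homotopy x').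
  by rewrite sdiffD addrA.
rewrite strandsD; case: (boolP (B v)) => [Bv|nB]; last first.
  rewrite (complex_elt_notin x'W nB) add0r.
  by apply: complex_elt_notin nB; apply/complex_elt_sdiff/homotopy_complex/x'W.
rewrite (sdiff_homotopy x'W Bv Dv) ?F2_addxx // => w Dw rw.
by apply: IH => //; apply: leq_trans rw _; rewrite -ltnS.
Qed.

(** Once the coefficients in D vanish, the differential at v in D determines the
    coefficient at beta v from those of smaller rank, so these vanish too. *)
Lemma morse l x : complex_elt Z s t l h x -> (forall v, D v -> sdiff x v = 0) ->
  exists2 y, complex_elt Z s t (l + 1) h y &
    forall a, U a || D a -> (x + sdiff y) a = 0.
Proof.
move=> xW dx0; have [y yW x'D] := clear_D (\max_a r a).+1 xW.
exists y => // a; pose x' := x + sdiff y; rewrite -/x'.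
have x'W : complex_elt Z s t l h x' by apply: complex_eltD xW (complex_elt_sdiff yW).
have {}x'D v : D v -> x' v = 0 by move=> Dv; apply: x'D => //; rewrite ltnS leq_bigmax.
have dx'0 v : D v -> sdiff x' v = 0.
  by move=> Dv; rewrite sdiffD sdiff_sdiff addr0 dx0.
case/orP => [|/x'D //]; have [m] := ubnP (r (tau a)).
elim: m a => // m IH a le_m Ua.
case: (boolP (B a)) => [Ba|nB]; last exact: complex_elt_notin x'W nB.
have [Bt Dt _] := tau_D Ba Ua; have [Bb Ub cb tb] := betaP Bt Dt.
have [x'P _] := x'W; rewrite (beta_tau x'P Ba Ua).
have := dx'0 _ Dt; rewrite sdiffE (bigD1 (beta (tau a))) //= big1 ?addr0 //.
move=> c /andP[ct nc]; case: (boolP (B c)) => [Bc|nB]; last exact: complex_elt_notin x'W nB.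
case/orP: (cov_UD Bc Dt ct) => [Uc|/x'D //].
apply: (IH _ _ Uc); apply: leq_trans (rank_lt Bc Uc Dt ct nc) _.
by rewrite -ltnS.
Qed.

End Morse.

End Matching.

(** * Chains with a multiplicity at least two *)

Section Multiplicity.

Variables (k : nat) (Z : pmc k).
Local Notation point := 'I_(4 * k).
Implicit Types (a b c v : diagram (4 * k)) (x : strands (4 * k)) (i j p q y : point).
Local Notation basic := (is_basic Z).

Lemma swap_mv a i j p : basic a -> fixed a p -> swappable a i j -> i != p -> j != p ->
  [/\ fixed (swap a i j) p, basic (swap a i j) & swap (mv Z a p) i j = mv Z (swap a i j) p].
Proof.
move=> ba fa sw ip jp; have /and4P[ia ja h1 h2] := sw.
have bs : basic (swap a i j) by rewrite /is_basic src_swap // tgt_swap.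
have fs : fixed (swap a i j) p.
  by rewrite /fixed src_swap // fixed_src // fn_swap ?fixed_src // tpermD // fixed_fn // eqxx.
have np' : partner Z p \notin src a by exact/basic_src/fixed_src.
have ip' : i != partner Z p by apply: contraNneq np' => <-.
have jp' : j != partner Z p by apply: contraNneq np' => <-.
have sw' : swappable (mv Z a p) i j.
  by rewrite /swappable !mem_src_mv // ip jp ia ja !orbT !fn_mv // h1 h2.
split=> //; apply: diag_ext => [|y].
  by apply/setP => y; rewrite (src_swap sw') !mem_src_mv // src_swap.
rewrite (src_swap sw') => ym; rewrite (fn_swap sw') //; move: ym.
rewrite mem_src_mv // => /orP[/eqP->|/andP[yp ya]].
  by rewrite tpermD // !fn_mv_partner.
have tyn : tperm i j y != p by case: tpermP => [_|_|].
by rewrite !fn_mv ?src_swap ?tperm_stable // fn_swap.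
Qed.

Section Level.

Variable m : nat.

Definition lowest2 (C : {set point}) : option (point * point) :=
  [pick ij | [&& ij.1 \in C, ij.2 \in C, (ij.1 < ij.2)%N &
     [forall (y | y \in C), (y == ij.1) || (ij.2 <= y)%N]]].

Lemma lowest2P C i j : lowest2 C = Some (i, j) ->
  [/\ i \in C, j \in C, (i < j)%N & forall y, y \in C -> y = i \/ (j <= y)%N].
Proof.
rewrite /lowest2; case: pickP => // -[i' j'] /= /and4P[iC jC lij /forall_inP h] [<- <-].
by split=> // y /h /orP[/eqP|]; [left|right].
Qed.

Lemma lowest2_exists (C : {set point}) : (1 < #|C|)%N -> exists i j, lowest2 C = Some (i, j).
Proof.
move=> C2; have /card_gt0P[i0 i0C] : (0 < #|C|)%N by apply: ltn_trans C2.
case: (arg_minnP (fun y : point => val y) i0C) => i iC' imin; have {iC'} iC : i \in C by exact: iC'.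
have /card_gt0P[j0 j0C] : (0 < #|C :\ i|)%N by move: C2; rewrite (cardsD1 i) iC.
case: (arg_minnP (fun y : point => val y) j0C) => j jC' jmin.
have /setD1P[ji jC] : j \in C :\ i by exact: jC'.
rewrite /lowest2; case: pickP => [[i' j'] _|/(_ (i, j))]; first by exists i', j'.
rewrite /= iC jC /= ltn_neqAle imin // andbT eq_sym -val_eqE /= in ji *.
move/negbT; rewrite ji /= => /forall_inPn[y yC]; rewrite negb_or => /andP[yi].
have yC' : y \in C :\ i by rewrite !inE yi.
by rewrite (jmin _ yC').
Qed.

(** The two lowest starting points of strands over the arc that starts at m.  With
    the lowest ones no strand over the arc starts below or between them, so that
    exchanging them changes the number of crossings by exactly one. *)
Definition low a := lowest2 (strands_over a m).

Definition low_inverted a :=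
  if low a is Some (i, j) then (fn a j < fn a i)%N else false.
Definition low_straight a :=
  if low a is Some (i, j) then (fn a i < fn a j)%N else false.
Definition low_swap a := if low a is Some (i, j) then swap a i j else a.
(** Resolving a crossing can only move starting points of the strands over the arc
    upwards. *)
Definition low_rank a : nat := \sum_(y in strands_over a m) y.

Lemma mem_over a y : (y \in strands_over a m) = [&& y \in src a, (y <= m)%N & (m < fn a y)%N].
Proof. by rewrite inE. Qed.

Lemma lowP a i j : low a = Some (i, j) ->
  [/\ i \in strands_over a m, j \in strands_over a m, (i < j)%N, swappable a i j &
      forall y, y \in strands_over a m -> y = i \/ (j <= y)%N].
Proof.
case/lowest2P => iC jC lij mn; split=> //.
move: iC jC; rewrite !mem_over => /and3P[ia h1 h2] /and3P[ja h3 h4].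
by rewrite /swappable ia ja /=; lia.
Qed.

Lemma over_swap a i j : low a = Some (i, j) -> strands_over (swap a i j) m = strands_over a m.
Proof.
case/lowP => iC jC lij sw _; apply/setP => y.
move: iC jC; rewrite !mem_over src_swap // => /and3P[ia h1 h2] /and3P[ja h3 h4].
case ya: (y \in src a) => //=; rewrite fn_swap //.
by case: tpermP => [->|->|//]; rewrite ?h1 ?h2 ?h3 ?h4.
Qed.

Lemma low_swap_low a i j : low a = Some (i, j) -> low (swap a i j) = Some (i, j).
Proof. by move=> la; rewrite /low over_swap. Qed.

Lemma low_swap_eq a i j : low a = Some (i, j) ->
  [/\ low_swap a = swap a i j, low_inverted (swap a i j) = low_straight a,
      low_straight (swap a i j) = low_inverted a & low_rank (swap a i j) = low_rank a].
Proof.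
move=> la; have [iC jC lij sw _] := lowP la; have /and4P[ia ja _ _] := sw.
rewrite /low_swap /low_inverted /low_straight /low_rank low_swap_low // la over_swap //.
by rewrite !fn_swap // tpermL tpermR.
Qed.

Lemma low_swap_cov a i j : low a = Some (i, j) -> (fn a j < fn a i)%N -> cov a (swap a i j).
Proof.
move=> la fji; have [iC jC lij sw mn] := lowP la; have /and4P[ia ja _ _] := sw.
apply/covP; exists i, j; split=> //; split=> //.
rewrite num_inv_swap // num_invE; apply: inv_swap_eq => // y ya /andP[iy yj].
move: iC jC; rewrite !mem_over ia ja /= => /andP[h1 h2] /andP[h3 h4].
case: (leqP (fn a y) m) => [h|h]; first by apply/negP; lia.
have [|e|] := mn y; first by rewrite mem_over ya h; lia.
  by rewrite e ltnn in iy.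
by rewrite leqNgt yj.
Qed.

(** If the strands over the arc start at the same points before and after the
    resolution, the same two are lowest.  They can become uncrossed only when their own
    crossing is resolved: any other exchange that uncrosses them would involve a
    strand over the arc that starts lower or between, or jump over a strand. *)
Lemma low_rank_lt a v : low_inverted a -> low_straight v -> cov a v ->
  a != low_swap v -> (low_rank (low_swap a) < low_rank v)%N.
Proof.
case la: (low a) => [[i j]|]; last by rewrite /low_inverted la.
have [-> _ _ ->] := low_swap_eq la.
rewrite /low_inverted la => fji Dv av nav; have eN := cov_inv av.
have [iC jC lij sw mn] := lowP la.
case/covP: av => p [q [pa qa lpq fqp [vE _]]].
have swpq := inversion_swappable pa qa lpq fqp.
have gp := fn_ge pa; have gq := fn_ge qa.
have overv y : (y \in strands_over v m) =
    [&& y \in src a, (y <= m)%N & (m < fn a (tperm p q y))%N].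
  by rewrite mem_over vE src_swap //; case ya: (y \in src a); rewrite // fn_swap.
case: (boolP [&& (q <= m)%N, (fn a q <= m)%N & (m < fn a p)%N]) => [/and3P[h1 h2 h3]|hc].
  have Cv : strands_over v m = q |: strands_over a m :\ p.
    apply/setP => y; rewrite overv !inE.
    case: (tpermP p q y) => [->|->|/eqP yp /eqP yq].
    - rewrite eqxx (ltnNge m (fn a q)) h2 !andbF /= ?orbF; apply/esym/negbTE.
      by rewrite -val_eqE /= neq_ltn lpq.
    - by rewrite eqxx qa h1 h3.
    by rewrite (negPf yp) (negPf yq).
  have pC : p \in strands_over a m by rewrite mem_over pa h3 andbT (leq_trans (ltnW lpq)).
  have qC : q \notin strands_over a m :\ p by rewrite !inE (ltnNge m (fn a q)) h2 !andbF.
  rewrite /low_rank Cv big_setU1 //= (big_setD1 p pC) /= ltn_add2r //.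
have Cv : strands_over v m = strands_over a m.
  apply/setP => y; rewrite overv mem_over; case ya: (y \in src a) => //=.
  by case: (tpermP p q y) => [->|->|//]; move: hc lpq gp gq fqp; clear; lia.
have lv : low v = Some (i, j) by rewrite /low Cv -/(low a).
have iv : i \in strands_over v m by rewrite Cv.
have jv : j \in strands_over v m by rewrite Cv.
have /and4P[ia ja _ _] := sw.
move: Dv; rewrite /low_straight lv vE !fn_swap // => Dv.
move: iC jC iv jv; rewrite !overv !mem_over ia ja /=.
move=> /andP[im mi] /andP[jm mj] /andP[_ mi'] /andP[_ mj'].
have inC y : y \in src a -> (y <= m)%N -> (m < fn a y)%N -> y = i \/ (j <= y)%N.
  by move=> ya h1 h2; apply: mn; rewrite mem_over ya h1.
exfalso; move: Dv mi' mj'.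
have [eip|nip] := eqVneq i p.
  rewrite -eip tpermL; have [ejq|njq] := eqVneq j q.
    by case/negP: nav; rewrite /low_swap lv vE -eip -ejq swapK ?eqxx // eip ejq.
  rewrite tpermD //; last by rewrite eq_sym.
    move=> h1 h2 _; case: (ltngtP q j) => [hq|hq|/val_inj e].
    - have [|e|] := inC q qa _ h2; first exact: leq_trans (ltnW hq) jm.
        by move: lpq; rewrite e eip ltnn.
      by rewrite leqNgt hq.
    - have := @inv_swap_between _ (src a) (fn a) p q j pa qa ja.
      rewrite -num_inv_swap // -num_invE -vE => /(_ _ _) h.
      have : ((num_inv (val v)).+1 < num_inv (val a))%N.
        by apply: h; rewrite -eip ?lij ?hq ?h1 ?fji.
      by rewrite eN ltnn.
    - by rewrite e eqxx in njq.
  by apply: contraTneq lij => ->; rewrite ltnn.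
have [eiq|niq] := eqVneq i q.
  move: lpq; rewrite -eiq => lpi; rewrite tpermR => _ h2 _.
  have [|e|] := inC p pa _ h2; first exact: leq_trans (ltnW lpi) im.
    by rewrite e eqxx in nip.
  by rewrite leqNgt (ltn_trans lpi lij).
have [ejq|njq] := eqVneq j q.
  move: lpq; rewrite -ejq => lpj; rewrite tpermR => _ _ h2.
  have [|e|] := inC p pa _ h2; first exact: leq_trans (ltnW lpj) jm.
    by rewrite e eqxx in nip.
  by rewrite leqNgt lpj.
have -> : tperm p q i = i by rewrite tpermD // eq_sym.
have [ejp|njp] := eqVneq j p.
  by rewrite -ejp tpermL => h1; rewrite -ejp in fqp; move: h1 fqp fji; clear; lia.
by rewrite tpermD 1?eq_sym // => h1; move: h1 fji; clear; lia.
Qed.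

End Level.

(** Crossing and uncrossing the two lowest strands over the arc is a perfect
    matching. *)
Lemma acyclic_multiplicity s t l h (m : nat) x :
  (forall a, in_complex Z s t h a -> (1 < #|strands_over a m|)%N) ->
  complex_elt Z s t l h x -> sdiff x = 0 ->
  exists2 y, in_pmc Z y & x = sdiff y.
Proof.
move=> m2 xW dx0.
have lowB a : in_complex Z s t h a -> exists i j, low m a = Some (i, j).
  by move/m2/lowest2_exists.
have basicB a : in_complex Z s t h a -> basic a by case/and3P.
have lowmv a p : in_complex Z s t h a -> fixed a p -> low m (mv Z a p) = low m a.
  by move=> /basicB ba fa; rewrite /low strands_over_mv.
have nfix a i j p : low m a = Some (i, j) -> fixed a p -> i != p /\ j != p.
  case/lowP => iC jC _ _ _ fp; have fpp := fixed_fn fp.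
  by split; [move: iC | move: jC]; rewrite mem_over => /and3P[_ h1 h2];
    apply: contraTneq h2 => e; rewrite e fpp -e -leqNgt.
have covB a : low_inverted m a -> cov a (low_swap m a).
  rewrite /low_inverted /low_swap; case la: (low m a) => [[i j]|] // fji.
  exact: low_swap_cov la fji.
have swapK2 a : in_complex Z s t h a -> low_swap m (low_swap m a) = a.
  move=> /lowB[i [j la]]; have [-> _ _ _] := low_swap_eq la.
  have [-> _ _ _] := low_swap_eq (low_swap_low la).
  by have [_ _ _ sw _] := lowP la; rewrite swapK.
have [|||||||| y yW xy] := @morse k Z s t h (low_inverted m) (low_straight m)
    (low_swap m) (low_swap m) (low_rank m) _ _ _ _ _ _ _ l x xW.
- move=> a p Ba fa; have [i [j la]] := lowB a Ba; have ba := basicB a Ba.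
  have [ip jp] := nfix _ _ _ _ la fa; have [iC jC _ sw _] := lowP la.
  have /and4P[ia ja _ _] := sw.
  by rewrite /low_inverted lowmv // la !fn_mv.
- move=> z a p [_ zm] Ba _ fa; have [i [j la]] := lowB a Ba; have ba := basicB a Ba.
  have [ip jp] := nfix _ _ _ _ la fa; have [_ _ _ sw _] := lowP la.
  have [fs bs e] := swap_mv ba fa sw ip jp.
  by rewrite /low_swap lowmv // la e zm.
- move=> a Ba Ua; have ca := covB a Ua; rewrite (in_complex_cov _ _ _ _ ca) Ba.
  have [i [j la]] := lowB a Ba; have [-> _ -> _] := low_swap_eq la.
  by rewrite Ua; split=> //; move: ca; rewrite /low_swap la => /cov_maslov.
- move=> v Bv Dv; have [i [j lv]] := lowB v Bv; have [e1 e2 _ _] := low_swap_eq lv.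
  have Ub : low_inverted m (low_swap m v) by rewrite e1 e2.
  have := covB _ Ub; rewrite swapK2 // => cv.
  by rewrite -(in_complex_cov _ _ _ _ cv).
- by move=> z a _ Ba _; rewrite swapK2.
- move=> a v Ba _ _; have [i [j la]] := lowB a Ba.
  have [_ _ lij sw _] := lowP la; have /and4P[ia ja _ _] := sw.
  rewrite /low_inverted /low_straight la; case: ltngtP => // /val_inj/fn_inj e.
  by move: lij; rewrite (e ja ia) ltnn.
- by move=> a v _ Ua Dv av nav; apply: low_rank_lt.
- by move=> v _; rewrite dx0 strands0.
exists y; first by case: yW.
apply: strandsP => a; case: (boolP (in_complex Z s t h a)) => [Ba|nB].
  have [i [j la]] := lowB a Ba; have [_ _ lij sw _] := lowP la.
  have := xy a; rewrite strandsD.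
  have -> : low_inverted m a || low_straight m a.
    have /and4P[ia ja _ _] := sw.
    rewrite /low_inverted /low_straight la; case: ltngtP => // /val_inj/fn_inj e.
    by move: lij; rewrite (e ja ia) ltnn.
  by move=> /(_ isT) e; rewrite -[LHS]addr0 -(F2_addxx (sdiff y a)) addrA e add0r.
have zero z l' : complex_elt Z s t l' h z -> z a = 0.
  by move=> zW; apply/eqP; apply: contraNT nB; apply: complex_elt_in zW.
by rewrite (zero _ _ xW) (zero _ _ (complex_elt_sdiff yW)).
Qed.

End Multiplicity.

(** * Chains with multiplicities zero and one *)

Section Thin.

Variables (k : nat) (Z : pmc k).
Local Notation point := 'I_(4 * k).
Implicit Types (a b c u v : diagram (4 * k)) (x : strands (4 * k)) (i j p q e y z : point).
Local Notation basic := (is_basic Z).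
Local Notation pt := (partner Z).

Lemma mvC a p q : basic a -> fixed a p -> fixed a q -> p != q ->
  mv Z (mv Z a p) q = mv Z (mv Z a q) p.
Proof.
move=> ba fp fq npq.
have np' : pt p \notin src a by exact/basic_src/fixed_src.
have nq' : pt q \notin src a by exact/basic_src/fixed_src.
have npq' : p != pt q by apply: contraNneq nq' => <-; apply: fixed_src.
have nqp' : q != pt p by apply: contraNneq np' => <-; apply: fixed_src.
have bp := basic_mv ba fp; have bq := basic_mv ba fq.
have fpq : fixed (mv Z a p) q by rewrite fixed_mv // fq [q == p]eq_sym npq orbT.
have fqp : fixed (mv Z a q) p by rewrite fixed_mv // fp npq orbT.
have npq2 : pt p != pt q by rewrite (inj_eq (can_inj (partnerK Z))).
apply: diag_ext => [|y].
  apply/setP => y; rewrite !mem_src_mv //.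
  case: (altP (y =P pt p)) => [->|yp']; first by rewrite [pt p == q]eq_sym (negPf nqp') /= orbT.
  case: (altP (y =P pt q)) => [->|yq'] /=; first by rewrite [pt q == p]eq_sym (negPf npq').
  by case: (y == p); case: (y == q).
rewrite mem_src_mv // mem_src_mv //.
case: (altP (y =P pt q)) => [-> _|yq'] /=.
  by rewrite fn_mv_partner // fn_mv ?fn_mv_partner // ?mem_src_mv ?eqxx // eq_sym.
case/andP => yq; case: (altP (y =P pt p)) => [-> _|yp'] /=.
  by rewrite fn_mv_partner // fn_mv ?fn_mv_partner // ?mem_src_mv ?eqxx // eq_sym.
by case/andP => yp ya; rewrite !fn_mv // mem_src_mv // ?yp ?yq ya !orbT.
Qed.

(** One strand ends at p and another one starts there. *)
Definition broken a p := [&& p \in src a, p \in tgt a & fn a p != p].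

Lemma broken_fixed a p : broken a p -> fixed a p = false.
Proof. by case/and3P => _ _ np; rewrite /fixed (negPf np) andbF. Qed.

Lemma broken_mv a p q : basic a -> fixed a p -> broken (mv Z a p) q = broken a q.
Proof.
move=> ba fa; have np' : pt p \notin src a by exact/basic_src/fixed_src.
rewrite /broken mem_src_mv // mem_tgt_mv //.
case: (altP (q =P pt p)) => [->|qp'] /=; first by rewrite fn_mv_partner // eqxx (negPf np').
case: (altP (q =P p)) => [->|qp] /=; first by rewrite fixed_fn // eqxx !andbF.
by case qa: (q \in src a) => //=; rewrite fn_mv.
Qed.

Lemma broken_partner a p : basic a -> broken a p -> broken a (pt p) = false.
Proof. by move=> ba /and3P[pa _ _]; rewrite /broken (negPf (basic_src ba pa)). Qed.

Variables (s t : {set 'I_(2 * k)}) (h : chain (4 * k)).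
Local Notation B := (in_complex Z s t h).
Local Notation Int := (in_int_supp h).

Lemma in_complex_basic a : B a -> basic a. Proof. by case/and3P. Qed.
Lemma in_complex_chain a : B a -> chain_of a = h. Proof. by case/and3P => _ _ /eqP. Qed.

Lemma in_complex_src a p : B a -> (Z p \in s) = (p \in src a) || (pt p \in src a).
Proof.
case/and3P => _ /andP[/eqP <- _] _; apply/imsetP/orP => [[q qa /pairing_inj[->|->]]|].
- by left.
- by rewrite partnerK; right.
by case=> pa; [exists p | exists (pt p); rewrite ?pairing_partner].
Qed.

Lemma in_complex_tgt a p : B a -> (Z p \in t) = (p \in tgt a) || (pt p \in tgt a).
Proof.
case/and3P => _ /andP[_ /eqP <-] _; apply/imsetP/orP => [[q qa /pairing_inj[->|->]]|].
- by left.
- by rewrite partnerK; right.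
by case=> pa; [exists p | exists (pt p); rewrite ?pairing_partner].
Qed.

Lemma broken_classes a p : B a -> broken a p -> Z p \in s :&: t.
Proof.
move=> Ba /and3P[ps pt' _]; rewrite inE (in_complex_src _ Ba) (in_complex_tgt _ Ba).
by rewrite ps pt'.
Qed.

Lemma above_neq0 a p : B a -> (mult_above h p != 0) = (0 < #|strands_over a p|)%N.
Proof. by move=> /in_complex_chain <-; rewrite mult_aboveE eqz_nat lt0n. Qed.

Lemma below_neq0 a p : B a ->
  (mult_below h p != 0) = (0 < #|[set y in src a | (y < p <= fn a y)%N]|)%N.
Proof. by move=> /in_complex_chain <-; rewrite mult_belowE eqz_nat lt0n. Qed.

Lemma broken_int a p : B a -> broken a p -> Int p.
Proof.
move=> Ba /and3P[pa pt' np]; have gp := fn_ge pa.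
rewrite /in_int_supp (above_neq0 _ Ba) (below_neq0 _ Ba); apply/andP; split.
  by apply/card_gt0P; exists p; rewrite inE pa leqnn /= ltn_neqAle gp andbT eq_sym.
move: pt'; rewrite mem_tgt => /exists_inP[y ya /eqP fy].
apply/card_gt0P; exists y; rewrite inE ya fy leqnn andbT /=.
rewrite ltn_neqAle -{2}fy fn_ge // andbT; apply: contraNneq np => /val_inj e.
by rewrite -{1}e fy.
Qed.

Hypothesis thin : forall a, B a -> forall m, (#|strands_over a m| <= 1)%N.

Lemma overlap_eq a (m : nat) y z : B a -> y \in src a -> z \in src a ->
  (y <= m < fn a y)%N -> (z <= m < fn a z)%N -> y = z.
Proof.
move=> Ba ya za hy hz; apply: (card_le1_eqP (thin Ba m)); rewrite inE ?ya ?za //.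
Qed.

(** If the strand at j were not constant, both strands would pass over the arc that
    starts at j. *)
Lemma inversion_fixed a i j : B a -> i \in src a -> j \in src a -> (i < j)%N ->
  (fn a j < fn a i)%N -> fixed a j.
Proof.
move=> Ba ia ja lij fji; rewrite /fixed ja /=; apply: contraTT lij => nj.
have gj : (j < fn a j)%N by rewrite ltn_neqAle eq_sym nj fn_ge.
have e : i = j \/ (j <= i)%N.
  case: (leqP j i) => h1; first by right.
  by left; apply: (@overlap_eq a j) => //; rewrite ?leqnn ?gj // (ltnW h1) (ltn_trans gj).
by case: e => [->|]; rewrite -leqNgt ?leqnn.
Qed.

Lemma int_strand a e : B a -> Int e -> fixed a e ->
  exists i, [/\ i \in src a, (i < e)%N & (e < fn a i)%N].
Proof.
move=> Ba /andP[ha _] fe; move: ha; rewrite (above_neq0 _ Ba) => /card_gt0P[i].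
rewrite inE => /and3P[ia h1 h2]; exists i; split=> //.
by rewrite ltn_neqAle h1 andbT; apply: contraTneq h2 => /val_inj ->; rewrite fixed_fn // ltnn.
Qed.

(** The multiplicities just above and just below e are both one, so the boundary of
    the chain vanishes at e. *)
Lemma int_src_tgt a e : B a -> Int e -> (e \in src a) = (e \in tgt a).
Proof.
move=> Ba /andP[ha hb]; have cb := card_below_above a e.
move: ha hb; rewrite (above_neq0 _ Ba) (below_neq0 _ Ba) => ha hb.
have le1 := thin Ba e.
have le2 : (#|[set y in src a | (y < e <= fn a y)%N]| <= 1)%N.
  case: (posnP e) => e0; first by rewrite (_ : [set _ in _ | _] = set0) ?cards0 //;
    apply/setP => y; rewrite !inE e0 ltn0 andbF.
  apply: leq_trans (thin Ba e.-1); apply: subset_leq_card; apply/subsetP => y.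
  by rewrite !inE; case: (y \in src a) => //=; lia.
by move: cb ha hb le1 le2; clear; case: (_ \in _); case: (_ \in _) => //=; lia.
Qed.

Lemma int_state a e : B a -> Int e -> Z e \in s :&: t ->
  [|| broken a e, broken a (pt e), fixed a e | fixed a (pt e)].
Proof.
move=> Ba ie; rewrite inE (in_complex_src _ Ba) (in_complex_tgt _ Ba) => /andP[].
rewrite /broken /fixed -(int_src_tgt Ba ie).
case es: (e \in src a) => /=; first by case: (_ == _); rewrite ?orbT.
by move=> -> -> /=; case: (_ == _); rewrite ?orbT.
Qed.

Lemma swap_broken a i e q : swappable a i e -> fixed a e -> (i < e)%N -> (e < fn a i)%N ->
  q != e -> broken (swap a i e) q = broken a q.
Proof.
move=> sw fe lie fie qe; rewrite /broken src_swap // tgt_swap //.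
case qa: (q \in src a) => //=; case: (q \in tgt a) => //=; rewrite fn_swap //.
case: (tpermP i e q) => [->|e1|//]; last by rewrite e1 eqxx in qe.
by rewrite (fixed_fn fe) -!val_eqE /=; lia.
Qed.

(** Resolving the crossing of a constant strand with the strand that passes over it
    breaks that strand.  Nothing lies in between, since the strand over e is alone. *)
Lemma break_spec a i e : B a -> fixed a e -> i \in src a -> (i < e)%N -> (e < fn a i)%N ->
  [/\ swappable a i e, cov a (swap a i e), B (swap a i e), broken (swap a i e) e &
      fn (swap a i e) i = e].
Proof.
move=> Ba fe ia lie fie; have ea := fixed_src fe; have ffe := fixed_fn fe.
have fei : (fn a e < fn a i)%N by rewrite ffe.
have sw := inversion_swappable ia ea lie fei.
have cv : cov a (swap a i e).
  apply/covP; exists i, e; split=> //; split=> //.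
  rewrite num_inv_swap // num_invE; apply: inv_swap_eq => // y ya /andP[iy ye].
  apply/negP => /andP[h1 h2]; rewrite ffe in h1.
  have : i = y.
    apply: (@overlap_eq a y) => //; first by rewrite (ltnW iy); lia.
    by rewrite leqnn /=; lia.
  by move=> e1; rewrite e1 ltnn in iy.
split=> //; first by rewrite (in_complex_cov _ _ _ _ cv).
  rewrite /broken src_swap // ea tgt_swap // fixed_tgt //= fn_swap // tpermR.
  by rewrite -val_eqE /=; lia.
by rewrite fn_swap // tpermL.
Qed.

(** The inverse operation: the strands before and after a break are joined, and a
    constant strand is put at the break. *)
Lemma mend_spec v e : B v -> broken v e -> exists i,
  [/\ i \in src v, fn v i = e, swappable v i e & [/\ B (swap v i e), fixed (swap v i e) e,
     (i < e)%N & (e < fn (swap v i e) i)%N]].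
Proof.
move=> Bv /and3P[ea et ne]; move: (et); rewrite mem_tgt => /exists_inP[i ia /eqP fi].
have gi := fn_ge ia; have ge := fn_ge ea; rewrite fi in gi.
have ie : i != e by apply: contraNneq ne => e1; rewrite -{1}e1 fi.
have lie : (i < e)%N by rewrite ltn_neqAle gi andbT.
have lef : (e < fn v e)%N by rewrite ltn_neqAle ge andbT eq_sym.
have sw : swappable v i e by rewrite /swappable ia ea fi leqnn andbT /=; lia.
exists i; split=> //; split=> //.
- have /and3P[bv st ch] := Bv.
  have e1 : chain_of (swap v i e) = chain_of v.
    by apply: chain_of_src_tgt; rewrite ?src_swap ?tgt_swap.
  by rewrite /in_complex /between /is_basic src_swap // tgt_swap // e1; apply/and3P.
- by rewrite /fixed src_swap // ea fn_swap // tpermR fi eqxx.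
by rewrite fn_swap // tpermL.
Qed.

(** With multiplicities at most one, this is the only kind of crossing. *)
Lemma cov_break a v : B a -> cov a v -> exists i e,
  [/\ fixed a e, i \in src a, (i < e)%N, (e < fn a i)%N & v = swap a i e /\
      (Int e /\ Z e \in s :&: t)].
Proof.
move=> Ba av; case/covP: (av) => i [e [ia ea lie fei [vE _]]].
have fe := inversion_fixed Ba ia ea lie fei; have ffe := fixed_fn fe.
rewrite ffe in fei; exists i, e; split=> //; split=> //.
have [_ _ Bv bv _] := break_spec Ba fe ia lie fei.
split; first exact: broken_int Bv bv.
exact: broken_classes Bv bv.
Qed.

(** In each pair of s :&: t that meets the interior of the support, one interior
    point is selected.  Such a pair is broken at one of its two points or carries a
    constant strand.  The diagrams that are broken at the selected point of a pair
    are matched with those in which the pair is constant; this is done for the first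
    pair that is not broken at the other point.  A pair with a single interior
    point is never broken at the other one.  The selection is left open because
    different applications need different critical diagrams. *)
Variable elig : pred point.
Hypothesis elig_int : forall e, elig e -> Int e /\ Z e \in s :&: t.
Hypothesis elig_xor : forall e, Int e -> Z e \in s :&: t -> elig (pt e) = ~~ elig e.

Lemma elig_partner e : elig e -> elig (pt e) = false.
Proof. by move=> ee; have [ie ze] := elig_int ee; rewrite elig_xor // ee. Qed.

(** The selected point of the first pair that is not broken at its other point. *)
Definition first_free a : option point :=
  [pick e | [&& elig e, ~~ broken a (pt e) &
     [forall (e1 : point | (e1 < e)%N), elig e1 ==> broken a (pt e1)]]].

Lemma first_freeP a e : first_free a = Some e <->
  [/\ elig e, ~~ broken a (pt e) & forall e1, (e1 < e)%N -> elig e1 -> broken a (pt e1)].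
Proof.
have spec e2 : [&& elig e2, ~~ broken a (pt e2) &
     [forall (e1 : point | (e1 < e2)%N), elig e1 ==> broken a (pt e1)]] ->
   [/\ elig e2, ~~ broken a (pt e2) & forall e1, (e1 < e2)%N -> elig e1 -> broken a (pt e1)].
  by case/and3P => ee nb /forall_inP hh; split=> // e1 /hh /implyP.
rewrite /first_free; case: pickP => [e2 /spec[ee nb hh]|none]; split.
- by case=> <-.
- case=> ee' nb' hh'; congr Some; apply: val_inj => /=.
  case: (ltngtP e2 e) => // lt.
    by rewrite hh' in nb.
  by rewrite hh in nb'.
- by [].
case=> ee nb hh; have /negP[] := none e; rewrite ee nb /=.
by apply/forall_inP => e1 /hh h1; apply/implyP.
Qed.

Lemma first_free_None a : first_free a = None -> forall e, elig e -> broken a (pt e).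
Proof.
move=> none e; have [m] := ubnP e; elim: m e => // m IH e le_m ee.
apply/negPn/negP => nb.
have /first_freeP : [/\ elig e, ~~ broken a (pt e) & forall e1, (e1 < e)%N -> elig e1 -> broken a (pt e1)].
  by split=> // e1 l1 ee1; apply: IH => //; lia.
by rewrite none.
Qed.

Lemma eq_first_free a b : (forall e, elig e -> broken a (pt e) = broken b (pt e)) ->
  first_free a = first_free b.
Proof.
move=> eb; case fb: (first_free b) => [e|].
  move/first_freeP: fb => [ee nb hh]; apply/first_freeP; split=> //; first by rewrite eb.
  by move=> e1 l1 ee1; rewrite eb // hh.
case fa: (first_free a) => [e|//]; move/first_freeP: fa => [ee nb hh].
by rewrite eb // (first_free_None fb) in nb.
Qed.

Definition unbroken a := if first_free a is Some e then ~~ broken a e else false.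
Definition broken_first a := if first_free a is Some e then broken a e else false.

Definition strand_over a e := odflt e [pick i | [&& i \in src a, (i < e)%N & (e < fn a i)%N]].
Definition strand_to a e := odflt e [pick i | (i \in src a) && (fn a i == e)].

(** The constant strand is first moved to the selected point if necessary. *)
Definition break_first a := if first_free a is Some e then
  let b := if fixed a e then a else mv Z a (pt e) in swap b (strand_over b e) e else a.
Definition mend_first a :=
  if first_free a is Some e then swap a (strand_to a e) e else a.
Definition break_rank a : nat := if first_free a is Some e then e else 0%N.

Lemma strand_overE a e i : B a -> i \in src a -> (i < e)%N -> (e < fn a i)%N ->
  strand_over a e = i.
Proof.
move=> Ba ia lie fie; rewrite /strand_over; case: pickP => [j /and3P[ja h1 h2]|/(_ i)] /=.
  by apply: (@overlap_eq a e) => //; rewrite ?(ltnW h1) ?(ltnW lie).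
by rewrite ia lie fie.
Qed.

Lemma strand_toE a e i : i \in src a -> fn a i = e -> strand_to a e = i.
Proof.
move=> ia fi; rewrite /strand_to; case: pickP => [j /andP[ja /eqP fj]|/(_ i)] /=.
  by apply: (@fn_inj _ a); rewrite // fi.
by rewrite ia fi eqxx.
Qed.

Lemma first_free_mv a p : B a -> fixed a p -> first_free (mv Z a p) = first_free a.
Proof.
move=> Ba fa; apply: eq_first_free => e _; apply: broken_mv => //.
exact: in_complex_basic Ba.
Qed.

Lemma first_free_swap a i e : elig e -> swappable a i e -> fixed a e -> (i < e)%N ->
  (e < fn a i)%N -> first_free (swap a i e) = first_free a.
Proof.
move=> ee sw fe lie fie; apply: eq_first_free => e1 ee1; apply: swap_broken => //.
by apply/eqP => e2; have := elig_partner ee1; rewrite e2 ee.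
Qed.

(** The diagram with the key of a whose constant strand sits at the selected point
    of the first free pair. *)
Lemma unbroken_fixed a e : B a -> unbroken a -> first_free a = Some e ->
  let b := if fixed a e then a else mv Z a (pt e) in
  [/\ B b, fixed b e, first_free b = Some e, maslov b = maslov a &
      forall x, in_pmc Z x -> x b = x a].
Proof.
move=> Ba; rewrite /unbroken => + fa; rewrite fa => nbe.
have ba := in_complex_basic Ba.
have [ee nb _] := (first_freeP a e).1 fa; have [ie ze] := elig_int ee.
have := int_state Ba ie ze; rewrite (negPf nbe) (negPf nb) /=.
case fe: (fixed a e) => /=; first by [].
move=> fe'; split.
- by rewrite in_complex_mv.
- by have := fixed_mv_partner ba fe'; rewrite partnerK.
- by rewrite first_free_mv.
- exact: maslov_mv.
by move=> x [_ xm]; apply: xm.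
Qed.

Lemma break_strand_mv x a p e : in_pmc Z x -> B a -> Int e -> fixed a e -> fixed a p -> p != e ->
  x (swap (mv Z a p) (strand_over (mv Z a p) e) e) = x (swap a (strand_over a e) e).
Proof.
move=> [_ xm] Ba ie fe fp pe; have ba := in_complex_basic Ba.
have [i [ia lie fie]] := int_strand Ba ie fe.
have [sw _ _ _ _] := break_spec Ba fe ia lie fie.
have ip : i != p.
  by apply: contraTneq (ltn_trans lie fie) => ->; rewrite fixed_fn // ltnn.
have ep : e != p by rewrite eq_sym.
have Bm : B (mv Z a p) by rewrite in_complex_mv.
have im : i \in src (mv Z a p) by rewrite mem_src_mv // ip ia orbT.
have fim : (e < fn (mv Z a p) i)%N by rewrite fn_mv.
rewrite (strand_overE Bm im lie fim) (strand_overE Ba ia lie fie).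
have [fs bs ->] := swap_mv ba fp sw ip ep.
exact: xm.
Qed.

(** Resolving a crossing breaks one pair and leaves the others as they are.  If the
    result is broken at the selected point of its first free pair, then either that
    crossing is the matched one, or the first free pair was broken at its other
    point and the next free pair comes later. *)
Lemma matching x l : complex_elt Z s t l h x -> (forall v, broken_first v -> sdiff x v = 0) ->
  exists2 y, complex_elt Z s t (l + 1) h y &
    forall a, unbroken a || broken_first a -> (x + sdiff y) a = 0.
Proof.
apply: (@morse k Z s t h unbroken broken_first break_first mend_first break_rank).
- move=> a p Ba fa; rewrite /unbroken first_free_mv //.
  by case: (first_free a) => // e; rewrite broken_mv // (in_complex_basic Ba).
- move=> {}x a p xP Ba Ua fap; have ba := in_complex_basic Ba.
  case fa: (first_free a) => [e|]; last by move: Ua; rewrite /unbroken fa.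
  have [ee nb _] := (first_freeP a e).1 fa; have [ie ze] := elig_int ee.
  have nbe : ~~ broken a e by move: Ua; rewrite /unbroken fa.
  have fee' := int_state Ba ie ze; rewrite (negPf nbe) (negPf nb) /= in fee'.
  rewrite /break_first first_free_mv // fa fixed_mv //.
  case: (boolP (fixed a e)) fee' => [fe _|fe /= fe'].
    have npe : e == pt p = false.
      by apply/eqP => epp; have := fixed_partner ba fap; rewrite -epp fe.
    rewrite npe andbT /=; case: (altP (e =P p)) => [ep|nep] /=; first by rewrite ep mvK.
    by apply: break_strand_mv => //; rewrite eq_sym.
  have -> : (e == pt p) || (e != p) && false = (p == pt e).
    by rewrite andbF orbF -[RHS](inj_eq (can_inj (partnerK Z))) partnerK eq_sym.
  case: (altP (p =P pt e)) => [-> //|npe].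
  rewrite mvC //; apply: break_strand_mv => //.
  - by rewrite in_complex_mv.
  - by have := fixed_mv_partner ba fe'; rewrite partnerK.
  - by rewrite fixed_mv // npe fap orbT.
  by apply/eqP => pe; rewrite -pe fap in fe.
- move=> a Ba Ua; case fa: (first_free a) => [e|]; last by move: Ua; rewrite /unbroken fa.
  have := unbroken_fixed Ba Ua fa; rewrite /break_first fa.
  set b := if _ then _ else _; case=> Bb fb ffb mb _.
  have [ee _ _] := (first_freeP a e).1 fa.
  have [ie ze] := elig_int ee.
  have [i [ib lie fie]] := int_strand Bb ie fb.
  rewrite (strand_overE Bb ib lie fie).
  have [sw cv Bs br _] := break_spec Bb fb ib lie fie.
  split=> //; last by rewrite -mb (cov_maslov cv).
  by rewrite /broken_first first_free_swap // ffb.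
- move=> v Bv; rewrite /broken_first; case fv: (first_free v) => [e|] // bv.
  have [ee _ _] := (first_freeP v e).1 fv.
  have [i [iv fi sw [Bu fu lie fie]]] := mend_spec Bv bv.
  rewrite /mend_first fv (strand_toE iv fi).
  have iu : i \in src (swap v i e) by rewrite src_swap.
  have [sw' cv _ _ _] := break_spec Bu fu iu lie fie.
  have ffu : first_free (swap v i e) = Some e.
    by rewrite -(first_free_swap ee sw' fu lie fie) swapK.
  rewrite swapK // in cv; split=> //.
    by rewrite /unbroken ffu; apply/negP => /broken_fixed; rewrite fu.
  by rewrite /break_first ffu fu (strand_overE Bu iu lie fie) swapK.
- move=> {}x a xP Ba Ua; case fa: (first_free a) => [e|]; last by move: Ua; rewrite /unbroken fa.
  have := unbroken_fixed Ba Ua fa; rewrite /break_first fa.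
  set b := if _ then _ else _; case=> Bb fb ffb _ xb.
  have [ee _ _] := (first_freeP a e).1 fa.
  have [ie ze] := elig_int ee.
  have [i [ib lie fie]] := int_strand Bb ie fb.
  rewrite (strand_overE Bb ib lie fie).
  have [sw cv Bs br fse] := break_spec Bb fb ib lie fie.
  rewrite /mend_first first_free_swap // ffb (@strand_toE _ _ i) ?src_swap //.
  by rewrite swapK // xb.
- move=> a v Ba Dv av; rewrite /unbroken /broken_first.
  case fa: (first_free a) => [e|]; first by case: (broken a e).
  have [i [e [fe ia lie fie [_ [ie ze]]]]] := cov_break Ba av.
  have ba := in_complex_basic Ba.
  case ee: (elig e); last first.
    have := elig_xor ie ze; rewrite ee => /(first_free_None fa); rewrite partnerK.
    by move/broken_fixed; rewrite fe.
  have /and3P[h1 _ _] := first_free_None fa ee.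
  by have := basic_src ba (fixed_src fe); rewrite h1.
move=> a v Ba Ua Dv av nav.
have [i [e [fe ia lie fie [vE [ie ze]]]]] := cov_break Ba av.
have ba := in_complex_basic Ba.
have [sw _ Bv bv fiv] := break_spec Ba fe ia lie fie; rewrite -vE in Bv bv fiv.
case fa: (first_free a) => [e0|]; last by move: Ua; rewrite /unbroken fa.
have [ee0 nb0 hh0] := (first_freeP a e0).1 fa.
have [ie0 ze0] := elig_int ee0.
have -> : break_rank (break_first a) = e0.
  have := unbroken_fixed Ba Ua fa; rewrite /break_first fa.
  set b := if _ then _ else _; case=> Bb fb ffb mb _.
  have [i' [ib lie' fie']] := int_strand Bb ie0 fb.
  rewrite (strand_overE Bb ib lie' fie').
  have [sw' _ _ _ _] := break_spec Bb fb ib lie' fie'.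
  by rewrite /break_rank first_free_swap // ffb.
have same q : q != e -> broken v q = broken a q by move=> qe; rewrite vE; apply: swap_broken.
have nbae : ~~ broken a e0 by move: Ua; rewrite /unbroken fa.
move: Dv; rewrite /broken_first /break_rank; case fv: (first_free v) => [e1|] // bv1.
have [ee1 nb1 hh1] := (first_freeP v e1).1 fv.
case: (ltngtP e0 e1) => // [lt|/val_inj e01].
  exfalso; have := hh0 _ lt ee1; rewrite -same ?(negPf nb1) //.
  apply/negP => /eqP epe.
  by have := broken_fixed (hh0 _ lt ee1); rewrite epe fe.
exfalso; subst e1; have [ee|ne] := eqVneq e0 e; last by rewrite same // (negPf nbae) in bv1.
case/negP: nav; apply/eqP; rewrite /mend_first fv (@strand_toE _ _ i).
- by rewrite ee vE swapK.
- by rewrite vE src_swap.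
by rewrite ee.
Qed.

(** Up to boundaries, only diagrams that break every pair at the point that is not
    selected matter. *)
Lemma critical_representative x l : complex_elt Z s t l h x ->
  (forall v, (exists2 e, elig e & ~~ broken v (pt e)) -> sdiff x v = 0) ->
  exists2 y, complex_elt Z s t (l + 1) h y &
    forall a e, elig e -> ~~ broken a (pt e) -> (x + sdiff y) a = 0.
Proof.
move=> xW dx0; have [|y yW xy] := matching xW.
  move=> v; rewrite /broken_first; case fv: (first_free v) => [e|] // _.
  by have [ee nb _] := (first_freeP v e).1 fv; apply: dx0; exists e.
exists y => // a e ee nb; apply: xy; rewrite /unbroken /broken_first.
case fa: (first_free a) => [e1|]; first by case: (broken a e1).
by rewrite (first_free_None fa ee) in nb.
Qed.

End Thin.

(** * Crossingless diagrams *)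

Section Crossingless.

Variables (k : nat) (Z : pmc k).
Local Notation point := 'I_(4 * k).
Implicit Types (a b c v : diagram (4 * k)) (x : strands (4 * k)) (i j p q e y z : point).
Local Notation basic := (is_basic Z).
Local Notation pt := (partner Z).
Variables (s t : {set 'I_(2 * k)}) (h : chain (4 * k)).
Local Notation B := (in_complex Z s t h).
Local Notation Int := (in_int_supp h).

Lemma sum_class (S : {set point}) (c : 'I_(2 * k)) :
  (forall p, p \in S -> pt p \notin S) ->
  \sum_(p | Z p == c) ((p \in S)%:Z : int) = (c \in Z @: S)%:R.
Proof.
move=> hS; case: imsetP => [[q qS ->]|nc].
  rewrite (bigD1 q) //= qS big1 ?addr0 // => p /andP[/eqP zp npq].
  by case: (pairing_inj zp) => e; [rewrite e eqxx in npq | rewrite e (negPf (hS _ qS))].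
rewrite big1 // => p /eqP zp; case pS: (p \in S) => //.
by case: nc; exists p.
Qed.

Lemma in_complex_compatible a : B a -> compatible Z s t h.
Proof.
case/and3P => /is_basicP[sa ta] /andP[/eqP <- /eqP <-] /eqP <- c.
under eq_bigr => p _ do rewrite chain_bndE.
by rewrite sumrB !sum_class.
Qed.

Lemma thin01 : multiplicities01 h -> forall a, B a -> forall m, (#|strands_over a m| <= 1)%N.
Proof.
move=> h01 a Ba m; case: (ltnP m (4 * k).-1) => hm; last by rewrite over_last.
have := h01 (Ordinal hm); rewrite -(in_complex_chain Ba) chain_ofE /=.
by case=> /eqP; rewrite eqz_nat => /eqP ->.
Qed.

Section Thin.

Hypothesis thin : forall a, B a -> forall m, (#|strands_over a m| <= 1)%N.

Lemma inversion_exists a : num_inv (val a) != 0%N -> exists i j,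
  [/\ i \in src a, j \in src a, (i < j)%N & (fn a j < fn a i)%N].
Proof.
rewrite num_invE cards_eq0 => /set0Pn[[i j]]; rewrite inE => /and4P[*].
by exists i, j.
Qed.

Lemma crossing_cov a : B a -> num_inv (val a) != 0%N -> exists v, cov a v.
Proof.
move=> Ba /inversion_exists[i [j [ia ja lij fji]]].
have fj := inversion_fixed thin Ba ia ja lij fji.
rewrite (fixed_fn fj) in fji; exists (swap a i j).
by have [] := break_spec thin Ba fj ia lij fji.
Qed.

Lemma crossingless_fixed a e : B a -> num_inv (val a) = 0%N -> Int e -> fixed a e = false.
Proof.
move=> Ba a0 ie; apply/negP => fe; have [i [ia lie fie]] := int_strand Ba ie fe.
have : (i, e) \in inv_pairs (src a) (fn a).
  by rewrite inE /= ia (fixed_src fe) lie (fixed_fn fe).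
by move/eqP: a0; rewrite num_invE cards_eq0 => /eqP ->; rewrite inE.
Qed.

(** A crossing is one of a strand with a constant strand at an interior point, but
    a critical diagram has a break in every pair that meets the interior. *)
Lemma critical_crossingless (elig : pred point) a :
  (forall e, Int e -> Z e \in s :&: t -> elig (pt e) = ~~ elig e) ->
  B a -> (forall e, elig e -> broken a (pt e)) -> num_inv (val a) = 0%N.
Proof.
move=> elig_xor Ba crit; apply/eqP/negPn/negP => /(crossing_cov Ba)[v av].
have [i [e [fe ia lie fie [_ [ie ze]]]]] := cov_break thin Ba av.
case ee: (elig e).
  have /and3P[h1 _ _] := crit _ ee.
  by have := basic_src (in_complex_basic Ba) (fixed_src fe); rewrite h1.
have := elig_xor e ie ze; rewrite ee => /crit; rewrite partnerK.
by move/broken_fixed; rewrite fe.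
Qed.

(** Otherwise b breaks at the end of its strand, where a does not, because there the
    strand of a passes over. *)
Lemma no_shorter_strand a b : B a -> B b -> (forall p, broken b p -> broken a p) ->
  forall p, p \in src a -> p \in src b -> (p < fn b p)%N -> (fn a p <= fn b p)%N.
Proof.
move=> Ba Bb ab p pa pb lpb; rewrite leqNgt; apply/negP => lt.
have ib : Int (fn b p).
  rewrite /in_int_supp (above_neq0 _ Ba) (below_neq0 _ Ba); apply/andP; split.
    by apply/card_gt0P; exists p; rewrite inE pa lt ltnW.
  by apply/card_gt0P; exists p; rewrite inE pa lpb ltnW.
have nb : fn b (fn b p) != fn b p.
  apply/eqP => e; have := fn_inj _ pb e; move: ib => ib.
  have qb : fn b p \in src b by rewrite (int_src_tgt thin Bb ib) fn_tgt.
  by move/(_ qb) => e2; rewrite e2 ltnn in lpb.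
have /ab /and3P[_ + na] : broken b (fn b p).
  by rewrite /broken (int_src_tgt thin Bb ib) fn_tgt.
rewrite mem_tgt => /exists_inP[w wa /eqP fw].
have gw := fn_ge wa; rewrite fw in gw.
have lw : (w < fn b p)%N.
  rewrite ltn_neqAle gw andbT; apply: contraNneq na => /val_inj e.
  by rewrite -{1}e fw.
have e : w = p.
  apply: (@overlap_eq _ Z s t h thin a (fn b p).-1) => //; rewrite ?fw; lia.
by rewrite -fw e ltnn in lt.
Qed.

(** If the strand of b over p started below p, then a would break at p, hence so
    would b. *)
Lemma moving_start a b p : B a -> B b -> (forall p, broken a p -> broken b p) ->
  p \in src a -> (p < fn a p)%N -> p \in src b /\ (p < fn b p)%N.
Proof.
move=> Ba Bb ab pa lp.
have gtb : broken b p -> p \in src b /\ (p < fn b p)%N.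
  by move=> /and3P[pb _ np]; split=> //; rewrite ltn_neqAle fn_ge // andbT eq_sym.
have : mult_above h p != 0.
  by rewrite (above_neq0 _ Ba); apply/card_gt0P; exists p; rewrite inE pa leqnn.
rewrite (above_neq0 _ Bb) => /card_gt0P[z]; rewrite inE => /and3P[zb h1 h2].
have [zp|nzp] := eqVneq z p; first by rewrite zp in zb h2.
have lzp : (z < p)%N by rewrite ltn_neqAle h1 andbT.
have : mult_below h p != 0.
  by rewrite (below_neq0 _ Bb); apply/card_gt0P; exists z; rewrite inE zb lzp ltnW.
rewrite (below_neq0 _ Ba) => /card_gt0P[w]; rewrite inE => /and3P[wa h3 h4].
have nwp : w != p by apply: contraTneq h3 => ->; rewrite ltnn.
have fw : fn a w = p.
  apply/eqP; apply: contraNT nwp => nfw; apply/eqP.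
  apply: (@overlap_eq _ Z s t h thin a p) => //; last by rewrite leqnn.
  by rewrite (ltnW h3) ltn_neqAle eq_sym nfw.
apply/gtb/ab; rewrite /broken pa -{1}fw fn_tgt //=.
by apply: contraTneq lp => ->; rewrite ltnn.
Qed.

(** The chain and the break points determine where moving strands start and, since
    strands do not overlap, where they end.  The remaining pairs of s are constant. *)
Lemma eq_broken_key a b : B a -> B b -> broken a =1 broken b -> key Z a = key Z b.
Proof.
have sub a' b' : B a' -> B b' -> broken a' =1 broken b' ->
    forall p q, p != q -> (p, q) \in val a' -> (p, q) \in val b'.
  move=> Ba Bb ab p q npq; rewrite !mem_diag => /andP[pa /eqP fp].
  have lp : (p < fn a' p)%N by rewrite ltn_neqAle fn_ge // andbT fp.
  have [|pb lpb] := @moving_start a' b' p Ba Bb _ pa lp; first by move=> r; rewrite ab.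
  rewrite pb -fp -val_eqE eqn_leq /=.
  rewrite (@no_shorter_strand b' a') // 1?(@no_shorter_strand a' b') // => r; by rewrite ab.
move=> Ba Bb ab; have ba r : broken b r = broken a r by rewrite ab.
have subf a' b' : B a' -> B b' -> broken a' =1 broken b' ->
    forall p, fixed a' p -> fixed b' p || fixed b' (pt p).
  move=> Ba' Bb' ab' p fp; have pa := fixed_src fp.
  have ba' r : broken b' r = broken a' r by rewrite ab'.
  have := in_complex_src p Ba'; rewrite pa => zp.
  have key_ q : q = p \/ q = pt p -> q \in src b' -> fixed b' q.
    move=> qp qb; rewrite /fixed qb /=; apply/negPn/negP => nq.
    have : (q, fn b' q) \in val a'.
      by apply: (sub b' a') => //; [rewrite eq_sym | apply: fn_in].
    rewrite mem_diag => /andP[qa /eqP fq]; case: qp => qp.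
      by rewrite -fq qp (fixed_fn fp) eqxx in nq.
    by have := basic_src (in_complex_basic Ba') pa; rewrite -qp qa.
  by move: zp; rewrite (in_complex_src _ Bb') => /orP[] qb; apply/orP; [left|right]; apply: key_ => //; [left|right].
apply: eq_key => [p q npq|p].
  by apply/idP/idP; apply: sub.
apply/orP/orP => -[fp|fp].
- by apply/orP/(subf a).
- by apply/orP; rewrite orbC -{2}(partnerK Z p); apply: (subf a).
- by apply/orP/(subf b).
by apply/orP; rewrite orbC -{2}(partnerK Z p); apply: (subf b).
Qed.

Hypothesis interior : matched_interior_cond Z s t h.

Lemma int_partner p : Z p \in s :&: t -> Int (pt p) = Int p.
Proof.
move=> zp; apply/idP/idP => ip; apply: contraTT zp => np.
  by rewrite -(pairing_partner Z p); apply: (interior _ ip np); rewrite pairing_partner.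
by apply: (interior _ ip np); rewrite pairing_partner.
Qed.

Lemma avg_mult_balanced a p : B a -> p \in src a -> p \in tgt a -> avg_mult h p = (Int p)%:R.
Proof.
move=> Ba pa pt'; rewrite /in_int_supp -(in_complex_chain Ba).
rewrite /avg_mult mult_aboveE mult_belowE.
have := card_below_above a p; rewrite pa pt' => /addIn ->; rewrite andbb eqz_nat.
rewrite -PoszD -pmulrn addnn -muln2 natrM mulfK //.
by have := thin Ba p; case: #|_| => [|[|]].
Qed.

(** If a and b start at different points of a pair, then the pair is in s and t and
    the boundary of the chain vanishes on it; both points have multiplicity one if
    one of them is interior, and multiplicity zero otherwise. *)
Lemma avg_mult_class a b p q : B a -> B b -> p \in src a -> q \in src b -> Z p = Z q ->
  avg_mult h p = avg_mult h q.
Proof.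
move=> Ba Bb pa qb zpq; case: (pairing_inj (esym zpq)) => [-> //|qp].
have pb : p \notin src b by rewrite -(partnerK Z p) -qp basic_src ?(in_complex_basic Bb).
have qa : q \notin src a by rewrite qp basic_src ?(in_complex_basic Ba).
have bnd r : (r \in tgt a)%:Z - (r \in src a)%:Z = (r \in tgt b)%:Z - (r \in src b)%:Z.
  by rewrite -!chain_bndE (in_complex_chain Ba) (in_complex_chain Bb).
have pta : p \in tgt a.
  by have := bnd p; rewrite pa (negPf pb); case: (p \in tgt a); case: (p \in tgt b).
have qtb : q \in tgt b.
  by have := bnd q; rewrite qb (negPf qa); case: (q \in tgt a); case: (q \in tgt b).
rewrite (avg_mult_balanced Ba pa pta) (avg_mult_balanced Bb qb qtb) qp int_partner //.
by rewrite inE (in_complex_src _ Ba) (in_complex_tgt _ Ba) pa pta.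
Qed.

(** The Maslov degree and the number of crossings differ by a constant. *)
Lemma maslov_num_inv a b : B a -> B b ->
  maslov a + (num_inv (val b))%:R = maslov b + (num_inv (val a))%:R.
Proof.
move=> Ba Bb; rewrite /maslov (in_complex_chain Ba) (in_complex_chain Bb).
suff -> : \sum_(p in src a) avg_mult h p = \sum_(p in src b) avg_mult h p by lra.
rewrite (partition_big Z xpredT) //= [RHS](partition_big Z xpredT) //=.
apply: eq_bigr => c _; case: (boolP (c \in s)) => cs.
  have rep a' : B a' -> exists p, [/\ p \in src a', Z p = c &
      \sum_(q in src a' | Z q == c) avg_mult h q = avg_mult h p].
    case/and3P => ba' /andP[/eqP sa' _] _; move: cs; rewrite -sa' => /imsetP[p pa' cE].
    exists p; split=> //; rewrite (bigD1 p) /= ?pa' ?cE ?eqxx // big1 ?addr0 //.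
    move=> q /andP[/andP[qa /eqP zq] nqp]; case: (pairing_inj zq) => e.
      by rewrite e eqxx in nqp.
    by have := basic_src ba' pa'; rewrite -e qa.
  have [p [pa zp ->]] := rep a Ba; have [q [qb zq ->]] := rep b Bb.
  by apply: (avg_mult_class Ba Bb) => //; rewrite zp.
have none a' : B a' -> \sum_(q in src a' | Z q == c) avg_mult h q = 0.
  case/and3P => _ /andP[/eqP sa' _] _; apply: big_pred0 => q.
  apply: contraNF cs => /andP[qa /eqP <-]; rewrite -sa'; exact: imset_f.
by rewrite !none.
Qed.

End Thin.

End Crossingless.

(** * The homology of a summand *)

Section HomologyOfSummand.

Variables (k : nat) (Z : pmc k) (s t : {set 'I_(2 * k)}) (h : chain (4 * k)).
Local Notation point := 'I_(4 * k).
Implicit Types (a b c v : diagram (4 * k)) (x y : strands (4 * k)) (p q e : point) (l : rat).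
Local Notation basic := (is_basic Z).
Local Notation pt := (partner Z).
Local Notation B := (in_complex Z s t h).
Local Notation Int := (in_int_supp h).

Lemma summand_in l a : basic a -> summand Z s t l h a = B a && (maslov a == l).
Proof. by move=> ba; rewrite /summand /bideg /in_complex ba /= andbA andbAC. Qed.

Lemma complex_elt_support l x a : complex_elt Z s t l h x -> x a != 0 ->
  [/\ basic a, B a & maslov a = l].
Proof.
move=> [[xb _] xQ] xa; have ba := xb a xa.
by have := xQ a xa; rewrite summand_in // => /andP[Ba /eqP].
Qed.

Lemma complex_elt_E l a : B a -> maslov a = l -> complex_elt Z s t l h (E Z a).
Proof.
move=> Ba al; have ba := in_complex_basic Ba.
split=> [|b]; first exact: in_pmc_E.
rewrite (E_coef b ba); case: (boolP (basic b)) => bb; last by rewrite eqxx.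
case: (key Z a =P key Z b) => [kab _|_]; last by rewrite eqxx.
rewrite -(key_invariant (fun c p bc fc => summand_mv s t l h bc fc) ba bb kab).
by rewrite summand_in // Ba al eqxx.
Qed.

Lemma E_self a : basic a -> E Z a a = 1.
Proof. by move=> ba; rewrite (E_coef a ba) ba eqxx. Qed.

Lemma complex_elt_idem l x : complex_elt Z s t l h x <-> x \in (idem_alg Z s t :&: deg_part Z l h)%VS.
Proof.
rewrite memv_cap; split=> [[xP xQ]|/andP[/idem_algP[xP xst] /deg_partP[_ xd]]].
  by apply/andP; split; [apply/idem_algP | apply/deg_partP]; split=> // a /xQ/andP[].
by split=> // a xa; rewrite /summand xst ?xd.
Qed.

Lemma complex_elt_neq0 l x : complex_elt Z s t l h x -> x != 0 ->
  exists a, [/\ B a, maslov a = l & x a != 0].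
Proof.
move=> xW x0; case: (pickP (fun a => x a != 0)) => [a xa|none].
  by have [_ Ba al] := complex_elt_support xW xa; exists a.
case/eqP: x0; apply: strandsP => a; rewrite strands0.
by apply/eqP; have := none a => /negbFE.
Qed.

Lemma homology_neq0 l : idem_homology_deg Z s t l h <> 0%VS ->
  exists x, [/\ complex_elt Z s t l h x, sdiff x = 0 &
    forall y, in_pmc Z y -> x <> sdiff y].
Proof.
move=> H0; have : vpick (idem_homology_deg Z s t l h) != 0 by rewrite vpick0; apply/eqP.
have /idem_homology_degP[x [xW dx ->]] := memv_pick (idem_homology_deg Z s t l h).
move=> cx; exists x; split=> // y yP xy; case/eqP: cx; apply/eqP.
by rewrite -memv_ker lker_cls; apply/boundariesP; exists y.
Qed.

Section Necessary.

Variables (l : rat) (x : strands (4 * k)).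
Hypotheses (xW : complex_elt Z s t l h x) (dx : sdiff x = 0).
Hypothesis nbd : forall y, in_pmc Z y -> x <> sdiff y.

Lemma cycle_neq0 : x != 0.
Proof.
apply/eqP => x0; apply: (nbd (in_pmc0 Z)); rewrite x0.
by have := sdiffD 0 (0 : strands (4 * k)); rewrite addr0 => /esym/(canRL (addKr _)); rewrite addNr.
Qed.

Lemma homology_multiplicities01 : multiplicities01 h.
Proof.
have [a [Ba _ _]] := complex_elt_neq0 xW cycle_neq0.
move=> j; have hj := chain_ofE a j; rewrite (in_complex_chain Ba) in hj.
case: (ltnP 1 #|strands_over a j|) => [j2|]; last first.
  by rewrite hj; case: #|_| => [|[|]]; [left | right |].
have [|y yP xy] := @acyclic_multiplicity k Z s t l h j x _ xW dx; last by case: (nbd yP).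
move=> b Bb; have := chain_ofE b j; rewrite (in_complex_chain Bb) hj => /eqP.
by rewrite eqz_nat => /eqP <-.
Qed.

(** When both points of a pair are interior, the first one is selected. *)
Let elig p := [&& Int p, Z p \in s :&: t & ~~ (Int (pt p) && (pt p < p)%N)].

Let elig_int e : elig e -> Int e /\ Z e \in s :&: t.
Proof. by case/and3P. Qed.

Let elig_xor e : Int e -> Z e \in s :&: t -> elig (pt e) = ~~ elig e.
Proof.
move=> ie ze; rewrite /elig pairing_partner partnerK ie ze /= negbK.
case: (Int (pt e)) => //=; rewrite -leqNgt ltn_neqAle leq_eqVlt.
have : (val (pt e) != val e) by rewrite (inj_eq val_inj) partner_neq.
by move: (pt e) => e'; rewrite /=; lia.
Qed.

(** If the complex has a nonzero class in degree l, its critical representative is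
    nonzero. *)
Lemma homology_critical : exists a, [/\ B a, maslov a = l & forall e, elig e -> broken a (pt e)].
Proof.
have thin := @thin01 k Z s t h homology_multiplicities01.
have [|y yW xy] := critical_representative thin elig_int elig_xor xW.
  by move=> v _; rewrite dx strands0.
have cW : complex_elt Z s t l h (x + sdiff y).
  exact: complex_eltD xW (complex_elt_sdiff yW).
have c0 : x + sdiff y != 0.
  apply/eqP => c0; case: yW => yP _; apply: (nbd yP).
  apply: strandsP => a; have := congr1 (fun z : strands (4 * k) => z a) c0.
  rewrite strandsD strands0 => e; rewrite -[LHS]addr0 -(F2_addxx (sdiff y a)) addrA e.
  exact: add0r.
have [a [Ba al ca]] := complex_elt_neq0 cW c0.
exists a; split=> // e ee; apply/negPn/negP => nb.
by rewrite (xy a e ee nb) eqxx in ca.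
Qed.

Lemma homology_conditions_hold : homology_conditions Z s t l h.
Proof.
have h01 := homology_multiplicities01; have thin := @thin01 k Z s t h h01.
have [a [Ba al crit]] := homology_critical.
have interior : matched_interior_cond Z s t h.
  move=> p1 p2 zp i1 i2; apply/negP => z1.
  case: (pairing_inj (esym zp)) => p2E; first by rewrite p2E i1 in i2.
  have ee : elig p1 by rewrite /elig i1 z1 -p2E (negPf i2).
  by have := broken_int Ba (crit _ ee); rewrite -p2E (negPf i2).
split=> //; first exact: in_complex_compatible Ba.
split; first by exists x; [apply/complex_elt_idem | exact: cycle_neq0].
move=> l' x' /complex_elt_idem x'W x'0; have [b [Bb bl _]] := complex_elt_neq0 x'W x'0.
have a0 := critical_crossingless thin elig_xor Ba crit.
have := maslov_num_inv thin interior Ba Bb; rewrite a0 addr0 al bl => <-.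
by rewrite lerDl ler0n.
Qed.

End Necessary.

Section Sufficient.

Variable l : rat.
Hypothesis conds : homology_conditions Z s t l h.

Let h01 : multiplicities01 h. Proof. by case: conds. Qed.
Let interior : matched_interior_cond Z s t h. Proof. by case: conds. Qed.
Let thin := @thin01 k Z s t h h01.

(** Resolving a crossing would lower the Maslov degree. *)
Lemma minimal_crossingless a : B a -> maslov a = l -> num_inv (val a) = 0%N.
Proof.
move=> Ba al; apply/eqP/negPn/negP => /(crossing_cov thin Ba)[v av].
have Bv : B v by rewrite (in_complex_cov _ _ _ _ av).
have vl : maslov v = l - 1 by rewrite -al (cov_maslov av) addrK.
have [_ _ _ [_ mn]] := conds.
have Ev0 : E Z v != 0.
  apply/eqP => Ev; have := E_self (in_complex_basic Bv).
  by rewrite Ev strands0 => /eqP; rewrite eq_sym oner_eq0.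
have := mn (l - 1) _ ((complex_elt_idem _ _).1 (complex_elt_E Bv vl)) Ev0.
by rewrite -subr_ge0 addrAC subrr add0r oppr_ge0 ler10.
Qed.

Variable a : diagram (4 * k).
Hypotheses (Ba : B a) (al : maslov a = l).

Let a0 : num_inv (val a) = 0%N. Proof. exact: minimal_crossingless Ba al. Qed.
Let ba : basic a. Proof. exact: in_complex_basic Ba. Qed.

(** With this selection the moves of the given crossingless diagram are the only
    critical diagrams. *)
Let elig p := [&& Int p, Z p \in s :&: t & ~~ broken a p].

Let elig_int e : elig e -> Int e /\ Z e \in s :&: t.
Proof. by case/and3P. Qed.

Let elig_xor e : Int e -> Z e \in s :&: t -> elig (pt e) = ~~ elig e.
Proof.
move=> ie ze; rewrite /elig pairing_partner ie ze (int_partner interior ze) ie /= negbK.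
have := int_state thin Ba ie ze.
rewrite (crossingless_fixed Ba a0 ie) (crossingless_fixed (e := pt e) Ba a0); last first.
  by rewrite (int_partner interior ze).
rewrite !orbF; case be: (broken a e) => /=; first by rewrite (broken_partner ba be).
by move=> ->.
Qed.

Let critical_a e : elig e -> broken a (pt e).
Proof.
move=> ee; have [ie ze] := elig_int ee.
have := elig_xor ie ze; rewrite ee /= /elig pairing_partner ze (int_partner interior ze) ie /=.
by move/negbFE.
Qed.

Let critical_key b : B b -> (forall e, elig e -> broken b (pt e)) -> key Z a = key Z b.
Proof.
move=> Bb crit; apply: (eq_broken_key thin Ba Bb) => p; apply/idP/idP => [bp|].
  have ip := broken_int Ba bp; have zp := broken_classes Ba bp.
  have := elig_xor ip zp; rewrite {2}/elig bp !andbF /= => /crit.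
  by rewrite partnerK.
move=> bp; have ip := broken_int Bb bp; have zp := broken_classes Bb bp.
apply/negPn/negP => nb; have /crit : elig p by rewrite /elig ip zp nb.
by rewrite (broken_partner (in_complex_basic Bb) bp).
Qed.

Let critical_multiple l' x : complex_elt Z s t l' h x ->
  (forall b e, elig e -> ~~ broken b (pt e) -> x b = 0) -> x = (x a : 'F_2) *: E Z a.
Proof.
move=> xW xc; have [xP _] := xW; apply: strandsP => b.
rewrite [RHS]strandsZ (E_coef b ba).
case: (boolP (x b == 0)) => [/eqP xb|xb].
  case: (boolP (basic b)) => bb; last by rewrite mulr0.
  case: (key Z a =P key Z b) => [kab|_]; last by rewrite mulr0.
  by rewrite (in_pmc_key xP ba bb kab) xb mul0r.
have [bb Bb _] := complex_elt_support xW xb.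
have kab : key Z a = key Z b.
  apply: critical_key => // e ee; apply/negPn/negP => nb.
  by rewrite (xc b e ee nb) eqxx in xb.
by rewrite bb kab eqxx mulr1 (in_pmc_key xP ba bb kab).
Qed.

Lemma sdiff_E : sdiff (E Z a) = 0.
Proof.
apply: strandsP => v; rewrite strands0 sdiffE big1 // => b bv.
apply/eqP; apply: contraTT (erefl true) => Eb.
have [_ Bb bl] := complex_elt_support (complex_elt_E Ba al) Eb.
by have := cov_inv bv; rewrite (minimal_crossingless Bb bl).
Qed.

(** A primitive y of E(a) can be taken homogeneous, of degree l + 1.  Its differential
    vanishes off the critical diagrams, so y is itself homologous to a combination of
    critical diagrams; these live in degree l, hence y is a boundary and E(a) = 0. *)
Lemma cls_E_neq0 : cls Z (E Z a) != 0.
Proof.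
rewrite -memv_ker lker_cls; apply/negP => /boundariesP[y0 y0P Ey0].
have EW := complex_elt_E Ba al.
pose y := restrict (summand Z s t (l + 1) h) y0.
have yW : complex_elt Z s t (l + 1) h y by apply: complex_elt_restrict.
have dy : sdiff y = E Z a.
  rewrite sdiff_restrict -Ey0; apply: strandsP => b; rewrite restrictE.
  by case: ifP => // nb; apply/esym/eqP; apply: contraFT nb; case: EW => _; apply.
have [v [e ee nb]|z zW yz] := critical_representative thin elig_int elig_xor yW.
  rewrite dy (E_coef v ba); case: (boolP (basic v)) => bv //=.
  case: (key Z a =P key Z v) => [kav|//].
  have := key_invariant (fun c p bc fc => broken_mv (pt e) bc fc) ba bv kav.
  by rewrite (critical_a ee) (negPf nb).
have cW : complex_elt Z s t (l + 1) h (y + sdiff z).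
  exact: complex_eltD yW (complex_elt_sdiff zW).
have c0 : y + sdiff z = 0.
  rewrite (critical_multiple cW yz).
  have -> : (y + sdiff z) a = 0; last by rewrite scale0r.
  apply/eqP; apply: contraT => ca; have [_ _ al'] := complex_elt_support cW ca.
  by move: al'; rewrite al => /eqP; rewrite -subr_eq0 opprD addrA subrr add0r oppr_eq0 oner_eq0.
have : sdiff (y + sdiff z) = E Z a by rewrite sdiffD sdiff_sdiff addr0.
rewrite c0 => d0; have : E Z a a = 0.
  rewrite -d0 sdiffE big1 // => b _; exact: strands0.
by rewrite (E_self ba) => /eqP; rewrite oner_eq0.
Qed.

Lemma homology_line : idem_homology_deg Z s t l h = <[cls Z (E Z a)]>%VS.
Proof.
have clsZ (r : 'F_2) w : cls Z (r *: w) = r *: cls Z w by rewrite linearZ.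
apply/vspaceP => u; apply/idP/idP.
  case/idem_homology_degP => x [xW dx ->].
  have [|y yW xy] := critical_representative thin elig_int elig_xor xW.
    by move=> v _; rewrite dx strands0.
  have cW : complex_elt Z s t l h (x + sdiff y).
    exact: complex_eltD xW (complex_elt_sdiff yW).
  have cE := critical_multiple cW xy.
  have -> : cls Z x = cls Z (x + sdiff y).
    apply/cls_eq; rewrite opprD addrA subrr add0r rpredN.
    by apply/boundariesP; exists y => //; case: yW.
  rewrite cE; apply/vlineP; exists ((x + sdiff y) a : 'F_2).
  by apply: clsZ.
case/vlineP => r ->; apply/memvZ/idem_homology_degP.
by exists (E Z a); split=> //; [exact: complex_elt_E | exact: sdiff_E].
Qed.

End Sufficient.

End HomologyOfSummand.

Theorem theorem9 (k : nat) (Z : pmc k) (s t : {set 'I_(2 * k)})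
    (l : rat) (l_half_int : 2%:R * l \is a Num.int) (h : chain (4 * k)) :
  (idem_homology_deg Z s t l h <> 0%VS -> homology_conditions Z s t l h) /\
  (homology_conditions Z s t l h ->
     \dim (idem_homology_deg Z s t l h) = 1%N /\
     (forall a : diagram (4 * k),
        is_basic Z a -> E Z a \in idem_alg Z s t ->
        maslov a = l -> chain_of a = h -> num_inv (val a) = 0%N ->
        sdiff (E Z a) = 0 /\
        idem_homology_deg Z s t l h = <[cls Z (E Z a)]>%VS)).
Proof.
split=> [/homology_neq0[x [xW dx nbd]]|conds].
  exact: homology_conditions_hold xW dx nbd.
split.
  have [_ _ _ [[x /complex_elt_idem xW x0] _]] := conds.
  have [a [Ba al _]] := complex_elt_neq0 xW x0.
  by rewrite (homology_line conds Ba al) dim_vline (cls_E_neq0 conds Ba al).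
move=> a ba /idem_algP[_ Est] al ah _.
have Ba : in_complex Z s t h a.
  by rewrite /in_complex ba ah eqxx andbT; apply: Est; rewrite (E_self ba) oner_eq0.
by split; [exact: (sdiff_E conds Ba al) | exact: (homology_line conds Ba al)].
Qed.
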